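(* Suppose that the connection function satisfies $g(r) = o(r^{-c})$ as $r\to\infty$ for some $c>d$. Let $\theta$ be the volume of the unit ball in $\mathbb{R}^d$ and let $$\beta = \inf\left\{x>0 : x\, g\left(\frac{\alpha}{x\theta}\right) > 1\right\}.$$ For $\gamma>0$ define $\hat r_n(\gamma)$ by $\hat r_n(\gamma)^d = \frac{\gamma\log n}{\alpha n}$. Then for any $\gamma>\beta$, $$P\big(G_n(\hat r_n(\gamma)) \text{ is connected}\big) \to 1 \quad\text{as } n\to\infty.$$
   Context: Let $d \ge 2$ and $S = \left(-\frac12,\frac12\right]^d$, equipped with the toroidal metric $d(x,y) = \inf\{|x-y-z| : z \in \mathbb{Z}^d\}$, where $|\cdot|$ is the Euclidean norm. (The letter $d$ denotes the dimension; $d(\cdot,\cdot)$ denotes the metric.) The connection function $g:[0,\infty)\to[0,1]$ is non-increasing with $0 < \alpha := \int_{\mathbb{R}^d} g(|x|)\,dx < \infty$. On one probability space $(\Omega,\mathcal{F},P)$ let $X_1,X_2,\ldots$ be independent and uniformly distributed on $S$; let $\{N_n\}_{n\ge1}$ be a non-decreasing sequence of random variables with $N_n$ Poisson of mean $n$; and let $\{U_{ij}\}$ be independent uniform random variables on $[0,1]$; these three families are independent of each other. Set $\mathcal{P}_n = \{X_1,\ldots,X_{N_n}\}$, a Poisson point process of intensity $n$ on $S$. For $r>0$, $G_n(r)$ is the (undirected) graph with vertex set $\mathcal{P}_n$ in which $X_i,X_j\in\mathcal{P}_n$, $i<j$, are joined by an edge iff $U_{ij} \le g\left(\frac{d(X_i,X_j)}{r}\right)$.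 *)

(* Defs.v *)
From HB Require Import structures.
From mathcomp Require Import all_boot all_order all_algebra.
From mathcomp Require Import finmap.
From mathcomp Require Import all_classical all_reals all_analysis.

Set Implicit Arguments.
Unset Strict Implicit.
Unset Printing Implicit Defensive.

Import Order.TTheory GRing.Theory Num.Theory.
Import numFieldNormedType.Exports.

Local Open Scope classical_set_scope.
Local Open Scope ring_scope.

(* R^d is d.-tuple R with the product sigma-algebra of the library.
   The library has no Lebesgue measure on R^d; it is built here by recursion on
   d, transporting (Lebesgue on R) \x (Lebesgue on R^d) to R^(d+1). *)

Section cons_measure.
Context (R : realType) (d : nat).

Definition consT (p : R * d.-tuple R) : d.+1.-tuple R := [tuple of p.1 :: p.2].

Lemma behead_consT p : [tuple of behead (consT p)] = p.2.
Proof. exact/val_inj. Qed.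

Lemma measurable_consT : measurable_fun [set: (R * d.-tuple R)%type] consT.
Proof. exact: measurable_cons. Qed.

Lemma measurable_unconsT :
  measurable_fun [set: d.+1.-tuple R]
    (fun x => (thead x, [tuple of behead x]) : R * d.-tuple R).
Proof.
apply/measurable_fun_pairP; split.
  exact: measurable_tnth.
exact: measurable_behead.
Qed.

Definition cons_measure (m : set (d.-tuple R) -> \bar R) :
    set (d.+1.-tuple R) -> \bar R :=
  pushforward (@lebesgue_measure R \x m)%E consT.

Variable m : {sigma_finite_measure set (d.-tuple R) -> \bar R}.

Let cons_measure0 : cons_measure m set0 = 0%E.
Proof. by rewrite /cons_measure /pushforward preimage_set0 measure0. Qed.

Let cons_measure_ge0 A : (0 <= cons_measure m A)%E.
Proof. by rewrite /cons_measure /pushforward; exact: measure_ge0. Qed.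

Let cons_measure_sigma_additive : semi_sigma_additive (cons_measure m).
Proof.
move=> F mF tF mUF; rewrite /cons_measure /pushforward preimage_bigcup.
have mc A : measurable A -> measurable (consT @^-1` A).
  by move=> mA; rewrite -[X in measurable X]setTI; exact: measurable_consT.
apply: measure_semi_sigma_additive.
- by move=> n; exact: mc.
- apply/trivIsetP => /= i j _ _ ij; rewrite -preimage_setI.
  by move/trivIsetP : tF => /(_ _ _ _ _ ij) ->//; rewrite preimage_set0.
- by rewrite -preimage_bigcup; exact: mc.
Qed.

HB.instance Definition _ := isMeasure.Build _ _ _ (cons_measure m)
  cons_measure0 cons_measure_ge0 cons_measure_sigma_additive.

Let cons_measure_sigma_finite : sigma_finite setT (cons_measure m).
Proof.
have /sigma_finiteP[F [TF ndF Foo]] := sigma_finiteT (@lebesgue_measure R).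
have /sigma_finiteP[G [TG ndG Goo]] := sigma_finiteT m.
exists (fun n => (fun x => (thead x, [tuple of behead x])) @^-1` (F n `*` G n)).
  apply/esym; rewrite -subTset => x _.
  have [k _ Fk] : (\bigcup_i F i) (thead x) by rewrite -TF.
  have [l _ Gl] : (\bigcup_i G i) [tuple of behead x] by rewrite -TG.
  exists (maxn k l) => //; split => /=.
    by move: Fk; exact/subsetPset/ndF/leq_maxl.
  by move: Gl; exact/subsetPset/ndG/leq_maxr.
move=> n; have [mF Fn] := Foo n; have [mG Gn] := Goo n; split.
  rewrite -[X in measurable X]setTI; apply: measurable_unconsT => //.
  exact: measurableX.
rewrite /cons_measure /pushforward (_ : consT @^-1` _ = F n `*` G n).
  by rewrite product_measure1E// lte_mul_pinfty// ge0_fin_numE.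
apply/seteqP; split=> -[a t] /=; by rewrite theadE behead_consT.
Qed.

HB.instance Definition _ := Measure_isSigmaFinite.Build _ _ _ (cons_measure m)
  cons_measure_sigma_finite.

End cons_measure.

Fixpoint lebesgueRd (R : realType) (d : nat) :
    {sigma_finite_measure set (d.-tuple R) -> \bar R} :=
  match d return {sigma_finite_measure set (d.-tuple R) -> \bar R} with
  | 0 => \d_([tuple] : 0.-tuple R)
  | d'.+1 => cons_measure (lebesgueRd R d')
  end.

Lemma lebesgueRd_box (R : realType) (d : nat) (a b : d.-tuple R) :
  (forall i, tnth a i <= tnth b i) ->
  lebesgueRd R d [set x | forall i, tnth a i < tnth x i <= tnth b i] =
  (\prod_(i < d) (tnth b i - tnth a i))%:E.
Proof.
elim: d a b => [|d IH] a b ab.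
  rewrite big_ord0 /= diracE mem_set//= => -[]//.
pose a' := [tuple of behead a]; pose b' := [tuple of behead b].
have tS (x : d.+1.-tuple R) i : tnth x (lift ord0 i) = tnth [tuple of behead x] i.
  by rewrite [in LHS](tuple_eta x) tnthS.
rewrite big_ord_recl.
under eq_bigr do rewrite !tS.
rewrite EFinM -IH; last by move=> i; rewrite -!tS.
rewrite /= /cons_measure /pushforward.
rewrite (_ : _ @^-1` _ = `]tnth a ord0, tnth b ord0] `*`
   [set x | forall i, tnth a' i < tnth x i <= tnth b' i]).
  rewrite product_measure1E//=.
    rewrite lebesgue_measure_itv/= lte_fin; case: ltP => // ba.
    have -> : tnth b ord0 = tnth a ord0 by apply/eqP; rewrite eq_le ba ab.
    by rewrite subrr.
  rewrite (_ : [set _ | _] = \bigcap_(i in [set: 'I_d])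
     ((fun x : d.-tuple R => tnth x i) @^-1` `]tnth a' i, tnth b' i])).
    apply: fin_bigcap_measurable => // i _.
    rewrite -[X in measurable X]setTI; exact: measurable_tnth.
  apply/seteqP; split => x /= h i; first by move=> _; rewrite /= in_itv/=; exact: h.
  by have := h i I; rewrite /= in_itv.
apply/seteqP; split => -[r x] /=.
  move=> h; split; first by rewrite in_itv/=; exact: (h ord0).
  by move=> i; have := h (lift ord0 i); rewrite !tS behead_consT.
move=> [+ h] i; rewrite in_itv/= => h0.
have [->//|i0] := eqVneq i ord0.
have [j ->] : exists j, i = lift ord0 j.
  by case: (unliftP ord0 i) i0 => [j ->|->]; [exists j|rewrite eqxx].
by rewrite !tS behead_consT; exact: h.
Qed.

Section euclidean.
Context (R : realType) (d : nat).
Implicit Types x y : d.-tuple R.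

(* The library norm on row vectors is the sup norm, hence this definition. *)
Definition enorm x : R := Num.sqrt (\sum_(i < d) tnth x i ^+ 2).

Definition torus_dist x y : R :=
  inf (range (fun z : d.-tuple int =>
    enorm [tuple tnth x i - tnth y i - (tnth z i)%:~R | i < d])).

(* Volume 1, so that the uniform law on it is A |-> volume (A `&` torus_cube). *)
Definition torus_cube : set (d.-tuple R) :=
  [set x | forall i, - 2^-1 < tnth x i <= 2^-1].

End euclidean.
Arguments torus_cube : clear implicits.

Definition unit_ball_volume (R : realType) (d : nat) : R :=
  fine (lebesgueRd R d [set x | enorm x <= 1]).

(* The little-o notation of the library is keyed on bundled filters. *)
Canonical pinfty_filter_on (R : numFieldType) :=
  FilterType (pinfty_nbhs R) (@proper_pinfty_nbhs R).

Section independence.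
Context (disp : measure_display) (Omega : measurableType disp) (R : realType).
Context (P : probability Omega R).

(* Mutual independence of a family of sets of events: the product rule for
   every choice of events, one from each member of a finite subfamily. *)
Definition mutually_independent (I : choiceType) (J : set I)
    (F : I -> set (set Omega)) : Prop :=
  forall (K : {fset I}) (A : I -> set Omega),
    [set` K] `<=` J -> (forall i, i \in K -> F i (A i)) ->
    P (\bigcap_(i in [set` K]) A i) = (\prod_(i <- K) P (A i))%E.

Context (dispT : measure_display) (T : measurableType dispT).

Definition events_of (Y : Omega -> T) : set (set Omega) :=
  preimage_set_system setT Y measurable.

Definition sigma_of (I : Type) (J : set I) (Y : I -> Omega -> T) :
    set (set Omega) :=
  <<s \bigcup_(i in J) events_of (Y i) >>.

End independence.

Section random_connection_model.
Context (R : realType) (d : nat) (g : R -> R).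

Definition conn_integral : \bar R :=
  (\int[lebesgueRd R d]_x (g (enorm x))%:E)%E.

Definition alpha : R := fine conn_integral.

Definition beta : R :=
  inf [set x | 0 < x /\ 1 < x * g (alpha / (x * unit_ball_volume R d))].

Definition rhat (gamma : R) (n : nat) : R :=
  (gamma * ln n%:R / (alpha * n%:R)) `^ d%:R^-1.

(* A realization of the model: positions x, number of points m, marks u.
   The points X_1, X_2, ... are indexed from 0 here. Vertices are points of the
   space; distinct indices give distinct points outside a null event. *)
Variables (x : nat -> d.-tuple R) (m : nat) (u : nat -> nat -> R).

Definition rcm_vertices : set (d.-tuple R) := x @` `I_m.

Definition rcm_edge (r : R) (p q : d.-tuple R) : Prop :=
  exists i j : nat, [/\ (i < j < m)%N,
    u i j <= g (torus_dist (x i) (x j) / r) &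
    (p = x i /\ q = x j) \/ (p = x j /\ q = x i)].

Definition rcm_connected (r : R) : Prop :=
  forall p q, rcm_vertices p -> rcm_vertices q ->
    exists s : seq (d.-tuple R),
      path (fun a b => `[< rcm_edge r a b >]) p s /\ last p s = q.

End random_connection_model.

(* Main.v *)
Require Import Defs.
From HB Require Import structures.
From mathcomp Require Import all_boot all_order all_algebra.
From mathcomp Require Import finmap.
From mathcomp Require Import all_classical all_reals all_analysis.
From mathcomp Require Import measurable_realfun.
From mathcomp Require Import zify ring lra.

Set Implicit Arguments.
Unset Strict Implicit.
Unset Printing Implicit Defensive.

Import Order.TTheory GRing.Theory Num.Theory.
Import numFieldNormedType.Exports.

Local Open Scope ring_scope.

(** The radius [rhat gamma n] is chosen so that a vertex has about [gamma * ln n]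
    neighbours. As [g <= 1], every [x] in the set defining [beta] exceeds [1], and
    that set is not empty, so [1 <= beta < gamma] ([beta_ge1]): the probability
    [n `^ - gamma] that a given vertex is isolated is small enough for a union
    bound over about [n] vertices. The proof shows that larger obstructions to
    connectivity are not likelier than isolated vertices, up to a small loss in
    the exponent.

    Discretisation. The torus is cut into [K.+2 ^ d] cells, of side slightly below
    [dl] times the radius. Two points in cells at offset [o] are joined with
    probability at least [g (dl * cell_dist o)] ([cell_prob_le]), and it suffices
    to connect the thinned graph in which this is the exact probability. Let [D]
    be the set of offsets in a large box where it is positive. For small [dl] and
    a large box, [dl ^+ d] times the sum of these probabilities is at least
    [(1 - eps) * alpha], even with one term left out ([riemann_sum]). Hence the
    mean degree of the thinned graph, and also the mean number of points in any
    [#|D| - 1] cells, is at least nearly [gamma * ln n].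

    A deterministic criterion. Take [k] to be a small multiple of [ln n], and call
    a cell bad if it contains fewer than [2 * k] points. The graph is connected
    ([connected_of_local]) as soon as
    - no box of a certain fixed radius contains [#|D| - 1] bad cells,
    - any two disjoint sets of [k] points each, in two cells at an offset in [D],
      are joined by an edge, and
    - every vertex has at least [2 * k] neighbours in one cell.
    Indeed a union of components colours each good cell by whether it contains at
    least [k] of its points. By the second condition cells at an offset in [D]
    have the same colour. By the first one and [2 <= d] all good cells have the
    same colour ([good_cells_monochromatic]): otherwise one finds a bounded set of
    cells of the minority colour all of whose neighbours outside it are bad, but
    there are at least [#|D| - 1] such neighbours ([outer_boundary_size]). So one
    side dominates every good cell, and by the third condition every vertex has a
    neighbour on that side.

    Probabilities. Given the number of points, the cells of the points are
    uniform and independent, so the thinned graph is a finite model on the group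
    of cells, in which the failure of each condition is estimated by a union bound
    ([good_probability]). The first and third fail with probability
    [n `^ - tau], by Chernoff's inequality, as both means exceed [ln n] by a
    factor. For the second, the [k * k] possible edges are all absent with
    probability [exp (- c * (ln n) ^ 2)], which beats the number of choices of the
    two sets ([error_bound]). Finally the number of points is close to [n] by
    Chebyshev's inequality ([poisson_concentration]). *)

(** * Bad-free slices and outer boundaries in the integer lattice *)

Section lattice.
Variable d : nat.
Notation Z := {ffun 'I_d -> int}.
Implicit Types (y z o : Z) (i j : 'I_d) (a : int).

Definition upd y i a : Z := [ffun j => if j == i then a else y j].

Definition in_box (L : nat) z y := [forall i, (`|y i - z i| <= L)%N].

Definition box_seq (L : nat) z : seq Z :=
  [seq [ffun i => z i + (f i : nat)%:Z - L%:Z] | f : {ffun 'I_d -> 'I_(L.*2.+1)}].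

Lemma in_boxP L z y : reflect (forall i, (`|y i - z i| <= L)%N) (in_box L z y).
Proof. exact: forallP. Qed.

Lemma mem_box_seq L z y : (y \in box_seq L z) = in_box L z y.
Proof.
apply/fintype.imageP/in_boxP => [[f _ ->] i|h].
  rewrite ffunE; have := ltn_ord (f i). by set q := nat_of_ord _; lia.
exists [ffun i => inord `|(y i - z i + L%:Z)%R|%N] => //; apply/ffunP => i.
rewrite !ffunE; move: (h i); move: (y i) (z i) => a b ab.
by rewrite inordK; lia.
Qed.

Lemma box_seq_uniq L z : uniq (box_seq L z).
Proof.
rewrite map_inj_uniq ?enum_uniq// => f f' /ffunP ff'; apply/ffunP => i.
move: (ff' i); rewrite !ffunE => e; apply/val_inj => /=.
by move: e; move: (z i) => c; set q := nat_of_ord _; set q' := nat_of_ord _; lia.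
Qed.

(** One walks from [y] to [y'] by unit steps, coordinate by coordinate, without
    leaving the box spanned by them. *)
Lemma walk_const (C : eqType) (f : Z -> C) y y' :
  (forall (w : Z) i a, (forall j, (y j <= w j <= y' j) || (y' j <= w j <= y j)) ->
     (`|a - w i| <= 1)%N -> (y i <= a <= y' i) || (y' i <= a <= y i) ->
     f w = f (upd w i a)) -> f y = f y'.
Proof.
move: {2}(\sum_i `|y i - y' i|)%N (leqnn (\sum_i `|y i - y' i|)%N) => N.
elim: N y => [|N IH] y le h.
  congr f; apply/ffunP => i; move: le; rewrite leqn0 sum_nat_eq0 => /forallP/(_ i)/=.
  by lia.
have [->//|yy'] := eqVneq y y'.
have /existsP[i yi] : [exists i, y i != y' i].
  by apply: contraNT yy' => /existsPn e; apply/eqP/ffunP => i; apply/eqP/negPn/e.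
pose a := if y i < y' i then y i + 1 else y i - 1.
have hi : (`|a - y i| <= 1)%N by rewrite /a; case: ifP; lia.
have ha : (y i <= a <= y' i) || (y' i <= a <= y i) by rewrite /a; case: ifP; lia.
rewrite (h y i a)//; last by move=> j; lia.
have uE j : upd y i a j = if j == i then a else y j by rewrite ffunE.
apply: IH => [|w j c hw hc hcj].
  rewrite (bigD1 i)//= in le; rewrite (bigD1 i)//= uE eqxx.
  under eq_bigr => j ji do rewrite uE (negPf ji).
  by move: le; rewrite /a; case: ifP; lia.
apply: h => [l||] //.
  by have := hw l; rewrite uE; case: eqP => [->|_]; lia.
by move: hcj; rewrite uE; case: eqP => [->|_]; lia.
Qed.

Lemma updE y i a j : upd y i a j = if j == i then a else y j.
Proof. by rewrite ffunE. Qed.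

(** The weights are the powers of [rho.+1]: if the weighted sum vanishes then
    [rho.+1] divides the lowest coordinate, which is therefore zero, and so on. *)
Lemma generic_functional (rho : nat) :
  exists phi : {additive Z -> int},
    forall o, (forall i, (`|o i| <= rho)%N) -> phi o = 0 -> o = 0.
Proof.
pose B : int := rho.+1%:Z.
pose phi (o : Z) := \sum_i o i * B ^+ i.
have phiB : zmod_morphism phi.
  move=> o o'; rewrite /phi -sumrB; apply: eq_bigr => i _.
  by rewrite !ffunE mulrBl.
pose F := GRing.isZmodMorphism.Build _ _ phi phiB.
pose phi' : {additive Z -> int} := HB.pack phi F.
exists phi' => o; rewrite /phi' /= /phi {F phi' phiB phi} => ob o0.
suff H n (q : nat -> int) : (forall k : nat, (`|q k| <= rho)%N) ->
    \sum_(i < n) q i * B ^+ i = 0 -> forall k, (k < n)%N -> q k = 0.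
  apply/ffunP => i; rewrite ffunE.
  have := H d (fun k => if insub k is Some j then o j else 0).
  move=> /(_ _ _ i (ltn_ord i)); rewrite valK; apply.
    by move=> k; case: insub => [j|//].
  by rewrite -[RHS]o0; apply: eq_bigr => j _; rewrite valK.
elim: n q => [//|n IH] q qb; rewrite big_ord_recl expr0 mulr1 /=.
under eq_bigr => i _ do rewrite /bump/= add1n exprS mulrCA.
rewrite -mulr_sumr => q0.
have q00 : q 0%N = 0.
  move: q0 (qb 0%N); rewrite /B; set s := \sum_(i < n) _ => q0 h.
  have [s0|s0] : s = 0 \/ (1 <= `|s|)%N by lia.
    by move: q0; rewrite s0 mulr0 addr0.
  by nia.
case=> [//|i] lin; apply: (IH (fun k => q k.+1)) => //.
by move: q0; rewrite q00 add0r => /eqP; rewrite mulf_eq0 /B => /orP[|/eqP//]; lia.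
Qed.

Variables (D : seq Z) (rho : nat).
Hypothesis D_uniq : uniq D.
Hypothesis D0 : 0 \in D.
Hypothesis D_down : forall o o', o \in D -> (forall i, (`|o' i| <= `|o i|)%N) -> o' \in D.
Hypothesis D_unit : forall i, upd 0 i 1 \in D.
Hypothesis D_bound : forall o i, o \in D -> (`|o i| <= rho)%N.

(** A linear functional that vanishes at no nonzero offset splits [D] minus the
    origin into a positive and a negative half. The translates of the highest
    point of [A] by the positive half, and of its lowest point by the negative
    half, are outside [A] and distinct. *)
Lemma outer_boundary_size (A : seq Z) : A != [::] ->
  exists s : seq Z, [/\ uniq s, (size D).-1 = size s &
    forall w, w \in s -> w \notin A /\ exists2 y, y \in A & w - y \in D].
Proof.
case: A => // a0 A _; set A' := a0 :: A.
have [phi phi0] := generic_functional rho.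
have ext (f : Z -> int) : exists2 y, y \in A' & forall x, x \in A' -> f x <= f y.
  rewrite /A' {A'}; elim: A a0 => [|a1 A IH] a0.
    by exists a0; rewrite ?mem_head// => x; rewrite inE => /eqP->.
  have [y yA hy] := IH a1; case: (leP (f a0) (f y)) => h.
    by exists y => [|x]; rewrite inE ?yA ?orbT// => /orP[/eqP->//|/hy].
  exists a0 => [|x]; rewrite inE ?eqxx// => /orP[/eqP->//|/hy le].
  exact: le_trans le (ltW h).
have [h hA hmax] := ext phi; have [l lA lmin] := ext (fun y => - phi y).
have lh : phi l <= phi h by exact: hmax.
exists ([seq h + o | o <- D & 0 < phi o] ++ [seq l + o | o <- D & phi o < 0]).
split.
- rewrite cat_uniq !map_inj_uniq ?filter_uniq//; try exact: addrI.
  rewrite andbT /=; apply/hasPn => w /mapP[ o]; rewrite mem_filter => /andP[ o0 _] ->.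
  apply/mapP => -[ o']; rewrite mem_filter => /andP[ o'0 _] /(congr1 phi).
  by rewrite !raddfD => e; lia.
- rewrite size_cat !size_map !size_filter.
  rewrite -count_predUI.
  set c0 := count (predI _ _) D; have -> : c0 = 0%N.
    by apply/eqP; rewrite -leqn0 leqNgt -has_count; apply/hasPn => o _ /=; lia.
  rewrite -(count_predC (pred1 (0 : Z)) D) count_uniq_mem// D0 addn0 add1n /=.
  apply: eq_in_count => o oD /=; apply/idP/idP => [ o0|].
    have [//|//|/(phi0 _ (fun i => D_bound i oD)) o00] := ltrgtP (phi o) 0.
    by rewrite o00 eqxx in o0.
  by apply: contraTneq => ->; rewrite raddf0 ltxx.
move=> w; rewrite mem_cat => /orP[] /mapP[ o]; rewrite mem_filter => /andP[ o0 oD] ->.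
  split; last by exists h => //; rewrite addrC addKr.
  by apply/negP => /hmax; rewrite raddfD; lia.
split; last by exists l => //; rewrite addrC addKr.
by apply/negP => /lmin; rewrite raddfD; lia.
Qed.

Variables (r : nat) (bad col : pred Z).
Hypothesis d_gt1 : (1 < d)%N.
Hypothesis r_large : ((size D).-1 + rho <= r)%N.
Hypothesis bad_sparse : forall z (s : seq Z), uniq s -> size s = (size D).-1 ->
  all (in_box r.+1 z) s -> ~~ all bad s.
Hypothesis col_adj : forall y y', ~~ bad y -> ~~ bad y' -> y' - y \in D ->
  col y = col y'.

Definition free_slice (l : nat) z i a :=
  all (fun y => (y i == a) ==> ~~ bad y) (box_seq l z).

Lemma ffunB_E y z i : (y - z) i = y i - z i.
Proof. by rewrite !ffunE. Qed.

Lemma free_sliceP l z i a :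
  reflect (forall y, in_box l z y -> y i = a -> ~~ bad y) (free_slice l z i a).
Proof.
apply: (iffP allP) => h y; first by rewrite -mem_box_seq => /h /implyP yb /eqP.
by rewrite mem_box_seq => /h yb; apply/implyP => /eqP.
Qed.

(** Otherwise [(size D).-1] consecutive slices would each contribute a bad cell. *)
Lemma exists_free_slice l z i a : (l <= r.+1)%N ->
  exists2 t : nat, (t < (size D).-1)%N & free_slice l z i (a + t%:Z).
Proof.
move=> lr; set b := (size D).-1.
have [[t ft]|nf] := pickP (fun t : 'I_b => free_slice l z i (a + (t : nat)%:Z)).
  by exists t.
have /fin_all_exists[y yP] (t : 'I_b) :
    exists y, [/\ in_box l z y, y i = a + (t : nat)%:Z & bad y].
  have /allPn[y] := negbT (nf t); rewrite mem_box_seq => yb.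
  by rewrite negb_imply negbK => /andP[/eqP yi yB]; exists y.
have ynj : injective y.
  move=> t u tu; have [_ yt _] := yP t; have [_ yu _] := yP u.
  by apply/val_inj; move: yt; rewrite tu yu /= => /addrI [].
have /negP[] : ~~ all bad (codom y).
  apply: (bad_sparse (z := z)).
  - by rewrite map_inj_uniq ?enum_uniq.
  - by rewrite size_codom card_ord.
  - apply/allP => _ /codomP[t ->]; apply/in_boxP => j.
    by have [/in_boxP/(_ j) h _ _] := yP t; exact: leq_trans h lr.
by apply/allP => _ /codomP[t ->]; have [] := yP t.
Qed.

(** A box in a hyperplane is connected by unit steps, and all its cells are good. *)
Lemma slice_color l z i a y y' : free_slice l z i a ->
  in_box l z y -> in_box l z y' -> y i = a -> y' i = a -> col y = col y'.
Proof.
move=> /free_sliceP fr /in_boxP yb /in_boxP y'b ya y'a; apply: walk_const => w j c hw cw hc.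
have wb k : (`|w k - z k| <= l)%N.
  by move: (hw k) (yb k) (y'b k); move: (w k) (y k) (y' k) => ? ? ?; lia.
apply: col_adj.
- by apply: fr; [exact/in_boxP|have := hw i; rewrite ya y'a; lia].
- apply: fr.
    apply/in_boxP => k; rewrite updE; case: eqP => [->|//].
    by move: hc (yb j) (y'b j); move: (w j) (y j) (y' j) => ? ? ?; lia.
  rewrite updE; case: eqP => [e|_]; last by have := hw i; rewrite ya y'a; lia.
  by move: hc; rewrite -e ya y'a; lia.
- apply: (D_down (D_unit j)) => k; rewrite !ffunE; case: eqP => [->|_]; last by rewrite subrr.
  exact: cw.
Qed.

Definition slice_point z y := in_box r z y && [exists i, free_slice r z i (y i)].

Lemma other_direction i : exists j : 'I_d, j != i.
Proof.
have [e|e] := eqVneq (i : nat) 0%N.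
  by exists (Ordinal d_gt1); apply/eqP => /(congr1 val)/=; rewrite e.
by exists (Ordinal (ltnW d_gt1)); apply/eqP => /(congr1 val)/= e'; rewrite -e' in e.
Qed.

(** Slices in different directions meet, and two parallel slices both meet a
    transversal one. *)
Lemma slice_point_color z y y' : slice_point z y -> slice_point z y' -> col y = col y'.
Proof.
move=> /andP[yb /existsP[i fi]] /andP[y'b /existsP[i' fi']].
have ne_case x x' j j' : in_box r z x -> in_box r z x' ->
    free_slice r z j (x j) -> free_slice r z j' (x' j') -> j != j' -> col x = col x'.
  move=> xb x'b fx fx' jj'.
  pose w := upd (upd z j (x j)) j' (x' j').
  have wj : w j = x j by rewrite /w !updE (negPf jj') eqxx.
  have wj' : w j' = x' j' by rewrite /w !updE eqxx.
  have wb : in_box r z w.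
    apply/in_boxP => k; rewrite /w !updE.
    case: eqP => [->|_]; first by move/in_boxP: x'b.
    by case: eqP => [->|_]; [move/in_boxP: xb|rewrite subrr].
  by rewrite (slice_color fx xb wb)// (slice_color fx' wb x'b).
have [ii'|] := eqVneq i i'; last exact: ne_case.
have [j ji] := other_direction i.
have [t tb ft] := exists_free_slice z j (z j) (leqnSn r).
pose w := upd z j (z j + t%:Z).
have wj : w j = z j + t%:Z by rewrite updE eqxx.
have wb : in_box r z w.
  by apply/in_boxP => k; rewrite updE; case: eqP => [->|_]; lia.
rewrite (ne_case y w i j)//; rewrite ?wj// 1?eq_sym//.
by apply: (ne_case w y' j i'); rewrite ?wj// -ii'.
Qed.

(** The common colour of the bad-free slices of the box around [z]. *)
Definition slice_col z := has (fun y => slice_point z y && col y) (box_seq r z).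

Lemma slice_colE z y : slice_point z y -> col y = slice_col z.
Proof.
move=> yz; apply/idP/hasP => [cy|[w _ /andP[wz]]].
  by exists y; rewrite ?yz// mem_box_seq; case/andP: yz.
by rewrite (slice_point_color yz wz).
Qed.

Lemma free_slice_upd z y i a t : i != t -> (`|a - z t| <= 1)%N -> free_slice r.+1 z i (y i) ->
  in_box r z y -> free_slice r (upd z t a) i (y i).
Proof.
move=> it az /free_sliceP fr yb; apply/free_sliceP => w wb; apply: fr.
apply/in_boxP => k; move/in_boxP: wb => /(_ k); rewrite updE.
by case: eqP => [->|_]; lia.
Qed.

(** When the centre moves by one step in direction [i], a bad-free slice normal to
    another direction serves for both boxes, if it is free in the box of radius
    [r.+1]. *)
Lemma slice_col_const z z' : slice_col z = slice_col z'.
Proof.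
apply: walk_const => w i a _ aw _.
have [j ji] := other_direction i.
have [t tb ft] := exists_free_slice w j (w j) (leqnn _).
pose y := upd w j (w j + t%:Z).
have yj : y j = w j + t%:Z by rewrite updE eqxx.
have yb : in_box r w y.
  by apply/in_boxP => k; rewrite updE; case: eqP => [->|_]; lia.
rewrite -yj in ft.
rewrite -(@slice_colE w y) -?(@slice_colE (upd w i a) y)//; apply/andP; split=> //.
- apply/in_boxP => k; rewrite !updE; case: eqP => [->|_]; last first.
    by case: eqP => [->|_]; lia.
  by rewrite (negPf ji); lia.
- by apply/existsP; exists j; apply: free_slice_upd.
- apply/existsP; exists j; apply/free_sliceP => x xb; move/free_sliceP: ft; apply.
  by apply/in_boxP => k; move/in_boxP: xb => /(_ k); lia.
Qed.

(** All bad-free slices in all boxes have one colour. A good cell [z] of another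
    colour is confined by bad-free slices on its two sides in every direction. The
    outer neighbours of the set [A] of good cells of the wrong colour in this
    region are bad: a good one would have the wrong colour too, hence lie outside
    the region, and one could reach a slice from [A] by an offset in [D]. There
    are too many of these bad cells for [bad_sparse]. *)
Lemma good_cells_monochromatic y y' : ~~ bad y -> ~~ bad y' -> col y = col y'.
Proof.
suff H z : ~~ bad z -> col z = slice_col 0 by move=> /H -> /H ->.
move=> zg; apply/eqP; apply: contraT => zc.
have b0 : (0 < (size D).-1)%N.
  by have [t] := exists_free_slice z (Ordinal d_gt1) 0 (leqnn _); case: (size D).-1.
have /fin_all_exists[up upP] i : exists t : nat, (0 < t <= (size D).-1)%N &&
    free_slice r z i (z i + t%:Z).
  have [t tb ft] := exists_free_slice z i (z i + 1) (leqnSn r).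
  by exists t.+1; rewrite ltnS tb/= -(_ : z i + 1 + t%:Z = z i + t.+1%:Z)//; lia.
have /fin_all_exists[dn dnP] i : exists t : nat, (0 < t <= (size D).-1)%N &&
    free_slice r z i (z i - t%:Z).
  have [t tb ft] := exists_free_slice z i (z i - (size D).-1%:Z) (leqnSn r).
  exists ((size D).-1 - t)%N; rewrite subn_gt0 tb leq_subr/=.
  rewrite -(_ : z i - (size D).-1%:Z + t%:Z = z i - ((size D).-1 - t)%N%:Z)//.
  by move: tb; move: (size D).-1 (z i) => ? ?; lia.
pose A := [seq x <- box_seq r z | [&& ~~ bad x, col x != slice_col 0 &
  [forall i, z i - (dn i)%:Z < x i < z i + (up i)%:Z]]].
have zA : z \in A.
  rewrite mem_filter zg zc mem_box_seq/=; apply/andP; split; last first.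
    by apply/in_boxP => k; rewrite subrr.
  by apply/forallP => i; move: (upP i) (dnP i) => /andP[+ _] /andP[+ _]; lia.
have [|s [su ss sP]] := @outer_boundary_size A; first by case: (A) zA.
have AP x : x \in A -> [/\ ~~ bad x, col x != slice_col 0,
    forall i, z i - (dn i)%:Z < x i < z i + (up i)%:Z & in_box r z x].
  by rewrite mem_filter mem_box_seq => /andP[/and3P[? ? /forallP ?] ?].
have Abox x : x \in A -> forall i, (`|x i - z i| < (size D).-1)%N.
  move=> /AP[_ _ h _] i; move: (h i) (upP i) (dnP i) => + /andP[+ _] /andP[+ _].
  by lia.
have /negP[] : ~~ all bad s.
  apply: (bad_sparse (z := z)) => //.
  apply/allP => w /sP[_ [x /Abox xb xD]]; apply/in_boxP => k.
  by move: (xb k) (D_bound k xD) r_large; rewrite ffunB_E;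
    move: (size D).-1 (w k) (x k) (z k); clear => *; lia.
apply/allP => w /sP[wA [x xA xD]]; apply: contraNT wA => wg.
have [xg xc xW xb] := AP x xA.
have xbox := Abox x xA.
have wc : col w != slice_col 0 by rewrite -(col_adj xg wg xD).
(* [D_down] allows the step from [x] to the projection [v] of [x] to a slice that
   separates [x] from [w]. *)
have onslice i a : free_slice r z i a -> (`|a - z i| <= (size D).-1)%N ->
    (`|a - x i| <= `|w i - x i|)%N -> False.
  move=> fr az ax; pose v := upd x i a.
  have vb : in_box r z v.
    apply/in_boxP => k; rewrite updE; case: eqP => [->|_].
      exact: leq_trans az (leq_trans (leq_addr _ _) r_large).
    exact: leq_trans (ltnW (xbox k)) (leq_trans (leq_addr _ _) r_large).
  have vi : v i = a by rewrite updE eqxx.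
  have vs : slice_point z v by apply/andP; split=> //; apply/existsP; exists i; rewrite vi.
  move: xc; rewrite (@col_adj x v)//.
  - by rewrite (slice_colE vs) (slice_col_const z 0) eqxx.
  - by move/free_sliceP : fr; apply.
  - apply: (D_down xD) => k; rewrite !ffunB_E updE; case: eqP => [->|_]//.
    by rewrite subrr.
rewrite mem_filter wg wc mem_box_seq/=; apply/andP; split; last first.
  by apply/in_boxP => k; move: (xbox k) (D_bound k xD) r_large; rewrite ffunB_E;
    move: (size D).-1 (w k) (x k) (z k); clear => *; lia.
apply/forallP => i; apply: contraT; rewrite negb_and -!leNgt.
move: (upP i) (dnP i) (xW i) => /andP[up_b /onslice up_x] /andP[dn_b /onslice dn_x] xi.
case/orP => h.
  case: dn_x; move: (size D).-1 (w i) (x i) (z i) (up i) (dn i) up_b dn_b xi h;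
    clear => *; lia.
case: up_x; move: (size D).-1 (w i) (x i) (z i) (up i) (dn i) up_b dn_b xi h;
  clear => *; lia.
Qed.
End lattice.

(** * Cuts of a graph over the cells of the torus *)
Section torus.
Variables (d K : nat).
Notation Z := {ffun 'I_d -> int}.
Notation T := {ffun 'I_d -> 'I_K.+2}.

Definition torus_proj (z : Z) : T := [ffun i => (z i)%:~R].

Lemma torus_projD y z : torus_proj (y + z) = torus_proj y + torus_proj z.
Proof. by apply/ffunP => i; rewrite !ffunE intrD. Qed.

Lemma torus_projB y z : torus_proj (y - z) = torus_proj y - torus_proj z.
Proof. by apply/ffunP => i; rewrite !ffunE intrB. Qed.

Lemma torus_proj0 : torus_proj 0 = 0.
Proof. by apply/ffunP => i; rewrite !ffunE. Qed.

Definition torus_lift (c : T) : Z := [ffun i => (c i : nat)%:Z].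

Lemma torus_liftK c : torus_proj (torus_lift c) = c.
Proof. by apply/ffunP => i; rewrite !ffunE -[RHS]natr_Zp. Qed.

End torus.

Section cut.
Variables (d K : nat).
Notation Z := {ffun 'I_d -> int}.
Notation T := {ffun 'I_d -> 'I_K.+2}.
Variables (D : seq Z) (rho r : nat).
Hypothesis D_uniq : uniq D.
Hypothesis D0 : 0 \in D.
Hypothesis D_down : forall o o' : Z, o \in D -> (forall i, (`|o' i| <= `|o i|)%N) -> o' \in D.
Hypothesis D_unit : forall i, upd 0 i 1 \in D.
Hypothesis D_bound : forall (o : Z) i, o \in D -> (`|o i| <= rho)%N.
Hypothesis d_gt1 : (1 < d)%N.
Hypothesis r_large : ((size D).-1 + rho <= r)%N.
Variables (m k : nat) (x : 'I_m -> T) (E : rel 'I_m).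

(** The vertices of the graph [E] are [m] points, the [i]-th one in the cell [x i].
    The next three conditions are local, and they imply connectivity. *)
Definition sparse_bad := forall (c : T) (O : seq Z), uniq O -> size O = (size D).-1 ->
  all (in_box r.+1 0) O -> ~~ all (fun o => #|[set i | x i == (c + torus_proj K o)%R]| < k.*2)%N O.

Definition dense_edges := forall (c : T) (o : Z) (A A' : {set 'I_m}), o \in D ->
  #|A| = k -> #|A'| = k -> [disjoint A & A'] ->
  (forall a, a \in A -> x a = c) -> (forall a, a \in A' -> x a = c + torus_proj K o) ->
  exists2 a, a \in A & exists2 a', a' \in A' & E a a'.

Definition rich_vertices := forall i, exists2 o : Z, o \in D &
  (k.*2 <= #|[set j | (x j == x i + torus_proj K o)%R && E i j]|)%N.

Lemma subset_of_card (A : {set 'I_m}) n : (n <= #|A|)%N -> exists2 B : {set 'I_m}, B \subset A & #|B| = n.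
Proof.
move=> nA; exists [set i in take n (enum A)].
  by apply/fintype.subsetP => i; rewrite inE => /mem_take; rewrite mem_enum.
rewrite cardsE; have /card_uniqP -> : uniq (take n (enum A)) by rewrite take_uniq ?enum_uniq.
by rewrite size_take -cardE; case: ltngtP nA.
Qed.

(** Let [S] be the component of [i0], and let a cell be coloured by whether it has
    [k] points in [S]. A good cell, with at least [2 * k] points, has [k] points in
    [S] or [k] points outside, so [dense_edges] makes the colours of good cells at
    an offset in [D] agree, and then all colours of good cells agree. Some cell
    contains [2 * k] neighbours of [i0], which are in [S], so every good cell has
    [k] points in [S]. A vertex [j0] outside [S] would have [2 * k] neighbours
    outside [S] in one cell, which is good and also has [k] points in [S], against
    [dense_edges] for the offset [0]. *)
Lemma connected_of_local : symmetric E -> sparse_bad -> dense_edges -> rich_vertices ->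
  forall i j, connect E i j.
Proof.
move=> Esym sparse dense rich i0 j0.
pose S := [set j | connect E i0 j].
have ES a a' : E a a' -> (a \in S) = (a' \in S).
  by move=> e; rewrite !inE; apply: same_connect_r; [exact: sym_connect_sym|exact: connect1].
pose cell (y : Z) := [set i | x i == torus_proj K y].
pose bad (y : Z) := (#|cell y| < k.*2)%N.
pose col (y : Z) := (k <= #|cell y :&: S|)%N.
have cellE i j o : (j \in cell (torus_lift (x i + torus_proj K o))) = (x j == x i + torus_proj K o).
  by rewrite inE torus_liftK.
have no_cut y y' o (B : {set 'I_m}) : y' = y + o -> o \in D -> (forall a a', E a a' -> (a \in B) = (a' \in B)) ->
    (k <= #|cell y :&: B|)%N -> (k <= #|cell y' :\: B|)%N -> False.
  move=> yo oD EB /subset_of_card[A AS Ak] /subset_of_card[A' AS' Ak'].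
  have [|a|a|a aA [a' aA']] := dense (torus_proj K y) o A A' oD Ak Ak'.
  - rewrite -setI_eq0; apply/eqP/setP => a; rewrite !inE; apply/andP => -[/(fintype.subsetP AS)].
    by rewrite !inE => /andP[_ aB] /(fintype.subsetP AS'); rewrite !inE aB.
  - by move=> /(fintype.subsetP AS); rewrite !inE => /andP[/eqP].
  - by move=> /(fintype.subsetP AS'); rewrite !inE yo torus_projD => /andP[_ /eqP].
  - move=> /EB; move: (fintype.subsetP AS _ aA) (fintype.subsetP AS' _ aA').
    by rewrite !inE => /andP[_ ->] /andP[/negPf->].
have ESC a a' : E a a' -> (a \in ~: S) = (a' \in ~: S) by move=> /ES; rewrite !finset.in_setC => ->.
have good_nocol y : ~~ bad y -> ~~ col y -> (k <= #|cell y :\: S|)%N.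
  by rewrite /bad /col -leqNgt -ltnNge -(cardsID S (cell y)); lia.
have mono y y' : ~~ bad y -> ~~ bad y' -> col y = col y'.
  apply: (good_cells_monochromatic D_uniq D0 D_down D_unit D_bound d_gt1 r_large).
    move=> z s us ss /allP sb; apply/negP => /allP sbad.
    move: (sparse (torus_proj K z) [seq o - z | o <- s]).
    rewrite size_map map_inj_uniq; last exact: addIr.
    move=> /(_ us ss); set b1 := all _ _; have -> : b1.
      apply/allP => _ /mapP[ o /sb /in_boxP h ->]; apply/in_boxP => i.
      by move: (h i); rewrite !ffunE subr0.
    move=> /(_ isT) /negP; apply.
    by apply/allP => _ /mapP[ o /sbad h ->]; rewrite -torus_projD addrC subrK.
  move=> {}y {}y' gy gy' yD.
  have yy' : y' = y + (y' - y) by rewrite addrC subrK.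
  case cy: (col y); case cy': (col y') => //.
    exfalso; apply: (no_cut _ _ _ _ yy' yD ES) => //.
    by apply: good_nocol => //; rewrite cy'.
  exfalso; apply: (no_cut _ _ _ _ yy' yD ESC).
    by rewrite -finset.setDE good_nocol// cy.
  by rewrite finset.setDE finset.setCK.
have all_col y : ~~ bad y -> col y.
  have [ o oD ho] := rich i0.
  pose y0 := torus_lift (x i0 + torus_proj K o).
  have y0S : (k.*2 <= #|cell y0 :&: S|)%N.
    apply: leq_trans ho _; apply/subset_leq_card/fintype.subsetP => j.
    by rewrite inE => /andP[xj /connect1 ij]; rewrite finset.in_setI cellE xj inE.
  move=> gy; rewrite (mono y y0)//.
    by apply: leq_trans y0S; rewrite -addnn leq_addr.
  rewrite /bad -leqNgt; apply: leq_trans y0S _.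
  by apply: subset_leq_card; exact: finset.subsetIl.
have [ o oD ho] := rich j0.
pose y0 := torus_lift (x j0 + torus_proj K o).
suff: j0 \in S by rewrite inE.
apply: contraT => j0S; exfalso.
have y0S : (k.*2 <= #|cell y0 :\: S|)%N.
  apply: leq_trans ho _; apply/subset_leq_card/fintype.subsetP => j.
  by rewrite inE => /andP[xj /ES e]; rewrite finset.in_setD cellE xj -e j0S.
have y00 : y0 = y0 + 0 by rewrite addr0.
apply: (no_cut _ _ _ _ y00 D0 ES).
  apply: all_col; rewrite /bad -leqNgt; apply: leq_trans y0S _.
  by apply: subset_leq_card; exact: finset.subsetDl.
by apply: leq_trans y0S; rewrite -addnn leq_addr.
Qed.

End cut.

(** * The finite model: uniform positions in a group, independent edges *)
Section model.
Variables (R : realFieldType) (T : finZmodType) (p : T -> R) (m : nat).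
Hypothesis p01 : forall u, 0 <= p u <= 1.
Hypothesis p_even : forall u, p (- u) = p u.
Notation pos := {ffun 'I_m -> T}.
Notation marks := {ffun 'I_m * 'I_m -> bool}.
Implicit Types (x : pos) (e : marks) (i j a b : 'I_m).

(** An edge has one mark, at the increasing pair of its ends. The marks at the
    other pairs are almost surely false, which makes a mark configuration a
    function on all pairs. *)
Definition edge_prob x (ij : 'I_m * 'I_m) : R :=
  if (ij.1 < ij.2)%N then p (x ij.2 - x ij.1) else 0.

Definition marks_weight x e : R :=
  \prod_ij (if e ij then edge_prob x ij else 1 - edge_prob x ij).

Definition weight x e : R := #|T|%:R^-1 ^+ m * marks_weight x e.

Definition ordered i j : 'I_m * 'I_m := if (i < j)%N then (i, j) else (j, i).

Definition adj e i j := (i != j) && e (ordered i j).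

Lemma adj_sym e : symmetric (adj e).
Proof.
move=> i j; rewrite /adj eq_sym; case: eqVneq => //= ij; congr (e _).
by rewrite /ordered; case: ltngtP => // /val_inj ji; rewrite ji eqxx in ij.
Qed.

Lemma edge_prob01 x ij : 0 <= edge_prob x ij <= 1.
Proof. by rewrite /edge_prob; case: ifP => // _; rewrite lexx ler01. Qed.

Lemma marks_weight_ge0 x e : 0 <= marks_weight x e.
Proof.
apply: prodr_ge0 => ij _; have := edge_prob01 x ij.
by case: (e ij) => /andP[]//; rewrite subr_ge0.
Qed.

Lemma weight_ge0 x e : 0 <= weight x e.
Proof. by rewrite mulr_ge0 ?marks_weight_ge0// exprn_ge0// invr_ge0. Qed.

(** Independence of the marks, as a product formula for expectations. *)
Lemma marks_weight_prod x (phi : 'I_m * 'I_m -> bool -> R) :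
  \sum_e marks_weight x e * \prod_ij phi ij (e ij) =
  \prod_ij (edge_prob x ij * phi ij true + (1 - edge_prob x ij) * phi ij false).
Proof.
transitivity (\prod_ij \sum_(t : bool)
    (if t then edge_prob x ij else 1 - edge_prob x ij) * phi ij t).
  by rewrite bigA_distr_bigA; apply: eq_bigr => e _; rewrite -big_split.
by apply: eq_bigr => ij _; rewrite big_bool.
Qed.

Lemma marks_weight_sum x : \sum_e marks_weight x e = 1.
Proof.
transitivity (\sum_e marks_weight x e * \prod_(ij : 'I_m * 'I_m) 1).
  by apply: eq_bigr => e _; rewrite big1// mulr1.
rewrite (marks_weight_prod x (fun _ _ => 1)) big1// => ij _.
by rewrite !mulr1 addrC subrK.
Qed.

Lemma cardT_gt0 : 0 < #|T|%:R :> R.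
Proof. by rewrite ltr0n; apply/card_gt0P; exists 0. Qed.

Lemma uniform_prod (F : 'I_m -> T -> R) :
  \sum_(x : pos) #|T|%:R^-1 ^+ m * \prod_i F i (x i) = \prod_i (#|T|%:R^-1 * \sum_u F i u).
Proof.
by rewrite big_split/= prodr_const card_ord bigA_distr_bigA -mulr_sumr.
Qed.

Lemma prodr_sum_const (B : {set T}) (y : R) :
  #|T|%:R^-1 * \sum_(u : T) (if u \in B then y else 1) =
  1 - (1 - y) * (#|B|%:R / #|T|%:R).
Proof.
have -> : \sum_(u : T) (if u \in B then y else 1) =
    \sum_(u : T) (1 - (1 - y) * (u \in B)%:R).
  by apply: eq_bigr => u _; case: (u \in B) => /=; ring.
rewrite sumrB -mulr_sumr sumr_const.
rewrite (_ : \sum_u (u \in B)%:R = #|B|%:R :> R); last first.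
  by rewrite -sum1_card natr_sum [RHS]big_mkcond; apply: eq_bigr => u _; case: (u \in B).
by have := cardT_gt0; move: #|T|%:R => t t0; field; rewrite gt_eqF.
Qed.

(** The tilting step common to the Chernoff bounds below, with tilt [s]. *)
Lemma exp_indicator (s : R) (N n : nat) : 0 < s <= 1 ->
  ((N <= n)%N)%:R <= s^-1 ^+ n * s ^+ N.
Proof.
case/andP=> s0 s1; have s10 : 0 <= s^-1 by rewrite invr_ge0 ltW.
case: leqP => Nn; last by rewrite mulr_ge0 ?exprn_ge0// ltW.
rewrite -(subnK Nn) exprD -mulrA -exprMn mulVf ?gt_eqF// expr1n mulr1.
by rewrite exprn_ege1// invf_ge1.
Qed.

Lemma prod_if_const (I : finType) (P : pred I) (y : R) :
  \prod_(i : I) (if P i then y else 1) = y ^+ #|P|.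
Proof. by rewrite -big_mkcond prodr_const. Qed.

Lemma prod_if_in (I : finType) (A : {set I}) (y : R) :
  \prod_(i : I) (if i \in A then y else 1) = y ^+ #|A|.
Proof. by rewrite -big_mkcond prodr_const. Qed.

(** If each cell of [B] has at most [h] points then their union has at most
    [#|B| * h] points, to which Chernoff's inequality applies. *)
Lemma sparse_cells_bound (s : R) (h : nat) (B : {set T}) : 0 < s <= 1 ->
  \sum_(x : pos) #|T|%:R^-1 ^+ m * ([forall c in B, #|[set i | x i == c]| <= h]%N)%:R <=
  s^-1 ^+ (#|B| * h) * (1 - (1 - s) * (#|B|%:R / #|T|%:R)) ^+ m.
Proof.
move=> s01; have [s0 s1] := andP s01.
have <- : \sum_(x : pos) #|T|%:R^-1 ^+ m * (s^-1 ^+ (#|B| * h) *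
    \prod_i (if x i \in B then s else 1)) =
    s^-1 ^+ (#|B| * h) * (1 - (1 - s) * (#|B|%:R / #|T|%:R)) ^+ m.
  under eq_bigr do rewrite mulrCA.
  rewrite -mulr_sumr; congr (_ * _).
  rewrite (uniform_prod (fun _ u => if u \in B then s else 1)).
  by rewrite prodr_sum_const prodr_const card_ord.
apply: ler_sum => x _; rewrite ler_wpM2l// ?exprn_ge0 ?invr_ge0//.
rewrite (prod_if_const (fun i => x i \in B)).
apply: le_trans (exp_indicator _ _ s01); rewrite ler_nat.
case: forall_inP => // hB; rewrite lt0b.
rewrite (_ : #|_| = \sum_(c in B) #|[set i | x i == c]|)%N; last first.
  rewrite -sum1_card (partition_big x (mem B))//=; apply: eq_bigr => c cB.
  rewrite -sum1dep_card; apply: eq_bigl => i.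
  by rewrite unfold_in; case: eqP => [->|_]; rewrite ?cB ?andbF.
by rewrite -sum_nat_const leq_sum.
Qed.

Lemma ord_ltF a b : (a < b)%N -> (a == b = false) * (b == a = false).
Proof. by rewrite -!val_eqE/= => ab; rewrite ltn_eqF ?gtn_eqF. Qed.

(** Products over all index pairs in which only the pairs containing [i] count,
    or, in the next lemma, only those between [A] and [A'], are turned into
    products over unordered pairs. *)
Lemma ordered_prod_incident i (F : 'I_m * 'I_m -> R) :
  (forall a b, ~~ ((a < b)%N && ((a == i) || (b == i))) -> F (a, b) = 1) ->
  \prod_ab F ab = \prod_(j | j != i) F (ordered i j).
Proof.
move=> F1.
pose P (ab : 'I_m * 'I_m) := (ab.1 < ab.2)%N && ((ab.1 == i) || (ab.2 == i)).
rewrite (bigID P)/= [X in _ * X]big1 ?mulr1; last by case=> a b; exact: F1.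
rewrite (reindex_onto (ordered i) (fun ab => if ab.1 == i then ab.2 else ab.1)).
  apply: eq_bigl => j; rewrite /P /ordered.
  case: (ltngtP i j) => [ij|ji|/val_inj ->] /=.
  - by rewrite ij eqxx/= eqxx (ord_ltF ij).
  - by rewrite ji eqxx orbT/= (ord_ltF ji) eqxx.
  - by rewrite ltnn eqxx.
case=> a b /andP[/= ab /orP[/eqP e|/eqP e]]; rewrite /ordered.
  by rewrite e eqxx -e ab.
by rewrite -e (ord_ltF ab) ltnNge (ltnW ab).
Qed.

Lemma ordered_prod_cross (A A' : {set 'I_m}) (F : 'I_m * 'I_m -> R) :
  [disjoint A & A'] ->
  (forall a b, ~~ [&& (a < b)%N & (a \in A) && (b \in A') || (a \in A') && (b \in A)] ->
    F (a, b) = 1) ->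
  \prod_ab F ab = \prod_(ab in finset.setX A A') F (ordered ab.1 ab.2).
Proof.
move=> dis F1.
pose P (ab : 'I_m * 'I_m) := (ab.1 < ab.2)%N &&
  ((ab.1 \in A) && (ab.2 \in A') || (ab.1 \in A') && (ab.2 \in A)).
have disF a : a \in A -> a \in A' -> False.
  by move=> aA; rewrite (disjointFr dis aA).
rewrite (bigID P)/= [X in _ * X]big1 ?mulr1; last by case=> a b; exact: F1.
rewrite (reindex_onto (fun ab => ordered ab.1 ab.2)
  (fun ab => if ab.1 \in A then ab else (ab.2, ab.1))).
  apply: eq_bigl => -[a b]; rewrite /P /ordered /= finset.in_setX /=.
  case: (ltngtP a b) => [ab|ba|/val_inj ->] /=.
  - rewrite ab /=; case: (boolP (a \in A)) => aA /=.
      rewrite eqxx andbT (_ : a \in A' = false) ?orbF//.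
      by apply/negP => /(disF _ aA).
    by rewrite xpair_eqE (ord_ltF ab) andbF.
  - rewrite ba /=; case: (boolP (b \in A)) => bA /=.
      rewrite xpair_eqE (ord_ltF ba) andbF.
      by rewrite (_ : b \in A' = false) ?andbF//; apply/negP => /(disF _ bA).
    by rewrite eqxx andbT andbC.
  - by rewrite ltnn /=; apply/esym/negP => /andP[/disF].
case=> a b /andP[/= ab]; rewrite /ordered.
case: (boolP (a \in A)) => aA /=; first by rewrite ab.
by rewrite ltnNge (ltnW ab).
Qed.

Lemma edge_prob_ordered x i j : i != j -> edge_prob x (ordered i j) = p (x j - x i).
Proof.
rewrite /edge_prob /ordered; case: (ltngtP i j) => [ij|ji|/val_inj ->] /=.
- by rewrite ij.
- by rewrite ji -p_even opprB.
- by rewrite eqxx.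
Qed.

(** The marks between [A] and [A'] are [#|A| * #|A'|] independent ones, each true
    with probability [p u], by evenness of [p] whatever the order of the ends. *)
Lemma no_cross_edge_bound (p0 : R) x (A A' : {set 'I_m}) u :
  p0 <= p u -> [disjoint A & A'] ->
  {in A & A', forall a a', x a' - x a = u} ->
  \sum_e marks_weight x e * ([forall a in A, forall a' in A', ~~ adj e a a'])%:R <=
  (1 - p0) ^+ (#|A| * #|A'|).
Proof.
move=> p0u dis xu.
pose P (ab : 'I_m * 'I_m) := (ab.1 < ab.2)%N &&
  ((ab.1 \in A) && (ab.2 \in A') || (ab.1 \in A') && (ab.2 \in A)).
pose phi ab (t : bool) : R := if P ab && t then 0 else 1.
have neA a a' : a \in A -> a' \in A' -> a != a'.
  by move=> aA; apply: contraTneq => <-; rewrite (disjointFr dis aA).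
apply: (@le_trans _ _ (\sum_e marks_weight x e * \prod_ab phi ab (e ab))).
  apply: ler_sum => e _; rewrite ler_wpM2l ?marks_weight_ge0//.
  case: forall_inP => [h|_] /=; last first.
    by apply: prodr_ge0 => ab _; rewrite /phi; case: ifP.
  rewrite big1// => -[a b] _; rewrite /phi; case: ifP => //.
  case/andP=> /andP[/= ab cr] eab.
  have adj_ab : adj e a b by rewrite /adj (ord_ltF ab) /ordered ab.
  case/orP : cr => /andP[h1 h2].
    by move: (h a h1) => /forall_inP/(_ b h2); rewrite adj_ab.
  by move: (h b h2) => /forall_inP/(_ a h1); rewrite adj_sym adj_ab.
rewrite marks_weight_prod (ordered_prod_cross dis); last first.
  by move=> a b /negPf h; rewrite /phi /P /= h/= !mulr1 addrC subrK.
rewrite -cardsX -prodr_const; apply: ler_prod => -[a a']; rewrite finset.in_setX => /andP[/= aA aA'].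
rewrite edge_prob_ordered ?neA// xu//.
have := p01 u; set o := ordered a a' => /andP[pu0 pu1].
have -> : phi o true = 0.
  rewrite /phi /P /o /ordered; have := neA _ _ aA aA'.
  by case: (ltngtP a a') => [h|h|/val_inj->] /=; rewrite ?h ?eqxx// ?aA ?aA' ?orbT.
rewrite {1 2}/phi andbF !mulr0 !add0r !mulr1 subr_ge0 pu1/=.
by rewrite lerD2l lerN2.
Qed.

(** Placing the [2 * k] points in the two cells costs [#|T|^-1] for each point. *)
Lemma cluster_pair_bound (p0 : R) (A A' : {set 'I_m}) c u k :
  p0 <= p u -> p0 <= 1 -> [disjoint A & A'] -> #|A| = k -> #|A'| = k ->
  \sum_(x : pos) \sum_e weight x e *
    [&& [forall a in A, x a == c], [forall a in A', x a == c + u] &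
        [forall a in A, forall a' in A', ~~ adj e a a']]%:R <=
  #|T|%:R^-1 ^+ k.*2 * (1 - p0) ^+ (k * k).
Proof.
move=> p0u p0_le1 dis Ak A'k.
pose G i (v : T) : R := if i \in A then (v == c)%:R else if i \in A' then (v == c + u)%:R else 1.
apply: (@le_trans _ _ (\sum_(x : pos) #|T|%:R^-1 ^+ m * \prod_i G i (x i) *
    (1 - p0) ^+ (k * k))); last first.
  rewrite -mulr_suml ler_wpM2r ?exprn_ge0 ?subr_ge0//.
  rewrite uniform_prod.
  have -> : #|T|%:R^-1 ^+ k.*2 = \prod_i (if i \in A :|: A' then #|T|%:R^-1 else 1) :> R.
    by rewrite prod_if_in cardsU (finset.disjoint_setI0 dis) cards0 subn0 Ak A'k addnn.
  apply: ler_prod => i _; apply/andP; split.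
    rewrite mulr_ge0 ?invr_ge0 ?ler0n// sumr_ge0// => v _.
    by rewrite /G; do 2 case: ifP => _ //; exact: ler0n.
  have sum1 (w : T) : \sum_v (v == w)%:R = 1 :> R.
    by rewrite (bigD1 w)//= eqxx big1 ?addr0// => v /negPf->.
  rewrite finset.in_setU /G; case: (i \in A) => /=; first by rewrite sum1 mulr1.
  case: (i \in A') => /=; first by rewrite sum1 mulr1.
  by rewrite sumr_const mulVf// gt_eqF// cardT_gt0.
apply: ler_sum => x _; rewrite /weight.
under [leLHS]eq_bigr do rewrite -mulrA.
rewrite -mulr_sumr -mulrA ler_wpM2l ?exprn_ge0 ?invr_ge0//.
case: (boolP ([forall a in A, x a == c] && [forall a in A', x a == c + u])); last first.
  move=> h; rewrite big1 ?mulr_ge0 ?exprn_ge0 ?subr_ge0//.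
    by apply: prodr_ge0 => i _; rewrite /G; do 2 case: ifP => _ //; exact: ler0n.
  by move=> e _; rewrite andbA (negPf h) mulr0.
case/andP=> xA xA'; rewrite [X in X * _](_ : _ = 1) ?mul1r; last first.
  rewrite big1// => i _; rewrite /G; case: ifP => [iA|_].
    by move/forall_inP : xA => /(_ i iA) ->.
  by case: ifP => // iA'; move/forall_inP : xA' => /(_ i iA') ->.
rewrite -{1}Ak -A'k xA xA'.
apply: (no_cross_edge_bound p0u dis) => // a a' aA aA'.
move/forall_inP : xA => /(_ a aA)/eqP->.
by move/forall_inP : xA' => /(_ a' aA')/eqP->; rewrite addrC addKr.
Qed.

(** Chernoff's inequality for the degree of [i] when the positions are fixed. *)
Lemma degree_marks_bound (s : R) (U : {set T}) x i (n : nat) : 0 < s <= 1 ->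
  \sum_e marks_weight x e * (#|[set j | ((x j - x i)%R \in U) && adj e i j]| <= n)%N%:R <=
  s^-1 ^+ n * \prod_(j | j != i) (if x j - x i \in U then 1 - (1 - s) * p (x j - x i) else 1).
Proof.
move=> s01; have [s0 s1] := andP s01.
pose other (ab : 'I_m * 'I_m) := if ab.1 == i then ab.2 else ab.1.
pose P (ab : 'I_m * 'I_m) := (ab.1 < ab.2)%N && ((ab.1 == i) || (ab.2 == i)).
pose Q ab := P ab && (x (other ab) - x i \in U).
pose phi ab (t : bool) : R := if Q ab && t then s else 1.
have PQ j : j != i -> Q (ordered i j) = (x j - x i \in U).
  rewrite /Q /P /other /ordered; case: (ltngtP i j) => [ij|ji|/val_inj->] /=.
  - by rewrite ij eqxx.
  - by rewrite ji eqxx orbT (ord_ltF ji).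
  - by rewrite eqxx.
have nP ab : ~~ P ab -> Q ab = false by rewrite /Q => /negPf->.
apply: (@le_trans _ _ (\sum_e marks_weight x e * (s^-1 ^+ n * \prod_ab phi ab (e ab)))).
  apply: ler_sum => e _; rewrite ler_wpM2l ?marks_weight_ge0//.
  rewrite (@ordered_prod_incident i (fun ab => phi ab (e ab))); last first.
    by move=> a b h; rewrite /phi (nP (a, b) h).
  apply: le_trans (exp_indicator _ _ s01) _; rewrite ler_wpM2l ?exprn_ge0 ?invr_ge0 ?(ltW s0)//.
  rewrite le_eqVlt; apply/orP; left; apply/eqP.
  rewrite -prod_if_in [RHS]big_mkcond; apply: eq_bigr => j _.
  rewrite !inE /adj eq_sym; case: eqVneq => [->|ji] /=; first by rewrite andbF.
  by rewrite /phi PQ.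
under [leLHS]eq_bigr do rewrite mulrCA.
rewrite -mulr_sumr ler_wpM2l ?exprn_ge0 ?invr_ge0 ?(ltW s0)//.
rewrite marks_weight_prod (@ordered_prod_incident i); last first.
  by move=> a b h; rewrite /phi (nP (a, b) h) !mulr1 addrC subrK.
apply: ler_prod => j ji; rewrite edge_prob_ordered 1?eq_sym// /phi PQ//.
have /andP[q0 q1] := p01 (x j - x i).
rewrite andbT andbF !mulr1; case: ifP => _; last by rewrite mulr1 addrC subrK ler01 lexx.
by rewrite addr_ge0 ?mulr_ge0 ?subr_ge0 ?(ltW s0)//=; lra.
Qed.

(** Averaged over the position of [j], the [j]-th factor of [degree_marks_bound]
    does not depend on the position of [i], by translation invariance. *)
Lemma degree_bound (s : R) (U : {set T}) i (n : nat) : 0 < s <= 1 ->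
  \sum_(x : pos) \sum_e weight x e *
    (#|[set j | ((x j - x i)%R \in U) && adj e i j]| <= n)%N%:R <=
  s^-1 ^+ n * (1 - (1 - s) * ((\sum_(u in U) p u) / #|T|%:R)) ^+ m.-1.
Proof.
move=> s01; have [s0 s1] := andP s01.
pose G (u : T) : R := if u \in U then 1 - (1 - s) * p u else 1.
have Gsum c : #|T|%:R^-1 * \sum_v G (v - c) =
    1 - (1 - s) * ((\sum_(u in U) p u) / #|T|%:R).
  rewrite (reindex_inj (addIr c))/=; under eq_bigr do rewrite addrK.
  have -> : \sum_u G u = \sum_(u : T) (1 - (1 - s) * (if u \in U then p u else 0)).
    by apply: eq_bigr => u _; rewrite /G; case: ifP => _ //; rewrite mulr0 subr0.
  rewrite sumrB -mulr_sumr -big_mkcond sumr_const.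
  by have := cardT_gt0; move: #|T|%:R => t t0; field; rewrite gt_eqF.
apply: (@le_trans _ _ (\sum_(x : pos) #|T|%:R^-1 ^+ m *
    (s^-1 ^+ n * \prod_(j | j != i) G (x j - x i)))).
  apply: ler_sum => x _; rewrite /weight.
  under [leLHS]eq_bigr do rewrite -mulrA.
  rewrite -mulr_sumr ler_wpM2l ?exprn_ge0 ?invr_ge0//.
  exact: degree_marks_bound.
under [leLHS]eq_bigr do rewrite mulrCA.
rewrite -mulr_sumr ler_wpM2l ?exprn_ge0 ?invr_ge0 ?(ltW s0)//.
(* Summing over the position [c] of the vertex [i] turns the integrand into a
   product over the vertices. *)
have split_i x : \prod_(j | j != i) G (x j - x i) =
    \sum_c \prod_j (if j == i then (x j == c)%:R else G (x j - c)).
  rewrite (bigD1 (x i))//= [X in _ + X]big1 ?addr0; last first.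
    by move=> c cx; rewrite (bigD1 i)//= eqxx eq_sym (negPf cx) mul0r.
  rewrite [RHS](bigD1 i)//= !eqxx mul1r; apply: eq_bigr => j /negPf ji.
  by rewrite ji.
under [leLHS]eq_bigr do rewrite split_i mulr_sumr.
rewrite exchange_big/=.
have term c : \sum_(x : pos) #|T|%:R^-1 ^+ m *
    \prod_j (if j == i then (x j == c)%:R else G (x j - c)) =
    #|T|%:R^-1 * (1 - (1 - s) * ((\sum_(u in U) p u) / #|T|%:R)) ^+ m.-1.
  rewrite (uniform_prod (fun j v => if j == i then (v == c)%:R else G (v - c))).
  rewrite (bigD1 i)//= eqxx (bigD1 c)//= eqxx big1 ?addr0 ?mulr1; last first.
    by move=> v /negPf->.
  congr (_ * _).
  under eq_bigr => j /negPf -> do rewrite Gsum.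
  rewrite prodr_const cardC1 card_ord; done.
under eq_bigr do rewrite term.
by rewrite sumr_const -[X in X <= _]mulr_natl mulrA mulfV ?mul1r// gt_eqF// cardT_gt0.
Qed.

Section good_configurations.
Variables (F : {set {set T}}) (h k : nat) (U : {set T}).

(** The family [F] consists of the sets of cells that must not be sparse, and [U]
    of the offsets at which edges occur. *)
Definition cells_ok (B : {set T}) x := [exists c in B, (h < #|[set i | x i == c]|)%N].

Definition cross_ok c u (AA : {set 'I_m} * {set 'I_m}) x e :=
  ([forall a in AA.1, x a == c] && [forall a in AA.2, x a == c + u]) ==>
  [exists a in AA.1, exists a' in AA.2, adj e a a'].

Definition k_pairs : {set {set 'I_m} * {set 'I_m}} :=
  [set AA : {set 'I_m} * {set 'I_m} | [&& #|AA.1| == k, #|AA.2| == k & [disjoint AA.1 & AA.2]]].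

Definition vertex_ok x e i :=
  [exists u in U, (h < #|[set j | (x j == (x i + u)%R) && adj e i j]|)%N].

Definition good x e := [&& [forall B in F, cells_ok B x],
  [forall c, forall u in U, forall AA in k_pairs, cross_ok c u AA x e] &
  [forall i, vertex_ok x e i]].

Lemma card_k_pairs : (#|k_pairs| <= m ^ k.*2)%N.
Proof.
pose Dk := [set A : {set 'I_m} | #|A| == k].
apply: (@leq_trans #|finset.setX Dk Dk|).
  apply/subset_leq_card/fintype.subsetP => -[A A']; rewrite !inE /=.
  by case/and3P => -> ->.
have Dk_le : (#|Dk| <= m ^ k)%N.
  rewrite card_draws card_ord; apply: (@leq_trans (m ^_ k)).
    by rewrite -bin_ffact leq_pmulr ?fact_gt0.
  by rewrite ffact_prod -[X in (_ <= _ ^ X)%N]card_ord -prod_nat_const leq_prod// => j _; exact: leq_subr.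
by rewrite cardsX -addnn expnD leq_mul.
Qed.

Lemma sum_weight : \sum_(x : pos) \sum_e weight x e = 1.
Proof.
transitivity (\sum_(x : pos) #|T|%:R^-1 ^+ m * \prod_(i < m) (1 : R)).
  by apply: eq_bigr => x _; rewrite -mulr_sumr marks_weight_sum big1.
rewrite (uniform_prod (fun _ _ => 1)) big1// => i _.
by rewrite sumr_const mulVf// gt_eqF// cardT_gt0.
Qed.

(** Union bound. For the last term, a vertex with at most [h] neighbours in each
    cell at an offset in [U] has at most [#|U| * h] such neighbours in all. *)
Lemma good_probability (s p0 : R) (b : nat) : 0 < s <= 1 -> p0 <= 1 ->
  (forall u, u \in U -> p0 <= p u) -> (forall B, B \in F -> #|B| = b) ->
  1 - (#|F|%:R * (s^-1 ^+ (b * h) * (1 - (1 - s) * (b%:R / #|T|%:R)) ^+ m) +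
       #|T|%:R * #|U|%:R * (m%:R / #|T|%:R) ^+ k.*2 * (1 - p0) ^+ (k * k) +
       m%:R * (s^-1 ^+ (#|U| * h) *
         (1 - (1 - s) * ((\sum_(u in U) p u) / #|T|%:R)) ^+ m.-1)) <=
  \sum_(x : pos) \sum_e weight x e * (good x e)%:R.
Proof.
move=> s01 p01' p0u Fb.
pose f1 x (B : {set T}) := [forall c in B, #|[set i | x i == c]| <= h]%N.
pose f2 x e c u (AA : {set 'I_m} * {set 'I_m}) :=
   [&& [forall a in AA.1, x a == c], [forall a in AA.2, x a == c + u] &
        [forall a in AA.1, forall a' in AA.2, ~~ adj e a a']].
pose f3 x e i := (#|[set j | ((x j - x i)%R \in U) && adj e i j]| <= #|U| * h)%N.
have pointwise x e : 1 <= (good x e)%:R + (\sum_(B in F) (f1 x B)%:R +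
    \sum_c \sum_(u in U) \sum_(AA in k_pairs) (f2 x e c u AA)%:R +
    \sum_i (f3 x e i)%:R) :> R.
  have ge0 (I : finType) (P : pred I) (G : I -> bool) :
    0 <= \sum_(i | P i) (G i)%:R :> R by exact: sumr_ge0.
  have ge1 (I : finType) (P : pred I) (G : I -> R) (l : I) : P l -> 1 <= G l ->
    (forall l : I, 0 <= G l) -> 1 <= \sum_(l | P l) G l :> R.
    move=> Pi Gi G0; by rewrite (bigD1 l)//= ler_wpDr// sumr_ge0.
  have g1 := ge0 _ (mem F) (f1 x).
  have g2u c u : 0 <= \sum_(AA in k_pairs) (f2 x e c u AA)%:R :> R by exact: ge0.
  have g2c c : 0 <= \sum_(u in U) \sum_(AA in k_pairs) (f2 x e c u AA)%:R :> R.
    exact: sumr_ge0.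
  have g2 : 0 <= \sum_c \sum_(u in U) \sum_(AA in k_pairs) (f2 x e c u AA)%:R :> R.
    exact: sumr_ge0.
  have g3 := ge0 _ predT (f3 x e).
  case: (boolP (good x e)) => [_|]; first by rewrite ler_wpDr ?addr_ge0.
  rewrite add0r /good !negb_and => /or3P[/forall_inPn[B BF nB]|/forallPn[c /forall_inPn[u uU /forall_inPn[AA AAk]]]|/forallPn[i ni]].
  - rewrite -addrA ler_wpDr ?addr_ge0//; apply: (ge1 _ _ _ B) => //.
    rewrite (_ : f1 x B)//; apply/forall_inP => c cB; rewrite leqNgt.
    by apply: contraNN nB => hc; apply/exists_inP; exists c.
  - rewrite negb_imply => /andP[/andP[h1 h2] h3].
    rewrite ler_wpDr// ler_wpDl//; apply: (ge1 _ _ _ c) => //.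
    apply: (ge1 _ _ _ u) => //; apply: (ge1 _ _ _ AA) => //.
    rewrite (_ : f2 x e c u AA)//; rewrite /f2 h1 h2 /=.
    apply/forall_inP => a aA; apply/forall_inP => a' aA'.
    apply: contraNN h3 => ea; apply/exists_inP; exists a => //.
    by apply/exists_inP; exists a'.
  - rewrite ler_wpDl ?addr_ge0//; apply: (ge1 _ _ _ i) => //.
    rewrite (_ : f3 x e i)// /f3 -sum_nat_const.
    rewrite -sum1dep_card (partition_big (fun j => x j - x i) (mem U))/=; last first.
      by move=> j /andP[].
    apply: leq_sum => u uU; rewrite sum1dep_card leqNgt.
    apply: contraNN ni => hu; apply/exists_inP; exists u => //.
    apply: leq_trans hu _; apply/subset_leq_card/fintype.subsetP => j.
    by rewrite !inE => /andP[/andP[_ ->] /eqP <-]; rewrite addrC subrK eqxx.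
set E1 := _ * (s^-1 ^+ (b * h) * _); set E2 := _ * (1 - p0) ^+ _; set E3 := m%:R * _.
have H1 : \sum_(x : pos) \sum_e weight x e * \sum_(B in F) (f1 x B)%:R <= E1.
  have -> : \sum_(x : pos) \sum_e weight x e * \sum_(B in F) (f1 x B)%:R =
      \sum_(B in F) \sum_(x : pos) #|T|%:R^-1 ^+ m * (f1 x B)%:R.
    rewrite [RHS]exchange_big/=; apply: eq_bigr => x _.
    rewrite -mulr_suml -mulr_sumr /weight -mulr_sumr marks_weight_sum mulr1.
    by rewrite mulr_sumr.
  rewrite /E1 mulr_natl -[leRHS]sumr_const; apply: ler_sum => B BF.
  by rewrite -(Fb B BF); exact: sparse_cells_bound.
have H2 : \sum_(x : pos) \sum_e weight x e *
    \sum_c \sum_(u in U) \sum_(AA in k_pairs) (f2 x e c u AA)%:R <= E2.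
  have -> : \sum_(x : pos) \sum_e weight x e *
      \sum_c \sum_(u in U) \sum_(AA in k_pairs) (f2 x e c u AA)%:R =
    \sum_c \sum_(u in U) \sum_(AA in k_pairs)
      \sum_(x : pos) \sum_e weight x e * (f2 x e c u AA)%:R.
    under eq_bigr => x _ do under eq_bigr => e _ do rewrite mulr_sumr.
    under eq_bigr => x _ do rewrite exchange_big/=.
    rewrite exchange_big/=; apply: eq_bigr => c _.
    under eq_bigr => x _ do under eq_bigr => e _ do rewrite mulr_sumr.
    under eq_bigr => x _ do rewrite exchange_big/=.
    rewrite exchange_big/=; apply: eq_bigr => u _.
    under eq_bigr => x _ do under eq_bigr => e _ do rewrite mulr_sumr.
    under eq_bigr => x _ do rewrite exchange_big/=.
    by rewrite exchange_big.
  apply: (@le_trans _ _ (\sum_(c : T) \sum_(u in U) \sum_(AA in k_pairs)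
     #|T|%:R^-1 ^+ k.*2 * (1 - p0) ^+ (k * k))).
    apply: ler_sum => c _; apply: ler_sum => u uU; apply: ler_sum => AA.
    rewrite inE => /and3P[/eqP A1 /eqP A2 dis].
    by apply: cluster_pair_bound => //; exact: p0u.
  rewrite !sumr_const /E2; set y := (1 - p0) ^+ (k * k).
  have y0 : 0 <= y by rewrite exprn_ge0// subr_ge0.
  have -> : #|T|%:R^-1 ^+ k.*2 * y *+ #|k_pairs| *+ #|U| *+ #|T| =
      #|T|%:R * #|U|%:R * (#|k_pairs|%:R * #|T|%:R^-1 ^+ k.*2) * y.
    by rewrite -mulrA -[in RHS]mulrA -mulrA !mulr_natl.
  rewrite ler_wpM2r// ler_wpM2l ?mulr_ge0// expr_div_n exprVn ler_wpM2r ?invr_ge0 ?exprn_ge0//.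
  by rewrite -natrX ler_nat card_k_pairs.
have H3 : \sum_(x : pos) \sum_e weight x e * \sum_i (f3 x e i)%:R <= E3.
  under eq_bigr => x _ do under eq_bigr => e _ do rewrite mulr_sumr.
  under eq_bigr => x _ do rewrite exchange_big/=.
  rewrite exchange_big/= /E3 mulr_natl -[X in _ *+ X]card_ord -[leRHS]sumr_const.
  by apply: ler_sum => i _; exact: degree_bound.
rewrite lerBlDr -[leLHS]sum_weight.
apply: (@le_trans _ _ (\sum_(x : pos) \sum_e weight x e * ((good x e)%:R + (\sum_(B in F) (f1 x B)%:R +
    \sum_c \sum_(u in U) \sum_(AA in k_pairs) (f2 x e c u AA)%:R +
    \sum_i (f3 x e i)%:R)))).
  apply: ler_sum => x _; apply: ler_sum => e _.
  by rewrite -[leLHS]mulr1 ler_wpM2l ?weight_ge0.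
under eq_bigr => x _ do under eq_bigr => e _ do rewrite 3!mulrDr.
under eq_bigr => x _ do rewrite 3!big_split/=.
by rewrite 3!big_split/= !lerD.
Qed.

End good_configurations.

End model.

Local Open Scope classical_set_scope.
Local Open Scope ring_scope.

(** * Concentration of the Poisson law *)

Section poisson.
Context (R : realType) (a : R).
Hypothesis a0 : 0 < a.
Notation pmf := (poisson_pmf a).

Lemma poisson_pmfS k : k.+1%:R * pmf k.+1 = a * pmf k.
Proof.
rewrite /poisson_pmf a0 exprS factS natrM invfM.
have h1 : k.+1%:R != 0 :> R by rewrite pnatr_eq0.
have h2 : k`!%:R != 0 :> R by rewrite pnatr_eq0 -lt0n fact_gt0.
by move: h1 h2; move: k.+1%:R k`!%:R => u v h1 h2; field; rewrite h1 h2.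
Qed.

(** The sum telescopes because [k%:R * pmf k = a * pmf k.-1]. Beyond the mean the
    correction term is nonpositive, which bounds the variance by [a]. *)
Lemma poisson_variance_partial (M : nat) :
  \sum_(k < M.+2) pmf k * (k%:R - a) ^+ 2 =
  a * (\sum_(k < M.+1) pmf k) + a ^+ 2 * (pmf M.+1 - pmf M).
Proof.
elim: M => [|M IH].
  rewrite !big_ord_recr !big_ord0 /= !add0r.
  have := poisson_pmfS 0; rewrite mul1r => ->; ring.
rewrite big_ord_recr /= IH [X in _ = _ * X + _]big_ord_recr /=.
have h1 := poisson_pmfS M; have h2 := poisson_pmfS M.+1.
move: h1 h2; move: (pmf M.+2) (pmf M.+1) (pmf M) (\sum_(k < M.+1) _) => p2 p1 p0 s h1 h2.
have -> : p2 * (M.+2%:R - a) ^+ 2 =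
    (M.+2%:R * p2) * M.+2%:R - 2 * a * (M.+2%:R * p2) + a ^+ 2 * p2 by ring.
have M2 : M.+2%:R = M.+1%:R + 1 :> R by rewrite natr1.
rewrite h2 [in X in a * p1 * X]M2.
have -> : a * p1 * (M.+1%:R + 1) = a * (M.+1%:R * p1) + a * p1 by ring.
by rewrite h1; ring.
Qed.

Lemma poisson_pmf_cvg : series (fun k => pmf k) @ \oo --> (1 : R).
Proof.
have -> : series (fun k => pmf k) = (fun n => expR (- a) * series (exp_coeff a) n).
  apply/funext => n; rewrite /series/= mulr_sumr; apply: eq_bigr => k _.
  by rewrite /poisson_pmf a0 mulrC /exp_coeff.
have -> : (1 : R) = expR (- a) * expR a by rewrite expRN mulVf// gt_eqF// expR_gt0.
by apply: cvgMr; exact: is_cvg_series_exp_coeff.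
Qed.

Lemma poisson_partial_le1 n : \sum_(k < n) pmf k <= 1.
Proof.
rewrite -(big_mkord predT (fun k => pmf k)).
have <- : limn (series (fun k => pmf k)) = 1 by apply/cvg_lim => //; exact: poisson_pmf_cvg.
apply: nondecreasing_cvgn_le; last by apply/cvg_ex; exists 1; exact: poisson_pmf_cvg.
by apply/nondecreasing_seqP => k; rewrite /series/= big_nat_recr//= lerDl poisson_pmf_ge0.
Qed.

(** Chebyshev's inequality, for a finite part of the law: one inverse of
    [eps ^+ 2 * a] pays for the deviations and one for the truncation at [M]. *)
Lemma poisson_concentration (eps : R) : 0 < eps ->
  exists M : nat, 1 - 2 / (eps ^+ 2 * a) <=
    \sum_(k < M | `|(k : nat)%:R - a| <= eps * a) pmf k.
Proof.
move=> e0; have ea : 0 < (eps ^+ 2 * a)^-1 by rewrite invr_gt0 mulr_gt0// exprn_gt0.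
have /cvgr_gt/(_ (1 - (eps ^+ 2 * a)^-1)) := poisson_pmf_cvg.
have -> : 1 - (eps ^+ 2 * a)^-1 < 1 by lra.
case=> // M0 _ hM.
pose M := (maxn M0 (Num.truncn a).+1)%N.
have aM : a <= M.+1%:R.
  by apply: le_trans (ltW (truncnS_gt a)) _; rewrite ler_nat leqW// leq_maxr.
exists M.+2.
have := hM M.+2; rewrite /= => /(_ _)/ltW hS.
have {}hS : 1 - (eps ^+ 2 * a)^-1 <= \sum_(k < M.+2) pmf k.
  rewrite -(big_mkord predT (fun k => pmf k)); apply: hS.
  by rewrite -[(M0 <= _)%N]/(M0 <= M.+2)%N /M !leqW// leq_maxl.
rewrite (bigID (fun k : 'I_M.+2 => `|(k : nat)%:R - a| <= eps * a))/= in hS.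
have tail : \sum_(k < M.+2 | ~~ (`|(k : nat)%:R - a| <= eps * a)) pmf k <= (eps ^+ 2 * a)^-1.
  apply: (@le_trans _ _ (\sum_(k < M.+2) pmf k * (k%:R - a) ^+ 2 / (eps * a) ^+ 2)).
    rewrite [leRHS](bigID (fun k : 'I_M.+2 => `|(k : nat)%:R - a| <= eps * a))/=.
    rewrite -[leLHS]add0r; apply: lerD.
      apply: sumr_ge0 => k _; apply: divr_ge0; last exact: sqr_ge0.
      by apply: mulr_ge0; [exact: poisson_pmf_ge0|exact: sqr_ge0].
    apply: ler_sum => k; rewrite -ltNge => hk.
    rewrite -mulrA ler_peMr ?poisson_pmf_ge0// ler_pdivlMr ?mul1r ?exprn_gt0 ?mulr_gt0//.
    rewrite -[leRHS]real_normK ?num_real//; apply: lerXn2r; rewrite ?nnegrE//.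
      by rewrite ltW// mulr_gt0.
    exact: ltW.
  rewrite -mulr_suml poisson_variance_partial ler_pdivrMr ?exprn_gt0 ?mulr_gt0//.
  have -> : (eps ^+ 2 * a)^-1 * (eps * a) ^+ 2 = a by field; rewrite !gt_eqF.
  have S1 := poisson_partial_le1 M.+1.
  have pM : pmf M.+1 <= pmf M.
    rewrite -(ler_pM2l (_ : 0 < M.+1%:R :> R))// poisson_pmfS ler_wpM2r ?poisson_pmf_ge0//.
  have : a ^+ 2 * (pmf M.+1 - pmf M) <= 0 by rewrite mulr_ge0_le0 ?sqr_ge0 ?subr_le0.
  have : a * (\sum_(k < M.+1) pmf k) <= a by rewrite ger_pMr.
  by lra.
move: hS tail; set s1 := \sum_(k < M.+2 | _) _; set s2 := \sum_(k < M.+2 | ~~ _) _.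
by move=> *; lra.
Qed.

End poisson.

(** * The size of the union bound *)

(** The comparison of exponents that concludes [cross_decay]. *)
Lemma half_gap (R : realFieldType) (l A B C T : R) :
  A <= B -> C <= A -> l + T <= C / 2 -> l + (A / 2 - B) <= - T.
Proof. by move=> *; lra. Qed.

Section error.
Context (R : realType).
Variables (gamma c1 eps mu p0 tau : R) (Dn b Cb : nat).
Hypothesis eps0 : 0 < eps < 2^-1.
Hypothesis tau0 : 0 < tau.
Hypothesis c1_gt0 : 0 < c1.
Hypothesis gamma_large : 1 + 2 * tau <= (1 - eps) ^+ 3 * (1 - 2 * eps) * gamma.
Hypothesis mean_large : (1 - eps) * gamma <= c1 * (mu - 1).
Hypothesis Sb : mu - 1 <= b%:R.
Hypothesis bDn : (b <= Dn)%N.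
Hypothesis p0_gt0 : 0 < p0 <= 1.

Lemma expr_le_expR (x : R) m : x <= 1 -> (1 - x) ^+ m <= expR (- (x * m%:R)).
Proof.
move=> x1; rewrite mulrC -mulrN expRM_natl; apply: lerXn2r; rewrite ?nnegrE ?subr_ge0 ?expR_ge0//.
exact: expR_ge1Dx.
Qed.

(** The price, in the exponent, of each point allowed by a Chernoff bound with
    tilt [eps]. *)
Definition tilt_cost : R := - ln eps.
(** So small that the price of [2 * cluster_size] points in each of [Dn] cells is
    at most [tau * lam] ([chernoff_factor]). *)
Definition cluster_rate : R := tau / (4 * (Dn%:R + 1) * (tilt_cost + 1)).
Definition cluster_size (lam : R) := (Num.truncn (cluster_rate * lam)).+1.

Let e0 : 0 < eps. Proof. by case/andP: eps0. Qed.
Let e12 : eps < 2^-1. Proof. by case/andP: eps0. Qed.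

Let e1 : 0 < 1 - eps. Proof. by rewrite subr_gt0; apply: lt_trans e12 _; lra. Qed.
Let e2 : 0 < 1 - 2 * eps. Proof. by rewrite subr_gt0 -ltr_pdivlMl// mulr1. Qed.

Let tilt_cost_gt0 : 0 < tilt_cost.
Proof. by rewrite /tilt_cost oppr_gt0 ln_lt0// e0 (lt_trans e12)//; lra. Qed.

Ltac plra := move: (e0) (e12) (tau0) (c1_gt0) => ? ? ? ?; lra.

Let D1_gt0 : 0 < 4 * (Dn%:R + 1) * (tilt_cost + 1).
Proof. by rewrite mulr_gt0 ?addr_gt0// mulr_gt0// ltr_wpDl. Qed.

Let cluster_rate_gt0 : 0 < cluster_rate.
Proof. exact: divr_gt0 tau0 D1_gt0. Qed.

Let cluster_rate_le : 4 * Dn%:R * tilt_cost * cluster_rate <= tau.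
Proof.
rewrite /cluster_rate mulrA ler_pdivrMr// [leRHS]mulrC ler_wpM2r ?(ltW tau0)//.
by rewrite ler_pM ?mulr_ge0 ?(ltW tilt_cost_gt0)// ?ler_wpM2l// lerDl.
Qed.

Let eps_inv : eps^-1 = expR tilt_cost.
Proof. by rewrite /tilt_cost expRN lnK// posrE. Qed.

Let cluster_size_bounds lam : 1 <= cluster_rate * lam ->
  cluster_rate * lam <= (cluster_size lam)%:R <= 2 * (cluster_rate * lam).
Proof.
move=> h; have z0 : 0 <= cluster_rate * lam by apply: le_trans h.
rewrite /cluster_size (ltW (truncnS_gt _))/= -natr1.
have /andP[h1 _] := truncn_itv z0; plra.
Qed.

Let chernoff_factor lam (c : nat) : (c <= Dn)%N -> 1 <= cluster_rate * lam ->
  eps^-1 ^+ (c * (cluster_size lam).*2.-1) <= expR (tau * lam).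
Proof.
move=> cD h; have /andP[_ k2] := cluster_size_bounds h.
rewrite eps_inv -expRM_natl ler_expR.
have lam0 : 0 < lam by rewrite -(pmulr_rgt0 _ cluster_rate_gt0) (lt_le_trans _ h).
apply: (@le_trans _ _ ((Dn%:R * (4 * (cluster_rate * lam))) * tilt_cost)).
  rewrite ler_wpM2r ?(ltW tilt_cost_gt0)// natrM ler_pM// ?ler_nat//.
  apply: (@le_trans _ _ ((cluster_size lam).*2%:R)); first by rewrite ler_nat leq_pred.
  by rewrite -muln2 natrM; plra.
have -> : Dn%:R * (4 * (cluster_rate * lam)) * tilt_cost = (4 * Dn%:R * tilt_cost * cluster_rate) * lam by ring.
by rewrite ler_wpM2r ?cluster_rate_le// ltW.
Qed.

(** Both Chernoff bounds lead here: [q * v * n] is the mean number of points in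
    [b] cells, or the mean degree, and it exceeds [lam] by a factor. *)
Let decay (lam n v q : R) (m : nat) : 0 < n -> 0 < lam -> 0 < v ->
  (1 - eps) * c1 * lam <= v * n -> (1 - 2 * eps) * n <= m%:R -> mu - 1 <= q -> q * v <= 1 ->
  (1 - (1 - eps) * (q * v)) ^+ m <= expR (- ((1 + 2 * tau) * lam)).
Proof.
move=> n0 lam0 v0 hv hm hq qv.
have S1 : 0 < mu - 1.
  have g0 : 0 < gamma.
    have : 0 < (1 - eps) ^+ 3 * (1 - 2 * eps) * gamma by apply: lt_le_trans gamma_large; plra.
    by rewrite pmulr_rgt0// mulr_gt0// ?exprn_gt0//; plra.
  by rewrite -(pmulr_rgt0 _ c1_gt0); apply: lt_le_trans mean_large; rewrite mulr_gt0.
have q0 : 0 < q by apply: lt_le_trans hq.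
have x1 : (1 - eps) * (q * v) <= 1 by rewrite mulr_ile1 ?mulr_ge0 ?(ltW q0) ?(ltW v0)//; plra.
apply: le_trans (expr_le_expR _ x1) _; rewrite ler_expR lerN2.
apply: (@le_trans _ _ ((1 - eps) ^+ 3 * (1 - 2 * eps) * gamma * lam)).
  by rewrite ler_wpM2r// ltW.
apply: (@le_trans _ _ ((1 - eps) * ((mu - 1) * v) * ((1 - 2 * eps) * n))); last first.
  rewrite ler_pM// ?mulr_ge0 ?(ltW e1) ?(ltW S1) ?(ltW v0) ?(ltW n0)//; try plra.
  by rewrite ler_pM2l// ler_pM2r.
have -> : (1 - eps) * ((mu - 1) * v) * ((1 - 2 * eps) * n) =
   (1 - eps) * (1 - 2 * eps) * (mu - 1) * (v * n) by ring.
apply: (@le_trans _ _ ((1 - eps) * (1 - 2 * eps) * (mu - 1) * ((1 - eps) * c1 * lam))); last first.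
  rewrite ler_wpM2l// !mulr_ge0// ?(ltW e1) ?(ltW S1)//; plra.
have -> : (1 - eps) * (1 - 2 * eps) * (mu - 1) * ((1 - eps) * c1 * lam) =
  ((1 - eps) ^+ 2 * (1 - 2 * eps) * lam) * (c1 * (mu - 1)) by ring.
have -> : (1 - eps) ^+ 3 * (1 - 2 * eps) * gamma * lam =
  ((1 - eps) ^+ 2 * (1 - 2 * eps) * lam) * ((1 - eps) * gamma) by ring.
rewrite ler_wpM2l// !mulr_ge0 ?sqr_ge0 ?(ltW lam0)//; plra.
Qed.

(** With [k] of order [lam], the factor [(1 - p0) ^+ (k * k)] is exponentially small
    in [lam ^+ 2], while [(m * v) ^+ (2 * k)] is only [expR] of [lam * ln lam] up
    to constants. *)
Let cross_decay (lam n v m : R) : 1 <= lam -> 1 <= cluster_rate * lam ->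
  4 * c1 ^+ 2 <= lam ^+ 2 * (p0 * cluster_rate / 8) ^+ 4 -> 1 + tau <= p0 * cluster_rate ^+ 2 * lam / 2 ->
  0 <= v -> 0 <= m -> m * v <= 2 * c1 * lam -> n = expR lam ->
  n * ((m * v) ^+ (cluster_size lam).*2 * (1 - p0) ^+ (cluster_size lam * cluster_size lam)) <=
  expR (- (tau * lam)).
Proof.
move=> lam1 zl h1 h2 v0 m0 mv ->; set k := cluster_size lam.
have /andP[kz _] := cluster_size_bounds zl; rewrite -/k in kz.
have lam0 : 0 < lam by plra.
have zl0 : 0 < cluster_rate * lam by apply: lt_le_trans zl.
have /andP[p00 p01] := p0_gt0.
(* The fourth power of [p0 * cluster_rate * lam / 8] is at most its exponential
   to the fourth, and exceeds the left-hand side for large [lam]. *)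
have sq_le : (2 * c1 * lam) ^+ 2 <= expR (p0 * cluster_rate * lam / 2).
  apply: (@le_trans _ _ ((p0 * cluster_rate * lam / 8) ^+ 4)).
    have -> : (2 * c1 * lam) ^+ 2 = lam ^+ 2 * (4 * c1 ^+ 2) by ring.
    have -> : (p0 * cluster_rate * lam / 8) ^+ 4 = lam ^+ 2 * (lam ^+ 2 * (p0 * cluster_rate / 8) ^+ 4).
      by ring.
    by rewrite ler_wpM2l// sqr_ge0.
  have -> : p0 * cluster_rate * lam / 2 = 4%:R * (p0 * cluster_rate * lam / 8) by field.
  rewrite expRM_natl; apply: lerXn2r; rewrite ?nnegrE ?expR_ge0//.
    by rewrite ltW// divr_gt0// -mulrA; exact: mulr_gt0 p00 zl0.
  by apply: le_trans (expR_ge1Dx _); rewrite lerDr.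
have t1 : (m * v) ^+ k.*2 <= expR (k%:R * (p0 * cluster_rate * lam / 2)).
  rewrite expRM_natl -mul2n exprM; apply: lerXn2r; rewrite ?nnegrE ?sqr_ge0 ?expR_ge0//.
  apply: le_trans sq_le; apply: lerXn2r; rewrite ?nnegrE ?mulr_ge0//; plra.
have t2 : (1 - p0) ^+ (k * k) <= expR (- (p0 * (k * k)%:R)) by exact: expr_le_expR.
apply: (@le_trans _ _ (expR lam * (expR (k%:R * (p0 * cluster_rate * lam / 2)) * expR (- (p0 * (k * k)%:R))))).
  rewrite ler_wpM2l ?expR_ge0// ler_pM// ?exprn_ge0 ?mulr_ge0 ?subr_ge0//.
rewrite -!expRD ler_expR natrM.
have k0 : 0 <= k%:R :> R by [].
have k1 : p0 * (cluster_rate * lam) * k%:R <= p0 * k%:R * k%:R.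
  by rewrite ler_wpM2r// ler_wpM2l// ltW.
have k2 : p0 * (cluster_rate * lam) * (cluster_rate * lam) <= p0 * (cluster_rate * lam) * k%:R.
  by rewrite ler_wpM2l//; exact: mulr_ge0 (ltW p00) (ltW zl0).
have k3 : (1 + tau) * lam <= (p0 * cluster_rate ^+ 2 * lam / 2) * lam by rewrite ler_wpM2r// ltW.
have E : (p0 * cluster_rate ^+ 2 * lam / 2) * lam = p0 * (cluster_rate * lam) * (cluster_rate * lam) / 2 by field.
have E2 : k%:R * (p0 * cluster_rate * lam / 2) = p0 * (cluster_rate * lam) * k%:R / 2 by field.
rewrite E in k3; rewrite E2 [p0 * (k%:R * k%:R)]mulrA.
have {k3} : lam + tau * lam <= p0 * (cluster_rate * lam) * (cluster_rate * lam) / 2.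
  by move: k3; rewrite mulrDl mul1r.
by move=> k3; exact: half_gap k1 k2 k3.
Qed.

(** The bound of [good_probability] with tilt [eps], where [lam = ln n], [m] is the
    number of points, [v^-1] the number of cells, [Dn] the number of offsets, [mu]
    the sum of their edge probabilities and [c1 * lam] about the mean number of
    points in a cell. *)
Lemma error_bound : exists C Lam : R, forall (lam n v : R) (m k h : nat),
  k = cluster_size lam -> h = k.*2.-1 -> Lam <= lam -> n = expR lam -> 0 < v -> b%:R * v <= 1 -> mu * v <= 1 ->
  (1 - eps) * c1 * lam <= v * n <= c1 * lam ->
  (1 - eps) * n <= m%:R <= (1 + eps) * n ->
  (Cb%:R * v^-1) * (eps^-1 ^+ (b * h) * (1 - (1 - eps) * (b%:R * v)) ^+ m) +
  v^-1 * Dn%:R * (m%:R * v) ^+ k.*2 * (1 - p0) ^+ (k * k) +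
  m%:R * (eps^-1 ^+ (Dn * h) * (1 - (1 - eps) * (mu * v)) ^+ m.-1) <=
  C * expR (- (tau * lam)).
Proof.
pose C' := ((1 - eps) * c1)^-1.
have C'0 : 0 < C' by rewrite invr_gt0 mulr_gt0.
pose Q := (p0 * cluster_rate / 8) ^+ 4.
have /andP[p00 p01] := p0_gt0.
have Q0 : 0 < Q by rewrite exprn_gt0// divr_gt0// mulr_gt0.
exists (Cb%:R * C' + C' * Dn%:R + 2).
exists (1 + eps^-1 + cluster_rate^-1 + 4 * c1 ^+ 2 / Q + (1 + tau) * 2 / (p0 * cluster_rate ^+ 2)).
move=> lam n v m k h kE hE hlam nE v0 bv Sv /andP[vn1 vn2] /andP[m1 m2].
rewrite {h}hE {k}kE; set k := cluster_size lam; set h := k.*2.-1.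
have a1 : 0 < eps^-1 by rewrite invr_gt0.
have a2 : 0 < cluster_rate^-1 by rewrite invr_gt0.
have a3 : 0 < 4 * c1 ^+ 2 / Q by rewrite divr_gt0// mulr_gt0// exprn_gt0.
have pz : 0 < p0 * cluster_rate ^+ 2 by exact: mulr_gt0 p00 (exprn_gt0 2 cluster_rate_gt0).
have a4 : 0 < (1 + tau) * 2 / (p0 * cluster_rate ^+ 2).
  by rewrite divr_gt0// mulr_gt0// addr_gt0.
have lam1 : 1 <= lam by plra.
have lam0 : 0 < lam by plra.
have zl : 1 <= cluster_rate * lam by rewrite -ler_pdivrMl// mulr1; plra.
have h1 : 4 * c1 ^+ 2 <= lam ^+ 2 * Q.
  rewrite -ler_pdivrMr//; apply: (@le_trans _ _ lam); first by plra.
  by rewrite expr2 ler_peMl// ltW.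
have h2 : 1 + tau <= p0 * cluster_rate ^+ 2 * lam / 2.
  rewrite ler_pdivlMr// mulrC -ler_pdivrMl// mulrC; plra.
have n_lam : lam <= n by rewrite nE; apply: le_trans (expR_ge1Dx _); plra.
have n0 : 0 < n by plra.
have vinv : v^-1 <= C' * n.
  rewrite invf_ple ?posrE ?mulr_gt0// invfM (_ : C'^-1 = (1 - eps) * c1); last by rewrite invrK.
  rewrite ler_pdivrMr//; apply: le_trans vn1; rewrite ler_peMr//.
  by rewrite mulr_ge0// ltW.
have m1' : (1 - 2 * eps) * n <= m%:R by apply: le_trans m1; rewrite ler_pM2r//; plra.
have en : 1 <= eps * n by rewrite -ler_pdivrMl// mulr1; plra.
have m1'' : (1 - 2 * eps) * n <= m.-1%:R.
  have : m%:R <= m.-1%:R + 1 :> R by rewrite natr1 ler_nat; case: (m).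
  by plra.
have q3 : 0 < expR (tau * lam) by exact: expR_gt0.
have q4 : 0 < expR (- ((1 + 2 * tau) * lam)) by exact: expR_gt0.
have comb : n * (expR (tau * lam) * expR (- ((1 + 2 * tau) * lam))) = expR (- (tau * lam)).
  by rewrite nE -!expRD; congr expR; ring.
have eb : (1 - (1 - eps) * (b%:R * v)) ^+ m <= expR (- ((1 + 2 * tau) * lam)).
  exact: (decay n0 lam0 v0 vn1 m1' Sb bv).
have eS : (1 - (1 - eps) * (mu * v)) ^+ m.-1 <= expR (- ((1 + 2 * tau) * lam)).
  by apply: (decay n0 lam0 v0 vn1 m1'' _ Sv); plra.
have pos1 (x : R) c : x <= 1 -> 0 <= (1 - (1 - eps) * x) ^+ c.
  move=> x1; rewrite exprn_ge0// subr_ge0.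
  have [x0|x0] := leP 0 x; first by rewrite mulr_ile1//; plra.
  by apply: le_trans ler01; rewrite mulr_ge0_le0 ?(ltW x0)// ltW.
have pos2 c : 0 <= eps^-1 ^+ c by rewrite exprn_ge0// ltW.
rewrite [leRHS]mulrDl [X in _ <= X + _]mulrDl.
apply: lerD; first apply: lerD.
- rewrite (_ : Cb%:R * C' * expR (- (tau * lam)) = Cb%:R * (C' * n) *
    (expR (tau * lam) * expR (- ((1 + 2 * tau) * lam)))); last by rewrite -comb; ring.
  apply: ler_pM.
  + by rewrite divr_ge0// ltW.
  + exact: mulr_ge0 (pos2 _) (pos1 _ _ bv).
  + by rewrite ler_wpM2l.
  + apply: ler_pM => //; [exact: pos1|exact: chernoff_factor].
- have mv : m%:R * v <= 2 * c1 * lam.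
    apply: (@le_trans _ _ (2 * n * v)).
      by rewrite ler_pM2r//; apply: le_trans m2 _; rewrite ler_pM2r//; plra.
    by move: vn2; rewrite -mulrA (mulrC n) -mulrA; plra.
  have := cross_decay lam1 zl h1 h2 (ltW v0) (ler0n _ m) mv nE.
  rewrite -/k; set w := (_ ^+ k.*2 * _) => hw.
  have w0 : 0 <= w by rewrite mulr_ge0// exprn_ge0// ?mulr_ge0// ?(ltW v0)//; plra.
  rewrite -mulrA -/w; apply: (@le_trans _ _ (C' * n * Dn%:R * w)).
    by rewrite ler_wpM2r// ler_wpM2r.
  have -> : C' * n * Dn%:R * w = C' * Dn%:R * (n * w) by ring.
  by rewrite ler_wpM2l// mulr_ge0// ltW.
- rewrite (_ : 2 * expR (- (tau * lam)) = 2 * n *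
    (expR (tau * lam) * expR (- ((1 + 2 * tau) * lam)))); last by rewrite -comb; ring.
  apply: ler_pM => //.
  + exact: mulr_ge0 (pos2 _) (pos1 _ _ Sv).
  + by apply: le_trans m2 _; rewrite ler_pM2r//; plra.
  + apply: ler_pM => //; [exact: pos1|exact: chernoff_factor].
Qed.

End error.

(** * Choice of the parameters *)
Section numbers.
Context (R : realType).

Lemma bernoulli_sub (x : R) n : 0 <= x <= 1 -> 1 - n%:R * x <= (1 - x) ^+ n.
Proof.
case/andP=> x0 x1; elim: n => [|n IH]; first by rewrite mul0r subr0 expr0.
rewrite exprS; apply: (@le_trans _ _ ((1 - x) * (1 - n%:R * x))).
  rewrite -natr1 mulrDl mul1r mulrBr mulr1 mulrBl mul1r.
  have : 0 <= x * (n%:R * x) by rewrite !mulr_ge0.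
  by move: (n%:R * x) => y; lra.
by rewrite ler_wpM2l// subr_ge0.
Qed.

(** Rounding [t^-1] up makes the side of the cells at most [t], as the estimate of
    distances requires, and loses little volume when [t] is small. *)
Lemma mesh_exists (t eps : R) (d L : nat) : 0 < t -> d%:R * t <= eps -> (L.*2.+1)%:R * t <= 1 ->
  exists K : nat, [/\ t^-1 <= K.+2%:R, (L.*2 < K.+2)%N &
    (1 - eps) * t ^+ d <= (K.+2%:R ^+ d)^-1 <= t ^+ d].
Proof.
move=> t0 dt Lt.
have t1 : t <= 1.
  by apply: le_trans Lt; rewrite ler_peMl ?(ltW t0)// ler1n.
have ti1 : 1 <= t^-1 by rewrite invf_ge1.
have /andP[h1 h2] := truncn_itv (le_trans ler01 ti1).
set q := Num.truncn t^-1 in h1 h2.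
have q0 : (0 < q)%N by rewrite /q truncn_gt0.
exists q.-1; have qE : q.-1.+2 = q.+1 by rewrite prednK.
rewrite qE; split; first exact: ltW.
  rewrite ltnS /q truncn_ge_nat ?(le_trans ler01)//.
  rewrite -[t^-1]mul1r ler_pdivlMr//; apply: le_trans Lt.
  by rewrite ler_wpM2r ?(ltW t0)// ler_nat.
have q1 : 0 < q.+1%:R :> R by [].
rewrite -exprVn; apply/andP; split; last first.
  by rewrite lerXn2r ?nnegrE ?invr_ge0 ?(ltW t0)// -[leRHS]invrK lef_pV2 ?posrE ?invr_gt0// ltW.
have qt : t * (1 - t) <= q.+1%:R^-1.
  rewrite -[leRHS]mul1r ler_pdivlMr//.
  apply: (@le_trans _ _ (t * (1 - t) * (t^-1 + 1))).
    rewrite ler_wpM2l ?mulr_ge0 ?subr_ge0 ?(ltW t0)//.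
    by rewrite -natr1 lerD2r.
  have -> : t * (1 - t) * (t^-1 + 1) = 1 - t ^+ 2 by field; rewrite gt_eqF.
  by rewrite gerBl sqr_ge0.
apply: (@le_trans _ _ ((t * (1 - t)) ^+ d)); last first.
  by rewrite lerXn2r ?nnegrE ?mulr_ge0 ?subr_ge0 ?(ltW t0)// ?invr_ge0.
rewrite exprMn mulrC ler_wpM2l ?exprn_ge0 ?(ltW t0)//.
apply: le_trans (bernoulli_sub d _); first by rewrite lerD2l lerN2.
by rewrite (ltW t0).
Qed.

Lemma ratio_expR_le (lam : R) : 0 < lam -> lam / expR lam <= 4 / lam.
Proof.
move=> l0; rewrite ler_pdivrMr ?expR_gt0// mulrAC ler_pdivlMr//.
have -> : expR lam = expR (lam / 2) ^+ 2 by rewrite -expRM_natl; congr expR; field.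
apply: (@le_trans _ _ (4 * (lam / 2) ^+ 2)).
  by rewrite le_eqVlt; apply/orP; left; apply/eqP; field.
rewrite ler_pM2l// lerXn2r ?nnegrE ?expR_ge0 ?divr_ge0 ?(ltW l0)//.
by apply: le_trans (expR_ge1Dx _); rewrite lerDr.
Qed.

Lemma expR_decay_le (C tau eta lam : R) : 0 <= C -> 0 < tau -> 0 < eta -> C / (tau * eta) <= lam ->
  C * expR (- (tau * lam)) <= eta.
Proof.
move=> C0 t0 e0 h.
rewrite expRN ler_pdivrMr ?expR_gt0//.
have h2 : C <= eta * (tau * lam).
  have -> : eta * (tau * lam) = lam * (tau * eta) by ring.
  by rewrite -ler_pdivrMr ?mulr_gt0.
apply: le_trans h2 _; rewrite ler_pM2l//.
by apply: le_trans (expR_ge1Dx _); rewrite lerDr.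
Qed.

Lemma rhat_expr (d : nat) (g : R -> R) (gamma : R) n : (0 < d)%N ->
  0 <= gamma * ln n%:R / (alpha d g * n%:R) ->
  rhat d g gamma n ^+ d = gamma * ln n%:R / (alpha d g * n%:R).
Proof.
move=> d0 h; rewrite /rhat -powR_mulrn ?powR_ge0// -powRrM mulVf ?powRr1//.
by rewrite pnatr_eq0 -lt0n.
Qed.

(** The room between [1] and [gamma] pays for all approximations: each factor
    [1 - eps] or [1 - 2 * eps] is one loss, in the Riemann sum, the mesh, the tilt
    or the number of points; one [tau] pays for the tilt, and one is left as the
    rate of decay. *)
Lemma slack_exists (gamma : R) : 1 < gamma -> exists eps tau : R,
  [/\ 0 < eps < 2^-1, 0 < tau & 1 + 2 * tau <= (1 - eps) ^+ 3 * (1 - 2 * eps) * gamma].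
Proof.
move=> g1; have g0 : 0 < gamma by lra.
pose eps := (gamma - 1) / (10 * gamma).
have e0 : 0 < eps by rewrite divr_gt0 ?mulr_gt0//; lra.
have eg : eps * gamma = (gamma - 1) / 10 by rewrite /eps; field; rewrite gt_eqF.
have e1 : eps < 10^-1.
  by rewrite -(ltr_pM2r g0) eg mulrC ltr_pM2l ?invr_gt0//; lra.
exists eps, ((gamma - 1) / 4); split; [by rewrite e0/=; lra|by lra|].
have b3 : 1 - 3 * eps <= (1 - eps) ^+ 3 by apply: bernoulli_sub; lra.
apply: (@le_trans _ _ ((1 - 3 * eps) * (1 - 2 * eps) * gamma)); last first.
  by rewrite ler_pM2r// ler_wpM2r//; lra.
apply: (@le_trans _ _ ((1 - 5 * eps) * gamma)); last first.
  rewrite ler_pM2r//; have : 0 <= eps * eps by rewrite mulr_ge0// ltW.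
  by lra.
have -> : (1 - 5 * eps) * gamma = gamma - 5 * (eps * gamma) by ring.
by rewrite eg; lra.
Qed.

End numbers.

(** * Riemann sums of the connection function *)
Section measurability.
Context (R : realType) (d : nat).

Lemma measurable_enorm : measurable_fun [set: d.-tuple R] (@enorm R d).
Proof.
apply: (measurableT_comp (f := @Num.sqrt R)).
  by apply: continuous_measurable_fun; exact: sqrt_continuous.
apply: measurable_sum => i; apply: measurable_funX; exact: measurable_tnth.
Qed.

Lemma enorm_ge0 (x : d.-tuple R) : 0 <= enorm x.
Proof. exact: sqrtr_ge0. Qed.

Lemma measurable_half_box (a b : d.-tuple R) :
  measurable [set x : d.-tuple R | forall i, tnth a i < tnth x i <= tnth b i].
Proof.
rewrite (_ : [set _ | _] = \bigcap_(i in [set: 'I_d])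
   ((fun x : d.-tuple R => tnth x i) @^-1` `]tnth a i, tnth b i])); last first.
  apply/seteqP; split => x /= h i; first by move=> _; rewrite /= in_itv/=; exact: h.
  by have := h i I; rewrite /= in_itv.
apply: fin_bigcap_measurable => // i _.
by rewrite -[X in measurable X]setTI; exact: measurable_tnth.
Qed.

Definition hyperplanes : set (d.-tuple R) := [set x | exists i, tnth x i = 0].

(** Bounded pieces of a coordinate hyperplane lie in arbitrarily thin boxes. *)
Lemma hyperplanes_null :
  measurable hyperplanes /\ lebesgueRd R d hyperplanes = 0%E.
Proof.
pose H (i : 'I_d) : set (d.-tuple R) := [set x | tnth x i = 0].
have mH i : measurable (H i).
  rewrite -[H i]setTI (_ : H i = (fun x => tnth x i) @^-1` [set 0])//.
  exact: measurable_tnth.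
have HE : hyperplanes = \bigcup_(i in [set: 'I_d]) H i.
  by apply/seteqP; split => [x [i xi]|x [i _ xi]]; exists i.
have mHyp : measurable hyperplanes.
  by rewrite HE; apply: fin_bigcup_measurable.
split => //; apply/eqP; rewrite -measure_le0.
pose Q (n : nat) : set (d.-tuple R) :=
  [set x | forall i, - n%:R < tnth x i <= n%:R].
have mHQ i n : measurable (H i `&` Q n).
  apply: measurableI => //.
  rewrite (_ : Q n = [set x : d.-tuple R | forall i, tnth [tuple - n%:R | _ < d] i <
      tnth x i <= tnth [tuple n%:R | _ < d] i]); first exact: measurable_half_box.
  by apply/seteqP; split=> x h j; have := h j; rewrite !tnth_mktuple.
have HQ i n : lebesgueRd R d (H i `&` Q n) = 0%E.
  apply/eqP; rewrite -measure_le0; apply/lee_addgt0Pr => e e0; rewrite add0e.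
  pose C : R := \prod_(j < d | j != i) (n%:R + n%:R).
  have C0 : 0 <= C by apply: prodr_ge0 => j _; exact: addr_ge0.
  pose t := e / (C + 1).
  have t0 : 0 < t by rewrite divr_gt0// ltr_wpDl.
  pose a := [tuple (if j == i then - t else - n%:R) | j < d].
  pose b : d.-tuple R := [tuple (if j == i then 0 else n%:R) | j < d].
  have ab j : tnth a j <= tnth b j.
    rewrite !tnth_mktuple; case: ifP => _; first by rewrite oppr_le0 ltW.
    by rewrite (@le_trans _ _ 0)// oppr_le0.
  apply: (@le_trans _ _ (lebesgueRd R d [set x | forall i, tnth a i < tnth x i <= tnth b i])).
    apply: le_measure; rewrite ?inE//; first exact: measurable_half_box.
    move=> x [xi xQ] j; rewrite !tnth_mktuple; case: eqP => [->|_]; last exact: xQ.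
    by rewrite xi lexx oppr_lt0 t0.
  rewrite lebesgueRd_box// lee_fin (bigD1 i)//= !tnth_mktuple eqxx sub0r opprK.
  rewrite (eq_bigr (fun=> n%:R + n%:R)); last first.
    by move=> j /negPf ji; rewrite !tnth_mktuple ji opprK.
  rewrite -/C /t mulrAC ler_pdivrMr ?ltr_wpDl//.
  by rewrite ler_wpM2l ?(ltW e0)// lerDl.
rewrite measure_le0; apply/eqP/(negligibleP _ mHyp).
apply: (@negligibleS _ _ _ _ (\bigcup_k (\bigcup_n
    [set x | exists i : 'I_d, [/\ i = k :> nat, H i x & Q n x]]))).
  move=> x [i xi]; exists (i : nat) => //.
  pose M : R := \sum_j `|tnth x j|.
  exists (Num.truncn M).+1 => //; exists i; split => // j.
  have xM : `|tnth x j| < (Num.truncn M).+1%:R.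
    apply: le_lt_trans (truncnS_gt M).
    by rewrite /M (bigD1 j)//= lerDl sumr_ge0.
  by move: xM; rewrite ltr_norml => /andP[-> /ltW ->].
apply: negligible_bigcup => k; apply: negligible_bigcup => n.
have [kd|kd] := ltnP k d; last first.
  rewrite (_ : [set _ | _] = set0); first exact: negligible_set0.
  by apply/seteqP; split=> x //= [i [ik _ _]]; move: (ltn_ord i); rewrite ik ltnNge kd.
exists (H (Ordinal kd) `&` Q n); split.
- exact: mHQ.
- exact: HQ.
- move=> x [i [ik Hx Qx]]; split => //.
  by rewrite (_ : Ordinal kd = i)//; exact/val_inj.
Qed.

End measurability.

Section riemann.
Context (R : realType) (d : nat) (g : R -> R).
Notation Z := {ffun 'I_d -> int}.
Hypothesis g01 : forall r : R, 0 <= r -> 0 <= g r <= 1.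
Hypothesis g_ninc : forall r s : R, 0 <= r -> r <= s -> g s <= g r.

(** An upper bound for the distance between two points of the unit cells of the
    lattice at offset [o]. *)
Definition cell_dist (o : Z) : R := Num.sqrt (\sum_i (`|o i|%N.+1%:R) ^+ 2).

Lemma cell_dist_ge0 o : 0 <= cell_dist o.
Proof. exact: sqrtr_ge0. Qed.

Lemma measurable_g_ge0 d' (T : measurableType d') (f : T -> R) :
  measurable_fun setT f -> (forall x, 0 <= f x) -> measurable_fun setT (fun x => g (f x)).
Proof.
move=> mf f0; rewrite (_ : (fun x => _) = (fun r => g (Num.max 0 r)) \o f); last first.
  by apply/funext => x /=; rewrite max_r.
apply: measurableT_comp => //; apply: nonincreasing_measurable => // r s rs.
by apply: g_ninc; rewrite ?ge_max !le_max lexx ?rs ?orbT.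
Qed.

Lemma measurable_g_enorm : measurable_fun setT (fun x : d.-tuple R => (g (enorm x))%:E).
Proof.
apply/measurable_EFinP; apply: measurable_g_ge0; first exact: measurable_enorm.
by move=> x; exact: enorm_ge0.
Qed.

(** These sets exhaust the complement of the coordinate hyperplanes. With cells of
    side [j.+1%:R^-1], each point of [shell j] is in some [shifted_cell]. *)
Definition shell (j : nat) : set (d.-tuple R) :=
  [set x | forall i, 2 * j.+1%:R^-1 < `|tnth x i| <= j%:R].

(** The cell at [o], moved away from the origin in every coordinate, so far that
    [dl * cell_dist o] is a lower bound for the norm of its points. *)
Definition shifted_cell (dl : R) (o : Z) : set (d.-tuple R) :=
  [set x | forall i,
    dl * (if 0 < o i then o i + 1 else o i - 2)%:~R < tnth x i <=
    dl * ((if 0 < o i then o i + 1 else o i - 2) + 1)%:~R].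

Lemma shell_covered j x : shell j x -> let dl := j.+1%:R^-1 in
  exists2 o : Z, o \in box_seq (j * j.+1) 0 & shifted_cell dl o x /\
    dl * cell_dist o <= enorm x.
Proof.
move=> xj dl; have dl0 : 0 < dl by rewrite invr_gt0.
pose y i := tnth x i / dl.
have xy i : tnth x i = dl * y i by rewrite /y mulrC divfK ?gt_eqF.
pose o : Z := [ffun i => if 0 < tnth x i then Num.ceil (y i) - 2 else Num.ceil (y i) + 1].
have yi i : 2 < `|y i| <= (j * j.+1)%:R.
  have /andP[h1 h2] := xj i; rewrite /y normrM normfV (gtr0_norm dl0).
  by rewrite ltr_pdivlMr// h1 ler_pdivrMr// natrM -mulrA divff// mulr1.
have H i : [/\ (`|o i|%N.+1)%:R <= `|y i|,
   (if 0 < o i then o i + 1 else o i - 2)%:~R < y i &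
   y i <= ((if 0 < o i then o i + 1 else o i - 2) + 1)%:~R].
  have /andP[c1 c2] := ceil_itv (y i).
  have /andP[y2 _] := yi i.
  rewrite /o ffunE; case: ifP => xi.
    have y0 : 0 < y i by rewrite divr_gt0.
    rewrite gtr0_norm// in y2 *.
    have c3 : 2 < Num.ceil (y i) by rewrite ceil_gt_int.
    move: c1 c2; move: (Num.ceil (y i)) c3 => c c3 c1 c2.
    have -> : (0 < c - 2) by lia.
    rewrite (_ : c - 2 + 1 = c - 1); last by ring.
    rewrite subrK; split => //; apply: le_trans (ltW c1).
    by rewrite -[X in X <= _]/((`|c - 2|%N.+1)%:~R) ler_int; lia.
  have y0 : y i < 0.
    have : y i <= 0 by rewrite /y pmulr_lle0 ?invr_gt0// leNgt xi.
    rewrite le_eqVlt => /orP[/eqP y0|//].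
    by rewrite y0 normr0 in y2; lra.
  rewrite ltr0_norm// in y2 *.
  have c3 : Num.ceil (y i) <= -2 by rewrite ceil_le_int; lra.
  move: c1 c2; move: (Num.ceil (y i)) c3 => c c3 c1 c2.
  have -> : (0 < c + 1) = false by lia.
  rewrite (_ : c + 1 - 2 = c - 1); last by ring.
  rewrite subrK; split => //.
  rewrite lerNr; apply: le_trans c2 _.
  by rewrite -[X in _ <= - X]/((`|(c + 1)%R|%N.+1)%:~R) -intrN ler_int; lia.
exists o.
  rewrite mem_box_seq; apply/in_boxP => i.
  have [h _ _] := H i; have /andP[_ h2] := yi i.
  have := le_trans h h2; rewrite ler_nat; apply: leq_trans.
  by rewrite (_ : (0 : Z) i = 0) ?ffunE// subr0.
split.
  by move=> i; have [_ h1 h2] := H i; rewrite xy ltr_pM2l// ler_pM2l// h1.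
rewrite /cell_dist /enorm -[X in X * _](gtr0_norm dl0) -sqrtr_sqr -sqrtrM ?sqr_ge0//.
apply: ler_wsqrtr; rewrite mulr_sumr; apply: ler_sum => i _.
have [h _ _] := H i.
rewrite -exprMn -[leRHS]real_normK ?num_real// lerXn2r ?nnegrE ?mulr_ge0 ?(ltW dl0)//.
by rewrite xy normrM (gtr0_norm dl0) ler_pM2l.
Qed.

Lemma measurable_shell j : measurable (shell j).
Proof.
rewrite (_ : shell j = \bigcap_(i in [set: 'I_d])
   ((fun x : d.-tuple R => `|tnth x i|) @^-1` `]2 * j.+1%:R^-1, j%:R])); last first.
  apply/seteqP; split => x /= h i; first by move=> _; rewrite /= in_itv/=; exact: h.
  by have := h i I; rewrite /= in_itv.
apply: fin_bigcap_measurable => // i _; rewrite -[X in measurable X]setTI.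
by apply: (measurableT_comp (f := @Num.norm R R)) => //; exact: measurable_tnth.
Qed.

Lemma shifted_cell_box dl o : 0 < dl -> measurable (shifted_cell dl o) /\
  lebesgueRd R d (shifted_cell dl o) = (dl ^+ d)%:E.
Proof.
move=> dl0; pose a := [tuple dl * (if 0 < o i then o i + 1 else o i - 2)%:~R | i < d].
pose b := [tuple dl * ((if 0 < o i then o i + 1 else o i - 2) + 1)%:~R | i < d].
have -> : shifted_cell dl o = [set x | forall i, tnth a i < tnth x i <= tnth b i].
  by apply/seteqP; split => x h i; have := h i; rewrite !tnth_mktuple.
have ab i : tnth b i - tnth a i = dl.
  by rewrite !tnth_mktuple intrD mulrDr mulr1 addrAC subrr add0r.
split; first exact: measurable_half_box.
rewrite lebesgueRd_box; last by move=> i; rewrite -subr_ge0 ab ltW.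
by under eq_bigr do rewrite ab; rewrite prodr_const card_ord.
Qed.

Lemma shell_integral_le j :
  (\int[lebesgueRd R d]_(x in shell j) (g (enorm x))%:E <=
   (j.+1%:R^-1 ^+ d * \sum_(o <- box_seq (j * j.+1) 0) g (j.+1%:R^-1 * cell_dist o))%:E)%E.
Proof.
set dl := j.+1%:R^-1; have dl0 : 0 < dl by rewrite invr_gt0.
have gd0 o : 0 <= g (dl * cell_dist o).
  by have /andP[] := g01 (mulr_ge0 (ltW dl0) (cell_dist_ge0 o)).
have mcell o := (shifted_cell_box o dl0).1.
have mind o : measurable_fun (shell j) (fun x => (\1_(shifted_cell dl o) x)%:E : \bar R).
  apply/measurable_EFinP; apply: measurable_funTS; exact: measurable_indic.
have mterm o : measurable_fun (shell j)
    (fun x => (g (dl * cell_dist o))%:E * (\1_(shifted_cell dl o) x)%:E)%E.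
  exact: measurable_funeM.
apply: (@le_trans _ _ (\int[lebesgueRd R d]_(x in shell j)
   (\sum_(o <- box_seq (j * j.+1) 0%R)
      (g (dl * cell_dist o))%:E * (\1_(shifted_cell dl o) x)%:E))%E).
  apply: ge0_le_integral => //.
  - exact: measurable_shell.
  - by move=> x _; rewrite lee_fin; have /andP[] := g01 (enorm_ge0 x).
  - by apply: measurable_funTS; exact: measurable_g_enorm.
  - exact: emeasurable_sum.
  move=> x xj; have [u uB [xu ux]] := shell_covered xj.
  rewrite (bigD1_seq u) ?box_seq_uniq//=.
  rewrite indicE mem_set//= mule1.
  apply: (@le_trans _ _ (g (dl * cell_dist u))%:E).
    by rewrite lee_fin g_ninc// mulr_ge0 ?cell_dist_ge0// ltW.
  by rewrite leeDl// sume_ge0// => v _; rewrite mule_ge0// lee_fin.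
rewrite ge0_integral_sum//=; last 2 first.
- exact: measurable_shell.
- by move=> o x _; rewrite mule_ge0// lee_fin.
rewrite mulr_sumr -sumEFin; apply: lee_sum => o _.
rewrite ge0_integralZl_EFin//; last exact: measurable_shell.
rewrite integral_indic//; last exact: measurable_shell.
rewrite (mulrC (dl ^+ d)) EFinM lee_wpmul2l ?lee_fin// -(shifted_cell_box o dl0).2.
apply: le_measure; rewrite ?inE//.
by apply: measurableI => //; exact: measurable_shell.
Qed.

Lemma shell_integral_cvg :
  (fun j => \int[lebesgueRd R d]_(x in shell j) (g (enorm x))%:E)%E @ \oo -->
  conn_integral d g.
Proof.
have [mH H0] := hyperplanes_null R d.
have -> : conn_integral d g =
    (\int[lebesgueRd R d]_(x in \bigcup_j shell j) (g (enorm x))%:E)%E.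
  rewrite /conn_integral (ge0_negligible_integral mH)//.
  - congr (integral _ _ _); apply/seteqP; split => [x [_ xH]|x [j _ xj]]; last first.
      split=> // -[i xi]; have := xj i; rewrite xi normr0 => /andP[+ _].
      by rewrite ltNge mulr_ge0.
    pose M : R := \sum_i (`|tnth x i| + 2 * `|tnth x i|^-1).
    exists (Num.truncn M).+1 => // i.
    have xi0 : 0 < `|tnth x i|.
      by rewrite normr_gt0; apply/eqP => xi; apply: xH; exists i.
    have le1 : `|tnth x i| + 2 * `|tnth x i|^-1 <= M.
      rewrite /M (bigD1 i)//= lerDl; apply: sumr_ge0 => k _.
      by apply: addr_ge0 => //; apply: mulr_ge0 => //; rewrite invr_ge0.
    have := truncnS_gt M; set N := (Num.truncn M).+1 => MN.
    have h1 : 0 < 2 * `|tnth x i|^-1 by rewrite mulr_gt0// invr_gt0.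
    have NM : N%:R <= N.+1%:R :> R by rewrite ler_nat.
    have N1 : 0 < N.+1%:R :> R by [].
    apply/andP; split; last by lra.
    rewrite ltr_pdivrMr// mulrC -ltr_pdivrMr//; lra.
  - exact: measurable_g_enorm.
  - by move=> x _; rewrite lee_fin; have /andP[] := g01 (enorm_ge0 x).
apply: ge0_nondecreasing_set_cvg_integral.
- move=> j j' jj'; rewrite subsetEset => x xj i; have /andP[h1 h2] := xj i.
  apply/andP; split; last by apply: le_trans h2 _; rewrite ler_nat.
  apply: le_lt_trans h1; rewrite ler_pM2l// lef_pV2 ?posrE//.
  by rewrite ler_nat.
- exact: measurable_shell.
- by move=> j; apply: measurable_funTS; exact: measurable_g_enorm.
- by move=> j x _; rewrite lee_fin; have /andP[] := g01 (enorm_ge0 x).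
Qed.

Hypothesis d_gt0 : (0 < d)%N.
Hypothesis alpha_pos_fin : (0 < conn_integral d g < +oo)%E.

Lemma alpha_gt0 : 0 < alpha d g.
Proof. by rewrite fine_gt0. Qed.

(** Although [cell_dist] overestimates the distance, the sums exceed the integral
    over a shell, by comparison on shifted cells of the same volume. The summand
    [-1] leaves out one offset, at the price of [dl ^+ d], which is small. *)
Lemma riemann_sum (eps eta : R) : 0 < eps -> 0 < eta ->
  exists dl rho, [/\ 0 < dl, dl <= eta, (0 < rho)%N &
    (1 - eps) * alpha d g <=
    dl ^+ d * (\sum_(o <- box_seq rho 0) g (dl * cell_dist o) - 1)].
Proof.
move=> e0 h0; have a0 := alpha_gt0.
have : (fun j => fine (\int[lebesgueRd R d]_(x in shell j) (g (enorm x))%:E)%E) @ \oo -->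
    alpha d g.
  apply: fine_cvg; rewrite fineK; first exact: shell_integral_cvg.
  by rewrite ge0_fin_numE ?(andP alpha_pos_fin).2// ltW// (andP alpha_pos_fin).1.
move=> /cvgr_gt/(_ ((1 - eps / 2) * alpha d g)).
have -> : (1 - eps / 2) * alpha d g < alpha d g by rewrite gtr_pMl//; lra.
case=> // j0 _ hj.
pose eta' := Num.min eta (Num.min 1 (eps / 2 * alpha d g)).
have eta'0 : 0 < eta' by rewrite !lt_min h0 ltr01 mulr_gt0// divr_gt0.
pose j := (maxn j0 (Num.truncn eta'^-1)).+1.
pose dl : R := j.+1%:R^-1.
have dl0 : 0 < dl by rewrite invr_gt0.
have dle : dl <= eta'.
  rewrite /dl invf_ple ?posrE//; apply: le_trans (ltW (truncnS_gt _)) _.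
  by rewrite ler_nat ltnW// ltnS ltnS leq_maxr.
have dl1 : dl <= 1 by apply: le_trans dle _; rewrite !ge_min lexx orbT.
exists dl, (j * j.+1)%N; split => //.
  by apply: le_trans dle _; rewrite ge_min lexx.
have hj' := hj j; rewrite /= in hj'.
have dld : dl ^+ d <= eps / 2 * alpha d g.
  apply: (@le_trans _ _ dl); last by apply: le_trans dle _; rewrite !ge_min lexx !orbT.
  by rewrite -[leRHS]expr1 ler_wiXn2l// ltW.
rewrite mulrBr mulr1 lerBrDr.
have I1 : (1 - eps / 2) * alpha d g <= dl ^+ d * \sum_(o <- box_seq (j * j.+1) 0) g (dl * cell_dist o).
  apply: le_trans (ltW (hj' _)) _; first by rewrite /= /j leqW// leq_maxl.
  rewrite -lee_fin; apply: le_trans (shell_integral_le j).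
  rewrite fineK// ge0_fin_numE.
    by apply: le_lt_trans (shell_integral_le j) _; rewrite ltry.
  by apply: integral_ge0 => x _; rewrite lee_fin; have /andP[] := g01 (enorm_ge0 x).
by lra.
Qed.
End riemann.

(** * Distances and cells in the torus *)
Section torus_distance.
Context (R : realType) (d : nat).
Implicit Types x y : d.-tuple R.

Definition shift_norm x y (z : d.-tuple int) : R :=
  enorm [tuple tnth x i - tnth y i - (tnth z i)%:~R | i < d].

Let norms x y : set R := range (shift_norm x y).

Let norms_nonempty x y : norms x y !=set0.
Proof. by exists (shift_norm x y [tuple 0 | i < d]); exists [tuple 0 | i < d]. Qed.

Let norms_lb x y : lbound (norms x y) 0.
Proof. by move=> _ [z _ <-]; exact: enorm_ge0. Qed.

Lemma torus_dist_ge0 x y : 0 <= torus_dist x y.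
Proof. exact: lb_le_inf (norms_nonempty x y) (@norms_lb x y). Qed.

Lemma torus_dist_le x y z : torus_dist x y <= shift_norm x y z.
Proof. by apply: ge_inf; [exists 0; exact: norms_lb|exists z]. Qed.

Lemma torus_dist_lt x y (a : R) : torus_dist x y < a -> exists z, shift_norm x y z < a.
Proof. by move=> /(inf_lt (norms_nonempty x y))[_ [z _ <-] za]; exists z. Qed.

(** The infimum is over the countable set of integer vectors. *)
Lemma measurable_torus_dist d' (S : measurableType d') (X Y : S -> d.-tuple R) :
  measurable_fun setT X -> measurable_fun setT Y ->
  measurable_fun setT (fun w => torus_dist (X w) (Y w)).
Proof.
move=> mX mY; apply: (measurability (@RGenInftyO.G R)) => [|/= _ [_] [a] -> <-].
  exact: RGenInftyO.measurableE.
rewrite setTI (_ : _ @^-1` _ = \bigcup_(z : d.-tuple int)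
    ((fun w => shift_norm (X w) (Y w) z) @^-1` `]-oo, a[)); last first.
  apply/seteqP; split => w /=; rewrite in_itv/=.
    by move=> /torus_dist_lt[z za]; exists z => //=; rewrite in_itv.
  by move=> [z _] /=; rewrite in_itv/=; apply: le_lt_trans; exact: torus_dist_le.
apply: countable_bigcupT_measurable => [|z]; first exact: countableP.
rewrite -[X in measurable X]setTI.
have mf : measurable_fun setT (fun w => shift_norm (X w) (Y w) z).
  apply: measurableT_comp; first exact: measurable_enorm.
  apply/measurable_fun_tnthP => i /=.
  rewrite (_ : _ \o _ = (fun w => tnth (X w) i - tnth (Y w) i - (tnth z i)%:~R)); last first.
    by apply/funext => w /=; rewrite tnth_mktuple.
  apply: measurable_funB => //; apply: measurable_funB.
    exact: (measurableT_comp (measurable_tnth i) mX).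
  exact: (measurableT_comp (measurable_tnth i) mY).
by apply: mf => //; exact: measurable_itv.
Qed.

End torus_distance.

(** One coordinate of the estimate in [torus_dist_cells]. *)
Lemma interval_gap (R : realFieldType) (x y h a b c q t : R) :
  h + a < x -> x <= h + (a + t) -> h + (a + b + q) < y -> y <= h + (a + b + q + t) ->
  - c <= b -> b <= c -> - (c + t) <= x - y + q <= c + t.
Proof. by move=> *; apply/andP; lra. Qed.

Section torus_cells.
Context (R : realType) (d K : nat).
Notation T := {ffun 'I_d -> 'I_K.+2}.
Notation Z := {ffun 'I_d -> int}.
Implicit Types (c : T) (o : Z).

Definition torus_cell c : set (d.-tuple R) :=
  [set x | forall i, - 2^-1 + (c i : nat)%:R / K.+2%:R < tnth x i <=
    - 2^-1 + (c i : nat).+1%:R / K.+2%:R].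

Let K0 : 0 < K.+2%:R :> R. Proof. by []. Qed.

Lemma torus_cell_volume c :
  measurable (torus_cell c) /\
  lebesgueRd R d (torus_cell c `&` torus_cube R d) = (#|{: T}|%:R^-1)%:E.
Proof.
pose a : d.-tuple R := [tuple - 2^-1 + (c i : nat)%:R / K.+2%:R | i < d].
pose b : d.-tuple R := [tuple - 2^-1 + (c i : nat).+1%:R / K.+2%:R | i < d].
have cE : torus_cell c = [set x | forall i, tnth a i < tnth x i <= tnth b i].
  by apply/seteqP; split => x h i; have := h i; rewrite !tnth_mktuple.
have ab i : tnth b i - tnth a i = K.+2%:R^-1.
  rewrite !tnth_mktuple (_ : (c i : nat).+1%:R = (c i : nat)%:R + 1 :> R) ?natr1//; ring.
have -> : torus_cell c `&` torus_cube R d = torus_cell c.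
  apply/setIidPl => x xc i; have /andP[x1 x2] := xc i; apply/andP; split.
    by apply: le_lt_trans x1; rewrite lerDl.
  apply: le_trans x2 _; have h : (2^-1 : R) = - 2^-1 + 1 by field.
  by rewrite [leRHS]h lerD2l ler_pdivrMr// mul1r ler_nat ltn_ord.
split; first by rewrite cE; exact: measurable_half_box.
rewrite cE lebesgueRd_box; last by move=> i; rewrite -subr_ge0 ab.
under eq_bigr do rewrite ab.
by rewrite prodr_const card_ord card_ffun !card_ord natrX exprVn.
Qed.

Lemma torus_cell_disjoint c c' : c != c' -> torus_cell c `&` torus_cell c' = set0.
Proof.
have aux (u u' : 'I_K.+2) (y : R) : (u < u')%N -> y <= - 2^-1 + (u : nat).+1%:R / K.+2%:R ->
    - 2^-1 + (u' : nat)%:R / K.+2%:R < y -> False.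
  move=> uu' h1 h2; have := lt_le_trans h2 h1.
  by rewrite ltrD2l ltr_pM2r ?invr_gt0// ltr_nat ltnS leqNgt uu'.
move=> cc'; rewrite -subset0 => x [xc xc'].
have /existsP[i ci] : [exists i, c i != c' i].
  by apply: contraNT cc' => /existsPn h; apply/eqP/ffunP => i; exact/eqP/negPn.
have /andP[h1 h2] := xc i; have /andP[h3 h4] := xc' i.
case: (ltngtP (c i) (c' i)) => [lt|lt|/val_inj e]; last by rewrite e eqxx in ci.
  exact: aux lt h2 h3.
exact: aux lt h4 h1.
Qed.

Lemma torus_dist_cells c o x y : torus_cell c x -> torus_cell (c + torus_proj K o) y ->
  torus_dist x y <= cell_dist R o / K.+2%:R.
Proof.
move=> xc yc.
(* The integers [q i] by which the coordinates wrap around give the translation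
   that is used in the infimum defining the distance. *)
have qP i : exists q : int, ((c + torus_proj K o)%R i : nat)%:Z = (c i : nat)%:Z + o i + q * K.+2%:Z.
  pose s : int := (c i : nat)%:Z + o i.
  have e1 : (c + torus_proj K o) i = s%:~R.
    by rewrite !ffunE /s intrD -[in LHS](natr_Zp (c i)).
  exists (- (s %/ K.+2%:Z)%Z).
  have -> : (c i : nat)%:Z + o i = s by [].
  have sE := divz_eq s K.+2%:Z.
  have sm : (0 <= (s %% K.+2%:Z)%Z < K.+2%:Z) by rewrite modz_ge0//= ltz_pmod.
  move: sm sE; case: (s %% K.+2%:Z)%Z => [t|//] /= tK sE.
  have -> : (c + torus_proj K o) i = inZp t.
    rewrite e1 sE intrD intrM.
    have -> : (K.+2%:Z)%:~R = 0 :> 'I_K.+2 by rewrite -[LHS]/(K.+2%:R) Zp_nat; apply/val_inj; rewrite /= modnn.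
    by rewrite mulr0 add0r -[LHS]/(t%:R) Zp_nat.
  rewrite /= modn_small//.
  by move: sE; move: (s %/ _)%Z => u ->; rewrite mulNr addrAC addrN add0r.
have /fin_all_exists[q qE] := qP.
apply: le_trans (torus_dist_le _ _ [tuple - q i | i < d]) _.
rewrite /shift_norm /enorm /cell_dist ler_pdivlMr// -[X in _ * X](gtr0_norm K0).
rewrite -sqrtr_sqr -sqrtrM; last by apply: sumr_ge0 => i _; exact: sqr_ge0.
apply: ler_wsqrtr; rewrite mulr_suml; apply: ler_sum => i _.
rewrite !tnth_mktuple -exprMn -[leLHS]real_normK ?num_real// lerXn2r ?nnegrE//.
rewrite normrM (gtr0_norm K0) -ler_pdivlMr//.
have /andP[x1 x2] := xc i; have /andP[y1 y2] := yc i.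
have E : ((c + torus_proj K o)%R i : nat)%:R = (c i : nat)%:R + (o i)%:~R + (q i)%:~R * K.+2%:R :> R.
  by have := congr1 (fun t : int => t%:~R : R) (qE i); rewrite !intrD intrM.
have Kn0 : K.+2%:R != 0 :> R by [].
have E' : ((c + torus_proj K o)%R i : nat)%:R / K.+2%:R =
    (c i : nat)%:R / K.+2%:R + (o i)%:~R / K.+2%:R + (q i)%:~R :> R.
  by rewrite E 2!mulrDl mulfK.
have oabs : `|(o i)%:~R / K.+2%:R : R| = `|o i|%N%:R / K.+2%:R.
  by rewrite normrM normfV (gtr0_norm K0) -intr_norm -abszE.
have nat1 (t : nat) : t.+1%:R / K.+2%:R = t%:R / K.+2%:R + K.+2%:R^-1 :> R.
  by rewrite -[t.+1]addn1 natrD mulrDl mul1r.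
have := lexx (`|(o i)%:~R / K.+2%:R : R|); rewrite {1}ler_norml oabs => /andP[w1 w2].
rewrite nat1 intrN opprK.
move: x1 x2 y1 y2; rewrite !nat1 E' => x1 x2 y1 y2.
rewrite ler_norml; exact: interval_gap x1 x2 y1 y2 w1 w2.
Qed.

End torus_cells.

(** * The connection function on cells *)

(** This makes the set of cells a group to which the finite model applies. *)
HB.instance Definition _ (I : finType) (M : finZmodType) := Finite.on {ffun I -> M}.

Section torus_proj_inj.
Variables (d K : nat).
Notation Z := {ffun 'I_d -> int}.

Lemma intr_Zp_eq0 (a : int) : (`|a| < K.+2)%N -> a%:~R = 0 :> 'I_K.+2 -> a = 0.
Proof.
have nat0 (t : nat) : (t < K.+2)%N -> t%:R = 0 :> 'I_K.+2 -> t = 0%N.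
  by move=> tK; rewrite Zp_nat => /(congr1 val)/=; rewrite modn_small.
case: a => t /= tK; first by move=> /(nat0 _ tK) ->.
by rewrite NegzE intrN => /eqP; rewrite oppr_eq0 => /eqP/(nat0 _ tK).
Qed.

Lemma torus_proj_inj (L : nat) (o o' : Z) : (L.*2 < K.+2)%N ->
  in_box L 0 o -> in_box L 0 o' -> torus_proj K o = torus_proj K o' -> o = o'.
Proof.
move=> LK /in_boxP ob /in_boxP o'b /ffunP oo'; apply/ffunP => i.
apply/eqP; rewrite -subr_eq0; apply/eqP/intr_Zp_eq0.
  have Z0 : (0 : Z) i = 0 by rewrite ffunE.
  move: (ob i) (o'b i) LK; rewrite Z0; move: (o i) (o' i) => a b; clear.
  by rewrite !subr0 -addnn; lia.
by move: (oo' i); rewrite !ffunE intrB => ->; rewrite subrr.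
Qed.

End torus_proj_inj.

Section cell_model.
Context (R : realType) (d : nat) (g : R -> R).
Notation Z := {ffun 'I_d -> int}.
Hypothesis g01 : forall r : R, 0 <= r -> 0 <= g r <= 1.
Hypothesis g_ninc : forall r s : R, 0 <= r -> r <= s -> g s <= g r.
Variables (dl : R) (rho : nat).
Hypothesis dl_gt0 : 0 < dl.
Hypothesis rho_gt0 : (0 < rho)%N.

(** A lower bound for the connection probability of points in cells at offset
    [o], if the side of the cells is at most [dl] times the radius. *)
Definition offset_prob (o : Z) : R := g (dl * cell_dist R o).

Definition offsets : seq Z := [seq o <- box_seq rho 0 | 0 < offset_prob o].

Lemma offset_prob01 o : 0 <= offset_prob o <= 1.
Proof. by apply: g01; rewrite mulr_ge0 ?cell_dist_ge0// ltW. Qed.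

Lemma offset_prob_anti (o o' : Z) : (forall i, (`|o' i| <= `|o i|)%N) ->
  offset_prob o <= offset_prob o'.
Proof.
move=> oo'; apply: g_ninc; first by rewrite mulr_ge0 ?cell_dist_ge0// ltW.
rewrite ler_pM2l//; apply: ler_wsqrtr; apply: ler_sum => i _.
by rewrite lerXn2r ?nnegrE// ler_nat ltnS oo'.
Qed.

Lemma offsets_uniq : uniq offsets.
Proof. by rewrite filter_uniq// box_seq_uniq. Qed.

Lemma offsets_bound (o : Z) i : o \in offsets -> (`|o i| <= rho)%N.
Proof.
rewrite mem_filter mem_box_seq => /andP[_ /in_boxP /(_ i)].
by rewrite (_ : (0 : Z) i = 0) ?ffunE// subr0.
Qed.

Lemma mem_offsets (o : Z) : (forall i, (`|o i| <= rho)%N) -> 0 < offset_prob o -> o \in offsets.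
Proof.
move=> ob po; rewrite mem_filter po mem_box_seq; apply/in_boxP => i.
by rewrite (_ : (0 : Z) i = 0) ?ffunE// subr0.
Qed.

Lemma offsets_down (o o' : Z) : o \in offsets -> (forall i, (`|o' i| <= `|o i|)%N) -> o' \in offsets.
Proof.
move=> oO oo'; apply: mem_offsets => [i|].
  by apply: leq_trans (oo' i) _; exact: offsets_bound.
by move: oO; rewrite mem_filter => /andP[po _]; apply: lt_le_trans po _; exact: offset_prob_anti.
Qed.

Lemma offsets_in_box (o : Z) : o \in offsets -> in_box rho 0 o.
Proof. by rewrite mem_filter mem_box_seq => /andP[]. Qed.

Lemma sum_offsets :
  \sum_(o <- offsets) offset_prob o = \sum_(o <- box_seq rho 0) offset_prob o.
Proof.
rewrite big_filter [RHS](bigID (fun o => 0 < offset_prob o))/= [X in _ + X]big1 ?addr0//.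
move=> o /negP po; apply/eqP; rewrite eq_le; have /andP[-> _] := offset_prob01 o.
by rewrite andbT leNgt; exact/negP.
Qed.

Lemma sum_offsets_le : \sum_(o <- offsets) offset_prob o <= (size offsets)%:R.
Proof.
rewrite -sum1_size natr_sum; apply: ler_sum => o _.
by have /andP[] := offset_prob01 o.
Qed.

Lemma offset_prob_min : exists2 p0 : R, 0 < p0 <= 1 &
  forall o, o \in offsets -> p0 <= offset_prob o.
Proof.
have : all (fun o => 0 < offset_prob o) offsets by exact: filter_all.
elim: offsets => [_|o s IH /= /andP[po /IH[p1 /andP[p10 p11] ps]]].
  by exists 1 => //; rewrite ltr01 lexx.
exists (Num.min (offset_prob o) p1); first by rewrite lt_min po p10/= ge_min p11 orbT.
by move=> v; rewrite inE ge_min => /orP[/eqP ->|/ps ->]; rewrite ?lexx ?orbT.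
Qed.

Variable K : nat.
Hypothesis rhoK : (rho.*2 < K.+2)%N.
Notation T := {ffun 'I_d -> 'I_K.+2}.

(** The sum has at most one term, since the offsets are too small to wrap around. *)
Definition cell_prob (u : T) : R := \sum_(o <- offsets | torus_proj K o == u) offset_prob o.

Definition offset_set : {set T} := [set u | u \in map (torus_proj K) offsets].

Lemma torus_proj_offsets_inj : {in offsets &, injective (torus_proj K)}.
Proof. by move=> o o' oO o'O; apply: (torus_proj_inj rhoK); exact: offsets_in_box. Qed.

Lemma cell_prob_proj (o : Z) : o \in offsets -> cell_prob (torus_proj K o) = offset_prob o.
Proof.
move=> oO; rewrite /cell_prob -big_filter.
rewrite (_ : [seq _ <- _ | _] = [:: o]) ?big_seq1//.
rewrite -(filter_pred1_uniq offsets_uniq oO); apply: eq_in_filter => o' o'O /=.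
by apply/eqP/eqP => [/torus_proj_offsets_inj|->//]; apply.
Qed.

Lemma cell_prob_notin u : u \notin offset_set -> cell_prob u = 0.
Proof.
move=> uO; rewrite /cell_prob big_seq_cond big1// => o /andP[oO /eqP ou].
by case/negP: uO; rewrite inE; apply/mapP; exists o.
Qed.

Lemma offset_setP u : reflect (exists2 o : Z, o \in offsets & u = torus_proj K o) (u \in offset_set).
Proof. by rewrite inE; exact: mapP. Qed.

Lemma cell_prob01 u : 0 <= cell_prob u <= 1.
Proof.
have [/offset_setP[ o oO ->]|/cell_prob_notin ->] := boolP (u \in offset_set).
  by rewrite cell_prob_proj// offset_prob01.
by rewrite lexx ler01.
Qed.

Lemma torus_projN (o : Z) : torus_proj K (- o) = - torus_proj K o.
Proof. by rewrite -sub0r torus_projB torus_proj0 sub0r. Qed.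

Lemma offsetsN (o : Z) : o \in offsets -> - o \in offsets.
Proof. by move=> oO; apply: (offsets_down oO) => i; rewrite ffunE abszN. Qed.

Lemma cell_prob_even u : cell_prob (- u) = cell_prob u.
Proof.
have sub v : v \in offset_set -> cell_prob (- v) = cell_prob v /\ - v \in offset_set.
  move=> /offset_setP[ o oO ->]; have oN := offsetsN oO.
  rewrite -torus_projN !cell_prob_proj//; split.
    by congr (g (_ * Num.sqrt _)); apply: eq_bigr => i _; rewrite ffunE abszN.
  by apply/offset_setP; exists (- o).
have [/sub[]//|uO] := boolP (u \in offset_set).
rewrite !cell_prob_notin//; apply: contraNN uO => /sub[_].
by rewrite opprK.
Qed.

Lemma card_offset_set : #|offset_set| = size offsets.
Proof.
rewrite cardsE -(size_map (torus_proj K)); apply/card_uniqP.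
by rewrite map_inj_in_uniq ?offsets_uniq//; exact: torus_proj_offsets_inj.
Qed.

Lemma sum_cell_prob : \sum_(u in offset_set) cell_prob u = \sum_(o <- offsets) offset_prob o.
Proof.
rewrite (eq_bigl (mem (map (torus_proj K) offsets))); last by move=> u; rewrite inE.
rewrite -big_uniq/=; last by rewrite map_inj_in_uniq ?offsets_uniq//; exact: torus_proj_offsets_inj.
by rewrite big_map !big_seq; apply: eq_bigr => o oO; exact: cell_prob_proj.
Qed.

(** The thinned graph is a subgraph: [g] is nonincreasing and [cell_dist], scaled
    by the side, bounds the distance from above. *)
Lemma cell_prob_le (r : R) (c c' : T) x y : 0 < r -> (K.+2%:R * r)^-1 <= dl ->
  torus_cell c x -> torus_cell c' y -> cell_prob (c' - c) <= g (torus_dist x y / r).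
Proof.
move=> r0 Kr xc yc; have Kn0 : 0 < K.+2%:R :> R by [].
have [/offset_setP[ o oO cc']|/cell_prob_notin ->] := boolP (c' - c \in offset_set); last first.
  by have /andP[] := g01 (divr_ge0 (torus_dist_ge0 x y) (ltW r0)).
rewrite cc' cell_prob_proj//; apply: g_ninc; first by rewrite divr_ge0 ?torus_dist_ge0// ltW.
have /(torus_dist_cells xc) tle : torus_cell (c + torus_proj K o) y.
  by rewrite -cc' addrC subrK.
rewrite ler_pdivrMr//; apply: le_trans tle _.
have dlK : 1 <= dl * (K.+2%:R * r) by rewrite -ler_pdivrMr ?mulr_gt0// div1r.
rewrite ler_pdivrMr// (_ : _ * r * _ = cell_dist R o * (dl * (K.+2%:R * r))); last by ring.
by rewrite ler_peMr// cell_dist_ge0.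
Qed.

Hypothesis d_gt1 : (1 < d)%N.
Hypothesis unit_prob : forall i : 'I_d, 0 < offset_prob (upd 0 i 1).

Lemma offsets_unit i : upd 0 i 1 \in offsets.
Proof.
by apply: mem_offsets => // j; rewrite updE; case: ifP => // _; rewrite ffunE.
Qed.

Lemma offsets0 : 0 \in offsets.
Proof. by apply: (offsets_down (offsets_unit (Ordinal d_gt1))) => i; rewrite ffunE. Qed.

Definition translate (c : T) (s : seq Z) : {set T} :=
  [set v | v \in [seq c + torus_proj K o | o <- s]].

Definition box_radius := ((size offsets).-1 + rho).+1.

(** The sets of cells of which [sparse_bad] says that they are not all bad. *)
Definition box_sets : {set {set T}} :=
  [set B : {set T} | (#|B| == (size offsets).-1) &&
    [exists c, B \subset translate c (box_seq box_radius 0)]].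

Lemma card_box_sets : (#|box_sets| <= #|{: T}| * 2 ^ (box_radius.*2.+1 ^ d))%N.
Proof.
pose S (c : T) := translate c (box_seq box_radius 0).
apply: (@leq_trans (\sum_(c : T) #|powerset (S c)|)).
  rewrite -sum1_card; apply: (@leq_trans (\sum_(B in box_sets) \sum_(c : T) (B \in powerset (S c)))).
    apply: leq_sum => B; rewrite inE => /andP[_ /existsP[c Bc]].
    by rewrite (bigD1 c)//= powersetE Bc.
  rewrite exchange_big/=; apply: leq_sum => c _.
  rewrite -sum1_card big_mkcond [leqRHS]big_mkcond/=; apply: leq_sum => B _.
  by case: (B \in box_sets) => //; case: ifP.
rewrite -sum_nat_const; apply: leq_sum => c _.
rewrite card_powerset leq_exp2l// cardsE; apply: leq_trans (card_size _) _.
by rewrite size_map size_image card_ffun !card_ord.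
Qed.

Variables (m k : nat) (x : {ffun 'I_m -> T}) (e : {ffun 'I_m * 'I_m -> bool}).
Hypothesis boxK : (box_radius.*2 < K.+2)%N.
Hypothesis k_gt0 : (0 < k)%N.

(** The three parts of [good] are the local conditions of [connected_of_local]. The
    threshold is [k.*2.-1] because the inequalities in [good] are strict. *)
Lemma good_connected : good box_sets k.*2.-1 k offset_set x e ->
  forall i j, connect (adj e) i j.
Proof.
case/and3P => /forall_inP sparse /forallP dense /forallP rich.
have k2 n : (k.*2.-1 < n)%N = (k.*2 <= n)%N by rewrite prednK// double_gt0.
apply: (connected_of_local offsets_uniq offsets0 offsets_down offsets_unit offsets_bound
  d_gt1 (leqnn _)) (adj_sym e) _ _ _.
- move=> c O Ouniq Osize /allP Obox; apply/allPn.
  have BF : translate c O \in box_sets.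
    rewrite inE cardsE (_ : #|_| = size O).
      rewrite Osize eqxx; apply/existsP; exists c; apply/fintype.subsetP => v.
      rewrite !inE => /mapP[ o oO ->]; apply: map_f.
      by rewrite mem_box_seq; exact: Obox.
    rewrite -(size_map (fun o => c + torus_proj K o)); apply/card_uniqP.
    rewrite map_inj_in_uniq// => o o' /Obox ob /Obox o'b /addrI.
    exact: (torus_proj_inj boxK).
  have /exists_inP[c'] := sparse _ BF.
  by rewrite inE k2 => /mapP[ o oO ->] h; exists o => //; rewrite -leqNgt; exact: h.
- move=> c o A A' oO Ak A'k dis Ac A'c.
  have /forall_inP/(_ (torus_proj K o))/(_ _)/forall_inP/(_ (A, A')) := dense c.
  have -> : torus_proj K o \in offset_set by apply/offset_setP; exists o.
  rewrite inE Ak A'k dis !eqxx /= => /(_ isT isT) /implyP.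
  have -> /= : [forall a in A, x a == c] by apply/forall_inP => a /Ac ->.
  have -> : [forall a in A', x a == c + torus_proj K o] by apply/forall_inP => a /A'c ->.
  by move=> /(_ isT)/exists_inP[a aA /exists_inP[a' aA' aa']]; exists a => //; exists a'.
- move=> i; have /exists_inP[u /offset_setP[ o oO ->]] := rich i.
  by rewrite k2 => h; exists o.
Qed.

End cell_model.

(** * The threshold is at least one *)
Section threshold.
Context (R : realType) (d : nat) (g : R -> R).
Hypothesis d_gt1 : (1 < d)%N.
Hypothesis g01 : forall r : R, 0 <= r -> 0 <= g r <= 1.
Hypothesis g_ninc : forall r s : R, 0 <= r -> r <= s -> g s <= g r.
Hypothesis alpha_pos_fin : (0 < conn_integral d g < +oo)%E.

(** Otherwise all Riemann sums, and with them [alpha], would vanish. *)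
Lemma g_pos_somewhere : exists2 r : R, 0 < r & 0 < g r.
Proof.
have half : 0 < 2^-1 :> R by [].
have [dl [rho [dl0 _ _ h]]] :=
  riemann_sum g01 g_ninc (ltnW d_gt1) alpha_pos_fin half ltr01.
have a0 := alpha_gt0 alpha_pos_fin.
have s1 : 0 < \sum_(o <- box_seq rho (0 : {ffun 'I_d -> int})) g (dl * cell_dist R o) - 1.
  rewrite -(pmulr_rgt0 _ (exprn_gt0 d dl0)); apply: lt_le_trans h.
  by rewrite mulr_gt0//; lra.
have [hasg|/hasPn nog] := boolP (has (fun o => 0 < g (dl * cell_dist R o)) (box_seq rho (0 : {ffun 'I_d -> int}))).
  have /hasP[v _ gv] := hasg; exists (dl * cell_dist R v) => //.
  rewrite mulr_gt0// sqrtr_gt0 (bigD1 (Ordinal (ltnW d_gt1)))//=.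
  by rewrite ltr_wpDr ?exprn_gt0// sumr_ge0// => i _; exact: sqr_ge0.
suff : \sum_(o <- box_seq rho (0 : {ffun 'I_d -> int})) g (dl * cell_dist R o) <= 0.
  by move: s1; lra.
by rewrite big_seq; apply: sumr_le0 => v /nog; rewrite -leNgt.
Qed.

(** As [g <= 1], every element of the set defining [beta] is larger than [1]. This
    needs the set to be nonempty, the infimum of the empty set being [0]: as the
    argument of [g] tends to [0] when [x] grows, a large [x] is an element. *)
Lemma beta_ge1 : 1 <= beta d g.
Proof.
have [r0 r00 gr0] := g_pos_somewhere.
apply: lb_le_inf; last first.
  move=> x /= [x0 hx]; apply: le_trans (ltW hx) _; rewrite ler_piMr ?(ltW x0)//.
  have a0 : 0 <= alpha d g / (x * unit_ball_volume R d).
    rewrite divr_ge0 ?(ltW (alpha_gt0 alpha_pos_fin))// mulr_ge0 ?(ltW x0)//.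
    by rewrite fine_ge0// measure_ge0.
  by have /andP[] := g01 a0.
pose q := alpha d g / unit_ball_volume R d.
have q0 : 0 <= q.
  by rewrite divr_ge0 ?(ltW (alpha_gt0 alpha_pos_fin))// fine_ge0// measure_ge0.
pose x := q / r0 + (g r0)^-1 + 1.
have gi0 : 0 < (g r0)^-1 by rewrite invr_gt0.
have qr0 : 0 <= q / r0 by rewrite divr_ge0// ltW.
have x0 : 0 < x by rewrite /x; lra.
exists x; split => //.
have gx : g r0 <= g (alpha d g / (x * unit_ball_volume R d)).
  apply: g_ninc.
    rewrite invfM mulrCA mulr_ge0 ?invr_ge0 ?(ltW x0)//.
  rewrite invfM mulrCA -/q mulrC ler_pdivrMr//.
  have : q / r0 <= x by rewrite /x; lra.
  by rewrite ler_pdivrMr// mulrC.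
apply: (@lt_le_trans _ _ (x * g r0)); last by rewrite ler_pM2l.
rewrite -ltr_pdivrMr// div1r /x; lra.
Qed.

End threshold.

(** * Connectivity is an event *)
Section connectivity_event.
Context (R : realType) (d : nat) (g : R -> R).

(** Connectivity depends on a configuration only through the coincidences of
    the points and the edges between indices. *)
Lemma rcm_connected_transfer (r : R) (x x' : nat -> d.-tuple R) (m : nat)
    (u u' : nat -> nat -> R) :
  (forall i j, (i < m)%N -> (j < m)%N -> (x i = x j) -> (x' i = x' j)) ->
  (forall i j, (i < j < m)%N -> u i j <= g (torus_dist (x i) (x j) / r) ->
     u' i j <= g (torus_dist (x' i) (x' j) / r)) ->
  rcm_connected g x m u r -> rcm_connected g x' m u' r.
Proof.
move=> xx' uu' conn _ _ [i im <-] [j jm <-].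
have [s [sp sl]] := conn (x i) (x j) (ex_intro2 _ _ i im erefl) (ex_intro2 _ _ j jm erefl).
elim: s i im sp sl => [|b s IH] i im /=.
  by move=> _ /xx' h; exists [::]; split => //=; exact: h.
case/andP => /asboolP [a1 [a2 [/andP[a12 a2m] ua xa]]] sp sl.
have a1m : (a1 < m)%N by exact: ltn_trans a2m.
have [k [km kb ek]] : exists k, [/\ (k < m)%N, b = x k & rcm_edge g x' m u' r (x' i) (x' k)].
  case: xa => -[xi xb].
    exists a2; split => //; exists a1, a2; split; [by rewrite a12| |].
      by apply: uu' => //; rewrite a12.
    by left; split => //; exact: xx'.
  exists a1; split => //; exists a1, a2; split; [by rewrite a12| |].
    by apply: uu' => //; rewrite a12.
  by right; split => //; exact: xx'.
have [s' [sp' sl']] := IH k km (eq_ind _ (fun b => path _ b s) sp _ kb)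
   (eq_ind _ (fun b => last b s = x j) sl _ kb).
by exists (x' k :: s') => /=; split => //; rewrite sp' andbT; exact/asboolP.
Qed.

Context (disp : measure_display) (Omega : measurableType disp).
Context (X : nat -> {mfun Omega >-> d.-tuple R}) (N : {mfun Omega >-> nat}).
Context (U : nat -> nat -> {mfun Omega >-> R}).
Hypothesis g_ninc : forall r s : R, 0 <= r -> r <= s -> g s <= g r.

(** Given the number of points, [rcm_connected_transfer] makes this set a finite
    union of events that prescribe the outcomes of finitely many comparisons. *)
Lemma measurable_rcm_connected (r : R) : 0 <= r ->
  measurable [set w | rcm_connected g (fun i => X i w) (N w) (fun i j => U i j w) r].
Proof.
move=> r0.
pose Em m (w : Omega) : Prop := rcm_connected g (fun i => X i w) m (fun i j => U i j w) r.
have -> : [set w | rcm_connected g (fun i => X i w) (N w) (fun i j => U i j w) r] =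
    \bigcup_m (N @^-1` [set m] `&` [set w | Em m w]).
  by apply/seteqP; split => [w h|w [m _ [/= <-]]//]; exists (N w).
apply: bigcupT_measurable => m; apply: measurableI.
  by rewrite -[X in measurable X]setTI; exact: measurable_funPT.
pose dat := {ffun 'I_m * 'I_m -> bool * bool}.
pose coin (ij : 'I_m * 'I_m) : set Omega := [set w | X ij.1 w = X ij.2 w].
pose edge (ij : 'I_m * 'I_m) : set Omega :=
  [set w | U ij.1 ij.2 w <= g (torus_dist (X ij.1 w) (X ij.2 w) / r)].
have mcoin ij : measurable (coin ij).
  have -> : coin ij = \bigcap_(k in [set: 'I_d])
      [set w | (tnth (X ij.1 w) k == tnth (X ij.2 w) k) = true].
    apply/seteqP; split => [w e k _|w h] /=; first by apply/eqP; congr tnth; exact: e.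
    by apply: eq_from_tnth => k; exact/eqP/(h k I).
  apply: fin_bigcap_measurable => // k _.
  rewrite -[X in measurable X]setTI.
  have mt (i : nat) : measurable_fun setT (fun w => tnth (X i w) k).
    exact: (measurableT_comp (measurable_tnth k) (measurable_funPT (X i))).
  by apply: (measurable_fun_eqr (mt ij.1) (mt ij.2) measurableT (Y := [set true])).
have medge ij : measurable (edge ij).
  have -> : edge ij = [set w | (U ij.1 ij.2 w <= g (torus_dist (X ij.1 w) (X ij.2 w) / r)) = true].
    by [].
  rewrite -[X in measurable X]setTI.
  have mg : measurable_fun setT (fun w => g (torus_dist (X ij.1 w) (X ij.2 w) / r)).
    apply: measurable_g_ge0 => //.
      by apply: measurable_funM => //; apply: measurable_torus_dist; exact: measurable_funPT.
    by move=> w; rewrite divr_ge0// torus_dist_ge0.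
  have mU : measurable_fun setT (U ij.1 ij.2) by exact: measurable_funPT.
  by apply: (measurable_fun_ler mU mg measurableT (Y := [set true])).
pose D (w : Omega) : dat := [ffun ij => (`[< coin ij w >], `[< edge ij w >])].
have mD (v : dat) : measurable [set w | D w = v].
  have -> : [set w | D w = v] = \bigcap_(ij in [set: 'I_m * 'I_m])
      ((if (v ij).1 then coin ij else ~` coin ij) `&`
       (if (v ij).2 then edge ij else ~` edge ij)).
    apply/seteqP; split => [w /= <- ij _|w h] /=.
      rewrite ffunE /=; split.
        by case: asboolP.
      by case: asboolP.
    apply/ffunP => ij; rewrite ffunE; have := h ij I; case: (v ij) => a b /= [h1 h2].
    congr pair.
      by case: a h1 => h1; [exact/asboolP|exact/asboolPn].
    by case: b h2 => h2; [exact/asboolP|exact/asboolPn].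
  apply: fin_bigcap_measurable => // ij _; apply: measurableI.
    by case: ifP => _ //; exact: measurableC.
  by case: ifP => _ //; exact: measurableC.
have -> : [set w | Em m w] = \bigcup_(v in [set v : dat | exists2 w, Em m w & D w = v])
    [set w | D w = v].
  apply/seteqP; split => [w Ew|w [v [w0 Ew0 Dw0] Dw]] /=; first by exists (D w) => //; exists w.
  have DD ij : (coin ij w0 -> coin ij w) /\ (edge ij w0 -> edge ij w).
    have := congr1 (fun f : dat => f ij) (etrans Dw0 (esym Dw)).
    rewrite !ffunE => -[e1 e2]; split => h.
      by apply/asboolP; rewrite -e1; exact/asboolP.
    by apply/asboolP; rewrite -e2; exact/asboolP.
  apply: rcm_connected_transfer Ew0 => [i j im jm|i j /andP[ij jm]].
    exact: (DD (Ordinal im, Ordinal jm)).1.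
  exact: (DD (Ordinal (ltn_trans ij jm), Ordinal jm)).2.
apply: fin_bigcup_measurable => //.
exact: finite_finset.
Qed.

End connectivity_event.

(** * Product rules and finite disjoint unions *)
Section independence.
Context (disp : measure_display) (Omega : measurableType disp) (R : realType).
Context (P : probability Omega R).

Lemma independent_seq (I : choiceType) (J : set I) (F : I -> set (set Omega))
    (s : seq I) (A : I -> set Omega) :
  mutually_independent P J F -> uniq s -> (forall i, i \in s -> J i) ->
  (forall i, i \in s -> F i (A i)) ->
  P (\bigcap_(i in [set` s]) A i) = (\prod_(i <- s) P (A i))%E.
Proof.
move=> indep us sJ sA; pose K := seq_fset tt s.
have KE i : (i \in K) = (i \in s) by rewrite seq_fsetE.
have -> : [set` s] = [set` K] by apply/seteqP; split=> i /=; rewrite KE.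
rewrite indep; first last.
- by move=> i; rewrite KE; exact: sA.
- by move=> i /=; rewrite KE; exact: sJ.
by apply: perm_big; rewrite -[X in perm_eq _ X](undup_id us); exact: seq_fset_perm.
Qed.

Lemma sigma_bigcap_seq (I : eqType) (G : set (set Omega)) (s : seq I) (A : I -> set Omega) :
  (forall i, i \in s -> G (A i)) -> <<s G >> (\bigcap_(i in [set` s]) A i).
Proof.
move=> sA.
have := @fin_bigcap_measurable _ (g_sigma_algebraType G) I [set` s] A.
apply; first exact: finite_seq.
by move=> i /= /sA Gi; apply: sub_sigma_algebra.
Qed.

Lemma finite_disjoint_le (I : finType) (A : set Omega) (E : I -> set Omega) :
  measurable A -> (forall i, measurable (E i)) -> (forall i, E i `<=` A) ->
  (forall i j, i != j -> E i `&` E j = set0) ->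
  (\sum_i P (E i) <= P A)%E.
Proof.
move=> mA mE EA dE.
suff H (s : seq I) B : uniq s -> measurable B -> (forall i, i \in s -> E i `<=` B) ->
  (\sum_(i <- s) P (E i) <= P B)%E by apply: H => //; exact: index_enum_uniq.
elim: s B => [|i s IH] B; first by rewrite big_nil.
rewrite cons_uniq => /andP[si us] mB EB; rewrite big_cons.
have mD : measurable (B `\` E i) by exact: measurableD.
rewrite -[in leRHS](setDUK (EB i (mem_head _ _))) measureU//; last by rewrite setDIK.
rewrite leeD2l// IH// => j js x Ejx; split; first by apply: EB Ejx; rewrite inE js orbT.
move=> Eix; have ij : i != j by apply: contraNneq si => ->.
by have := dE i j ij; rewrite -subset0 => /(_ x); apply.
Qed.

Lemma uniform_prob_le (q : R) : 0 <= q <= 1 ->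
  uniform_prob (@ltr01 R) [set u | u <= q] = q%:E.
Proof.
move=> /andP[q0 q1].
rewrite /uniform_prob integral_uniform_pdf.
have -> : [set u | u <= q] `&` `[0, 1] = `[0, q]%classic.
  apply/seteqP; split => u /=; rewrite !in_itv/=.
    by move=> [-> /andP[-> _]].
  by move=> /andP[u0 uq]; rewrite uq u0 (le_trans uq q1).
under eq_integral.
  move=> u; rewrite inE /= in_itv/= => /andP[u0 uq].
  rewrite /uniform_pdf u0 (le_trans uq q1)/= subr0 invr1; over.
rewrite integral_cst//= mul1e lebesgue_measure_itv/= lte_fin.
by case: ltgtP q0 => //= [_|<-]; rewrite ?sube0.
Qed.

End independence.

(** * From the finite model to the random connection model *)
Section random_graph.
Context (R : realType) (d : nat) (g : R -> R).
Hypothesis d_gt1 : (1 < d)%N.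
Hypothesis g01 : forall r : R, 0 <= r -> 0 <= g r <= 1.
Hypothesis g_ninc : forall r s : R, 0 <= r -> r <= s -> g s <= g r.
Context (disp : measure_display) (Omega : measurableType disp) (P : probability Omega R).
Context (X : nat -> {RV P >-> d.-tuple R}) (N : nat -> {RV P >-> nat}).
Context (U : nat -> nat -> {RV P >-> R}).
Hypothesis X_unif : forall i (A : set (d.-tuple R)), measurable A ->
  distribution P (X i) A = lebesgueRd R d (A `&` torus_cube R d).
Hypothesis X_indep : mutually_independent P [set: nat] (fun i => events_of (X i)).
Hypothesis N_poisson : forall n k, (1 <= n)%N ->
  distribution P (N n) [set k] = (poisson_pmf (n%:R : R) k)%:E.
Hypothesis U_unif : forall i j (A : set R), (i < j)%N -> measurable A ->
  distribution P (U i j) A = uniform_prob (@ltr01 R) A.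
Hypothesis U_indep : mutually_independent P [set ij : nat * nat | (ij.1 < ij.2)%N]
  (fun ij => events_of (U ij.1 ij.2)).
Hypothesis XNU_indep : mutually_independent P [set: 'I_3]
  (nth set0 [:: sigma_of [set: nat] X;
                sigma_of [set n | (1 <= n)%N] N;
                sigma_of [set ij : nat * nat | (ij.1 < ij.2)%N]
                  (fun ij => U ij.1 ij.2)]).

Section realization.
Context (T : finZmodType) (C : T -> set (d.-tuple R)) (p : T -> R).
Hypothesis mC : forall t, measurable (C t).
Hypothesis X_C : forall i t, P (X i @^-1` C t) = (#|T|%:R^-1)%:E.
Hypothesis p01 : forall t, 0 <= p t <= 1.

Lemma events_of_preimage d' (S : measurableType d') (Y : Omega -> S) B :
  measurable B -> events_of Y (Y @^-1` B).
Proof. by move=> mB; exists B => //; rewrite setTI. Qed.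

Context (n m : nat) (x : {ffun 'I_m -> T}) (e : {ffun 'I_m * 'I_m -> bool}).

Definition mark_set (ab : 'I_m * 'I_m) : set R :=
  if e ab then [set u | u <= edge_prob p x ab] else [set u | edge_prob p x ab < u].

(** The positions are prescribed up to cells and the marks up to the comparison
    with the edge probabilities between cells. A mark configuration that is true
    at a pair which is not increasing gives the empty event, in accordance with
    its weight. *)
Definition model_event : set Omega :=
  [set w | [/\ N n w = m, forall i : 'I_m, C (x i) (X i w) &
    forall a b : 'I_m, if (a < b)%N then mark_set (a, b) (U a b w) else ~~ e (a, b)]].

Let posE (i : nat) : set Omega :=
  if insub i is Some j then X i @^-1` C (x j) else setT.
Let markE (ij : nat * nat) : set Omega :=
  if (insub ij.1, insub ij.2) is (Some a, Some b) then U ij.1 ij.2 @^-1` mark_set (a, b)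
  else setT.
Let nat_pair (ab : 'I_m * 'I_m) : nat * nat := (ab.1 : nat, ab.2 : nat).
Let pairs := [seq nat_pair ab | ab : 'I_m * 'I_m <- enum {: 'I_m * 'I_m} & (ab.1 < ab.2)%N].

Let mark_set_measurable ab : measurable (mark_set ab).
Proof.
rewrite /mark_set; case: (e ab).
  by rewrite -[X in measurable X]/([set` `]-oo, edge_prob p x ab]]) ; exact: measurable_itv.
rewrite (_ : [set _ | _] = [set` `]edge_prob p x ab, +oo[]); first exact: measurable_itv.
by apply/seteqP; split=> u /=; rewrite in_itv/= andbT.
Qed.

Let pairsP ij : ij \in pairs ->
  exists2 ab : 'I_m * 'I_m, (ab.1 < ab.2)%N & ij = (ab.1 : nat, ab.2 : nat).
Proof. by move=> /mapP[ab]; rewrite mem_filter => /andP[? _] ->; exists ab. Qed.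

Let markE_pair (ab : 'I_m * 'I_m) :
  markE (ab.1 : nat, ab.2 : nat) = U ab.1 ab.2 @^-1` mark_set ab.
Proof. by rewrite /markE/= !valK -surjective_pairing. Qed.

Let pos_event := \bigcap_(i in [set` iota 0 m]) posE i.
Let mark_event := \bigcap_(ij in [set` pairs]) markE ij.

Let posE_ord (i : 'I_m) : posE i = X i @^-1` C (x i).
Proof. by rewrite /posE valK. Qed.

Let pos_events i : i \in iota 0 m -> events_of (X i) (posE i).
Proof.
rewrite mem_iota add0n => /= im; rewrite -[i]/(val (Ordinal im)) posE_ord.
exact: events_of_preimage.
Qed.

Let mark_events ij : ij \in pairs -> events_of (U ij.1 ij.2) (markE ij).
Proof. by move=> /pairsP[ab _ ->]; rewrite markE_pair; exact: events_of_preimage. Qed.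

Let pos_event_prob : P pos_event = (#|T|%:R^-1 ^+ m)%:E.
Proof.
rewrite (independent_seq X_indep) ?iota_uniq// (_ : iota 0 m = index_iota 0 m);
  last by rewrite /index_iota subn0.
rewrite big_mkord; under eq_bigr => i _ do rewrite posE_ord X_C.
by rewrite prodEFin prodr_const card_ord.
Qed.

Let edge_prob_01 ab : 0 <= edge_prob p x ab <= 1.
Proof. by rewrite /edge_prob; case: ifP => _; rewrite ?p01// lexx ler01. Qed.

Let mark_prob (ab : 'I_m * 'I_m) : (ab.1 < ab.2)%N ->
  P (U ab.1 ab.2 @^-1` mark_set ab) =
  (if e ab then edge_prob p x ab else 1 - edge_prob p x ab)%:E.
Proof.
move=> ab12.
have H : P (U ab.1 ab.2 @^-1` [set u | u <= edge_prob p x ab]) = (edge_prob p x ab)%:E.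
  have /= := U_unif ab12 (measurable_itv `]-oo, edge_prob p x ab]).
  rewrite /distribution /pushforward => ->; exact: uniform_prob_le.
rewrite /mark_set; case: (e ab) => //.
have -> : U ab.1 ab.2 @^-1` [set u | edge_prob p x ab < u] =
    ~` (U ab.1 ab.2 @^-1` [set u | u <= edge_prob p x ab]).
  by apply/seteqP; split => w /=; rewrite ltNge => /negP.
rewrite probability_setC ?H//.
rewrite -[X in measurable X]setTI; apply: measurable_funPT => //.
exact: (measurable_itv `]-oo, edge_prob p x ab]).
Qed.

Let mark_event_prob : (forall ab : 'I_m * 'I_m, ~~ (ab.1 < ab.2)%N -> ~~ e ab) ->
  P mark_event = (marks_weight p x e)%:E.
Proof.
move=> esupp; rewrite (independent_seq U_indep); last first.
- exact: mark_events.
- by move=> ij /pairsP[ab ab12 ->].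
- rewrite map_inj_uniq; first by apply: filter_uniq; exact: enum_uniq.
  by move=> [a b] [a' b'] [/val_inj -> /val_inj ->].
rewrite big_map big_filter big_enum_cond/=.
rewrite (eq_bigr (fun ab => (if e ab then edge_prob p x ab else 1 - edge_prob p x ab)%:E)); last first.
  by move=> ab ab12; rewrite markE_pair mark_prob.
rewrite prodEFin /marks_weight [in RHS](bigID (fun ab : 'I_m * 'I_m => (ab.1 < ab.2)%N))/=.
rewrite [X in _ = (_ * X)%:E]big1 ?mulr1// => ab ab12.
by rewrite (negPf (esupp ab ab12)) /edge_prob (negPf ab12) subr0.
Qed.

Let model_eventE : (forall ab : 'I_m * 'I_m, ~~ (ab.1 < ab.2)%N -> ~~ e ab) ->
  model_event = pos_event `&` (N n @^-1` [set m]) `&` mark_event.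
Proof.
move=> esupp; apply/seteqP; split => w.
  move=> [Nm Xw Uw]; split; first split => //.
    move=> i /=; rewrite mem_iota add0n => /= im.
    by rewrite -[i]/(val (Ordinal im)) posE_ord; exact: Xw.
  move=> ij /pairsP[[a b] /= ab ->]; rewrite (markE_pair (a, b)) /=.
  by have := Uw a b; rewrite ab.
move=> [[Xw Nm] Uw]; split => //.
  move=> i; have := Xw i; rewrite posE_ord; apply => /=.
  by rewrite mem_iota add0n /= ltn_ord.
move=> a b; case: ifPn => ab; last exact: (esupp (a, b)).
have := Uw (a : nat, b : nat); rewrite (markE_pair (a, b)); apply => /=.
by apply/mapP; exists (a, b) => //; rewrite mem_filter /= ab mem_enum.
Qed.

Let pos_sigma : sigma_of [set: nat] X pos_event.
Proof. by apply: sigma_bigcap_seq => i /pos_events h; exists i. Qed.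

Let mark_sigma : sigma_of [set ij : nat * nat | (ij.1 < ij.2)%N] (fun ij => U ij.1 ij.2) mark_event.
Proof.
apply: sigma_bigcap_seq => ij ijp; exists ij; last exact: mark_events.
by have [ab ab12 ->] := pairsP ijp.
Qed.

Lemma model_event_probability : (1 <= n)%N ->
  P model_event = (poisson_pmf (n%:R : R) m * weight p x e)%:E.
Proof.
move=> n1.
have [/forallP esupp|/forallPn[[a b]]] :=
    boolP [forall ab : 'I_m * 'I_m, ~~ (ab.1 < ab.2)%N ==> ~~ e ab]; last first.
  rewrite negb_imply negbK => /andP[/= ab eab].
  rewrite (_ : model_event = set0).
    rewrite measure0 /weight /marks_weight (bigD1 (a, b))//= eab /edge_prob /= (negPf ab).
    by rewrite mul0r !mulr0.
  by rewrite -subset0 => w [_ _ /(_ a b)]; rewrite (negPf ab) eab.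
have {}esupp (ab : 'I_m * 'I_m) : ~~ (ab.1 < ab.2)%N -> ~~ e ab.
  by move/implyP: (esupp ab).
rewrite model_eventE// /weight EFinM EFinM -pos_event_prob -mark_event_prob//.
rewrite -(N_poisson _ n1) /distribution /pushforward muleCA.
pose A3 := nth set0 [:: pos_event; N n @^-1` [set m]; mark_event].
have := @independent_seq _ _ _ _ _ _ _ (index_enum 'I_3) (fun i => A3 i)
  XNU_indep (index_enum_uniq _).
rewrite !big_ord_recl big_ord0 mule1 /A3/= => <-//.
- congr (P _); apply/seteqP; split => w.
    move=> [[h1 h2] h3] i _; case: i => -[|[|[|]]]//.
  move=> h; split; first split.
  + by have := h ord0; apply; rewrite /= mem_index_enum.
  + by have := h (inord 1); rewrite inordK//; apply; rewrite /= mem_index_enum.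
  + by have := h (inord 2); rewrite inordK//; apply; rewrite /= mem_index_enum.
- case=> -[|[|[|k]]] i3 // _.
  by apply: sub_sigma_algebra; exists n => //; exact: events_of_preimage.
Qed.

Lemma measurable_model_event : measurable model_event.
Proof.
have mpre d' (S : measurableType d') (Y : {mfun Omega >-> S}) B :
    measurable B -> measurable (Y @^-1` B).
  by move=> mB; rewrite -[X in measurable X]setTI; exact: measurable_funPT.
have [/forallP esupp|/forallPn[[a b]]] :=
    boolP [forall ab : 'I_m * 'I_m, ~~ (ab.1 < ab.2)%N ==> ~~ e ab]; last first.
  rewrite negb_imply negbK => /andP[/= ab eab].
  rewrite (_ : model_event = set0)// -subset0 => w [_ _ /(_ a b)].
  by rewrite (negPf ab) eab.
rewrite model_eventE; last by move=> ab; move/implyP: (esupp ab).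
apply: measurableI; first apply: measurableI.
- apply: fin_bigcap_measurable => [|i /= im]; first exact: finite_seq.
  by have [B mB <-] := pos_events im; rewrite setTI; exact: mpre.
- exact: mpre.
- apply: fin_bigcap_measurable => [|ij /= ijp]; first exact: finite_seq.
  by have [B mB <-] := mark_events ijp; rewrite setTI; exact: mpre.
Qed.

End realization.

Definition conn_event (r : R) (n : nat) : set Omega :=
  [set w | rcm_connected g (fun i => X i w) (N n w) (fun i j => U i j w) r].

Lemma measurable_conn_event r n : 0 <= r -> measurable (conn_event r n).
Proof. exact: measurable_rcm_connected. Qed.

Section mesh.
Variables (dl : R) (rho K : nat).
Hypothesis dl_gt0 : 0 < dl.
Hypothesis rho_gt0 : (0 < rho)%N.
Hypothesis unit_prob : forall i : 'I_d, 0 < offset_prob g dl (upd 0 i 1).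
Notation T := {ffun 'I_d -> 'I_K.+2}.
Hypothesis boxK : ((box_radius d g dl rho).*2 < K.+2)%N.
Variable r : R.
Hypothesis r_gt0 : 0 < r.
Hypothesis mesh : (K.+2%:R * r)^-1 <= dl.

Let rhoK : (rho.*2 < K.+2)%N.
Proof.
apply: leq_ltn_trans boxK; rewrite leq_double.
by apply: leqW; exact: leq_addl.
Qed.

Notation p := (@cell_prob R d g dl rho K).

Let p01 u : 0 <= p u <= 1. Proof. exact: cell_prob01. Qed.

(** By [cell_prob_le] the marked pairs are edges of the random connection graph. *)
Lemma model_event_connected n m (x : {ffun 'I_m -> T}) e w :
  model_event (@torus_cell R d K) p n x e w ->
  (forall i j, connect (adj e) i j) -> conn_event r n w.
Proof.
case=> Nm xw ew conn _ _ [i im <-] [j jm <-]; rewrite /= Nm in im jm *.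
have /connectP[s sp jl] := conn (Ordinal im) (Ordinal jm).
exists [seq X (a : nat) w | a : 'I_m <- s]; split; last first.
  by rewrite -[X i w]/((fun a : 'I_m => X a w) (Ordinal im)) last_map -jl.
rewrite -[X i w]/((fun a : 'I_m => X a w) (Ordinal im)) path_map.
apply: sub_path sp => a b /= /andP[ab eab]; apply/asboolP.
have edge (a1 b1 : 'I_m) : (a1 < b1)%N -> e (a1, b1) ->
    U a1 b1 w <= g (torus_dist (X a1 w) (X b1 w) / r).
  move=> ab1 e1; have := ew a1 b1; rewrite ab1 /mark_set e1 /edge_prob /= ab1.
  by move=> /le_trans; apply; apply: cell_prob_le (xw a1) (xw b1).
move: eab; rewrite /ordered; case: ifP => [lt eab|/negbT nlt eab].
  by exists a, b; split; [rewrite lt ltn_ord|exact: edge|left].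
have ba : (b < a)%N.
  by rewrite ltn_neqAle leqNgt nlt andbT; apply: contraNneq ab => /val_inj ->.
by exists b, a; split; [rewrite ba ltn_ord|exact: edge|right].
Qed.

Let conn_N n m := conn_event r n `&` (N n @^-1` [set m]).

Let mconn_N n m : measurable (conn_N n m).
Proof.
apply: measurableI; first by apply: measurable_conn_event; exact: ltW.
by rewrite -[X in measurable X]setTI; exact: measurable_funPT.
Qed.

Lemma X_torus_cell i (t : T) : P (X i @^-1` torus_cell t) = (#|{: T}|%:R^-1)%:E.
Proof.
have [mt tv] := torus_cell_volume R t.
by have := X_unif i mt; rewrite tv.
Qed.

(** The model events of the good configurations are disjoint and imply
    connectivity. *)
Lemma connected_lower_bound n m k : (1 <= n)%N -> (0 < k)%N ->
  ((poisson_pmf (n%:R : R) m * \sum_(x : {ffun 'I_m -> T}) \sum_e weight p x e *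
     (good (@box_sets R d g dl rho K) k.*2.-1 k (@offset_set R d g dl rho K) x e)%:R)%:E <=
   P (conn_N n m))%E.
Proof.
move=> n1 k0.
pose gd (xe : {ffun 'I_m -> T} * {ffun 'I_m * 'I_m -> bool}) :=
  good (@box_sets R d g dl rho K) k.*2.-1 k (@offset_set R d g dl rho K) xe.1 xe.2.
pose ev (xe : {ffun 'I_m -> T} * {ffun 'I_m * 'I_m -> bool}) : set Omega :=
  model_event (@torus_cell R d K) p n xe.1 xe.2.
pose E xe := if gd xe then ev xe else set0.
have mev xe : measurable (ev xe).
  apply: measurable_model_event => // t; exact: (torus_cell_volume R t).1.
have evP xe : P (ev xe) = (poisson_pmf (n%:R : R) m * weight p xe.1 xe.2)%:E.
  apply: model_event_probability => //.
  - by move=> t; exact: (torus_cell_volume R t).1.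
  - exact: X_torus_cell.
rewrite pair_big mulr_sumr -sumEFin/=.
rewrite (eq_bigr (fun xe => P (E xe))); last first.
  move=> xe _; rewrite /E -[good _ _ _ _ _ _]/(gd xe); case: (gd xe).
    by rewrite evP mulr1.
  by rewrite measure0 !mulr0.
apply: finite_disjoint_le => //.
- by move=> xe; rewrite /E; case: ifP.
- move=> xe; rewrite /E; case: ifP => // gxe w exw; split; last by case: exw.
  apply: (model_event_connected exw); apply: good_connected gxe => //.
- move=> xe xe' ne; rewrite /E; case: ifP => _; last by rewrite set0I.
  case: ifP => _; last by rewrite setI0.
  rewrite -subset0 => w [[_ h1 h2] [_ h3 h4]]; case/eqP: ne.
  have x12 : xe.1 = xe'.1.
    apply/ffunP => i; apply/eqP; apply: contraT => /(torus_cell_disjoint R).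
    by rewrite -subset0 => /(_ (X i w)); case; split; [exact: h1|exact: h3].
  rewrite [xe]surjective_pairing [xe']surjective_pairing x12; congr pair.
  apply/ffunP => -[a b]; have := h2 a b; have := h4 a b.
  case: ifP => [ab|_ /negPf-> /negPf->//]; rewrite /mark_set x12.
  by case: (xe.2 (a, b)); case: (xe'.2 (a, b)) => //=; [rewrite ltNge => /negP|move=> h; rewrite ltNge h].
Qed.

Lemma conn_event_ge_sum n (M : nat) (A : pred nat) : (1 <= n)%N ->
  (\sum_(m < M | A m) P (conn_N n m) <= P (conn_event r n))%E.
Proof.
move=> n1; rewrite big_mkcond/=.
rewrite (eq_bigr (fun m : 'I_M => P (if A m then conn_N n m else set0))); last first.
  by move=> m _; case: ifP => //; rewrite measure0.
apply: finite_disjoint_le.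
- by apply: measurable_conn_event; exact: ltW.
- by move=> m; case: ifP.
- by move=> m; case: ifP => // _ w [].
- move=> m m' mm'; case: ifP => _; last by rewrite set0I.
  case: ifP => _; last by rewrite setI0.
  rewrite -subset0 => w [[_ /= h1] [_ /= h2]]; case/eqP: mm'.
  by apply/val_inj; rewrite /= -h1 -h2.
Qed.

End mesh.

Hypothesis alpha_pos_fin : (0 < conn_integral d g < +oo)%E.
Variable gamma : R.
Hypothesis gamma_gt1 : 1 < gamma.

(** The mesh [dl] is chosen first, then the parameters of [error_bound], then [n]
    large. The factor with [C] bounds the probability of [good] given the number
    of points, the other one the probability that this number is close to [n]. *)
Lemma connectivity_rate : exists eps tau C Lam : R, [/\ 0 < eps, 0 < tau, 0 <= C &
  forall n : nat, (1 <= n)%N -> Lam <= ln (n%:R : R) ->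
    C * expR (- (tau * ln n%:R)) <= 1 ->
    (((1 - C * expR (- (tau * ln n%:R))) * (1 - 2 / (eps ^+ 2 * n%:R)))%:E <=
     P (conn_event (rhat d g gamma n) n))%E].
Proof.
have [eps [tau [eps12 tau0 slack]]] := slack_exists gamma_gt1.
have [e0 e1] := andP eps12.
have a0 := alpha_gt0 alpha_pos_fin.
have g0 : 0 < gamma by apply: lt_trans gamma_gt1.
have [r0 r00 gr0] := g_pos_somewhere d_gt1 g01 g_ninc alpha_pos_fin.
(* [C0] bounds [cell_dist] at the unit offsets, whose probability is thus positive
   for [dl <= r0 / (C0 + 1)]. *)
pose C0 : R := Num.sqrt (\sum_(i < d) 2 ^+ 2).
have C00 : 0 <= C0 by exact: sqrtr_ge0.
have eta0 : 0 < r0 / (C0 + 1) by rewrite divr_gt0// ltr_wpDl.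
have [dl [rho [dl0 dle rho0 riem]]] := riemann_sum g01 g_ninc (ltnW d_gt1) alpha_pos_fin e0 eta0.
have unitp (i : 'I_d) : 0 < offset_prob g dl (upd 0 i 1).
  apply: lt_le_trans gr0 _; apply: g_ninc.
    by rewrite mulr_ge0 ?cell_dist_ge0// ltW.
  apply: (@le_trans _ _ (r0 / (C0 + 1) * C0)).
    apply: ler_pM; rewrite ?cell_dist_ge0 ?(ltW dl0)//.
    apply: ler_wsqrtr; apply: ler_sum => j _.
    rewrite lerXn2r ?nnegrE// ler_nat updE; case: ifP => // _.
    by rewrite ffunE.
  rewrite mulrAC ler_pdivrMr ?ltr_wpDl// ler_pM2l// lerDl//.
pose Dn := size (offsets d g dl rho).
have Dn0 : (0 < Dn)%N.
  have := offsets0 g_ninc dl0 rho0 d_gt1 unitp.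
  by rewrite /Dn; case: (offsets d g dl rho).
pose b := Dn.-1.
pose mu := \sum_(o <- offsets d g dl rho) offset_prob g dl o.
have muE : mu = \sum_(o <- box_seq rho (0 : {ffun 'I_d -> int})) g (dl * cell_dist R o).
  exact: sum_offsets.
have [p0 p01 p0min] := @offset_prob_min R d g dl rho.
(* A cell of side [dl * r] contains [c1 * ln n] points on average. *)
pose c1 := dl ^+ d * gamma / alpha d g.
have c10 : 0 < c1 by rewrite divr_gt0// mulr_gt0// exprn_gt0.
have mean_large : (1 - eps) * gamma <= c1 * (mu - 1).
  rewrite -muE in riem.
  rewrite /c1 mulrAC ler_pdivlMr// mulrAC [leRHS]mulrAC ler_pM2r//.
have mub : mu - 1 <= b%:R.
  by rewrite lerBlDr natr1 /b prednK//; exact: sum_offsets_le.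
pose L := box_radius d g dl rho.
pose Cb := (2 ^ (L.*2.+1 ^ d))%N.
have [C [Lam EB]] := @error_bound R gamma c1 eps mu p0 tau Dn b Cb eps12 tau0 c10 slack
  mean_large mub (leq_pred _) p01.
have d0 : 0 < d%:R :> R by rewrite ltr0n ltnW.
(* If the side of the cells is at most [eta1] then the mesh loses only a fraction
   [eps] of the volume, and boxes of radius [L] do not wrap around. *)
pose eta1 := Num.min (eps / d%:R) (L.*2.+1%:R)^-1.
have eta10 : 0 < eta1 by rewrite lt_min divr_gt0//= invr_gt0.
exists eps, tau, `|C|, (`|Lam| + 1 + 4 * c1 / eta1 ^+ d); split => //.
move=> n n1 hlam hC; set lam := ln n%:R in hlam hC *.
have q0 : 0 < 4 * c1 / eta1 ^+ d by apply: divr_gt0; [exact: mulr_gt0|exact: exprn_gt0].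
have Lam_lam : Lam <= lam.
  by have := ler_norm Lam; move: hlam q0; move: (4 * c1 / _) `|Lam| => ? ?; lra.
have lam1 : 1 <= lam.
  by have := normr_ge0 Lam; move: hlam q0; move: (4 * c1 / _) `|Lam| => ? ?; lra.
have lam0 : 0 < lam by apply: lt_le_trans lam1.
have lam_q : 4 * c1 / eta1 ^+ d <= lam.
  by have := normr_ge0 Lam; move: hlam q0; move: (4 * c1 / _) `|Lam| => ? ?; lra.
have n0 : 0 < n%:R :> R by rewrite ltr0n.
have nE : n%:R = expR lam by rewrite /lam lnK.
pose r := rhat d g gamma n.
have arg0 : 0 < gamma * lam / (alpha d g * n%:R) by rewrite divr_gt0// mulr_gt0.
have rd : r ^+ d = gamma * lam / (alpha d g * n%:R).
  by apply: rhat_expr; [exact: ltnW|exact: ltW].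
have rpos : 0 < r by exact: powR_gt0.
pose t := dl * r.
have t0 : 0 < t by exact: mulr_gt0.
have td : t ^+ d = c1 * lam / n%:R.
  rewrite /t exprMn rd /c1; field; rewrite !gt_eqF//.
have teta : t <= eta1.
  rewrite -(@ler_pXn2r _ d) ?nnegrE ?(ltW t0) ?(ltW eta10)//; last exact: ltnW.
  rewrite td -mulrA; apply: (@le_trans _ _ (c1 * (4 / lam))).
    by rewrite ler_pM2l// nE; exact: ratio_expR_le.
  rewrite mulrA ler_pdivrMr// [c1 * 4]mulrC -ler_pdivrMl ?exprn_gt0//.
  by rewrite [_ ^- d * _]mulrC.
have teps : d%:R * t <= eps.
  by rewrite mulrC -ler_pdivlMr//; apply: le_trans teta _; rewrite ge_min lexx.
have tL : L.*2.+1%:R * t <= 1.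
  by rewrite mulrC -ler_pdivlMr// div1r; apply: le_trans teta _; rewrite ge_min lexx orbT.
have [K [tK LK /andP[v1 v2]]] := mesh_exists t0 teps tL.
have K0 : 0 < K.+2%:R :> R by [].
have mesh : (K.+2%:R * r)^-1 <= dl.
  rewrite invf_ple ?posrE ?mulr_gt0//.
  by move: tK; rewrite /t invfM ler_pdivrMr.
have rhoK : (rho.*2 < K.+2)%N.
  by apply: leq_ltn_trans LK; rewrite leq_double; apply: leqW; exact: leq_addl.
pose T := {ffun 'I_d -> 'I_K.+2}.
have cardT : #|{: T}|%:R = K.+2%:R ^+ d :> R by rewrite card_ffun !card_ord natrX.
pose v : R := #|{: T}|%:R^-1.
have vE : v = (K.+2%:R ^+ d)^-1 by rewrite /v cardT.
have T0 : 0 < #|{: T}|%:R :> R by rewrite cardT exprn_gt0.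
have v0 : 0 < v by rewrite invr_gt0.
pose S : {set T} := @offset_set R d g dl rho K.
pose p : T -> R := @cell_prob R d g dl rho K.
have cardS : #|S| = Dn by exact: card_offset_set.
have DnT : Dn%:R * v <= 1 by rewrite /v ler_pdivrMr// mul1r ler_nat -cardS max_card.
have bv : b%:R * v <= 1.
  by apply: le_trans DnT; rewrite ler_pM2r// ler_nat leq_pred.
have muv : mu * v <= 1.
  by apply: le_trans DnT; rewrite ler_pM2r//; exact: sum_offsets_le.
have vn : (1 - eps) * c1 * lam <= v * n%:R <= c1 * lam.
  rewrite vE -ler_pdivrMr// -[X in _ && X]ler_pdivlMr// -td.
  by rewrite -mulrA -[(1 - eps) * _ / _]mulrA -td v1 v2.
pose k := cluster_size eps tau Dn lam.
have k0 : (0 < k)%N by [].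
have [M conc] := poisson_concentration n0 e0.
apply: (le_trans _ (conn_event_ge_sum rpos M
  (fun m => `|m%:R - n%:R| <= eps * n%:R) n1)).
apply: (@le_trans _ _ (\sum_(m < M | (`|(m : nat)%:R - n%:R| <= eps * n%:R)%R)
    ((1 - `|C| * expR (- (tau * lam))) * poisson_pmf n%:R m)%:E)%E).
  rewrite sumEFin lee_fin -mulr_sumr ler_wpM2l// subr_ge0//.
apply: lee_sum => m hm.
apply: (le_trans _ (connected_lower_bound dl0 rho0 unitp LK rpos mesh m n1 k0)).
rewrite lee_fin mulrC ler_wpM2l ?poisson_pmf_ge0//.
have s01 : 0 < eps <= 1 by rewrite e0 (le_trans (ltW e1))//; lra.
have p0u (u : T) : u \in S -> p0 <= p u.
  by move=> /offset_setP[v' v'D ->]; rewrite /p cell_prob_proj//; exact: p0min.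
have Fb (B : {set T}) : B \in @box_sets R d g dl rho K -> #|B| = b.
  by rewrite inE => /andP[/eqP].
have pu01 u : 0 <= p u <= 1 by exact: cell_prob01.
have pu_even u : p (- u) = p u by exact: cell_prob_even.
have := @good_probability R T p m pu01 pu_even
  (@box_sets R d g dl rho K) k.*2.-1 k S eps p0 b s01 (andP p01).2 p0u Fb.
apply: le_trans; rewrite lerD2l lerN2.
have mrange : (1 - eps) * n%:R <= m%:R <= (1 + eps) * n%:R.
  by move: hm; rewrite ler_norml => /andP[h1 h2]; apply/andP; split; lra.
have := EB lam n%:R v m k k.*2.-1 erefl erefl Lam_lam nE v0 bv muv vn mrange.
move=> EBm; apply: (@le_trans _ _ (C * expR (- (tau * lam)))); last first.
  by rewrite ler_wpM2r ?expR_ge0// ler_norm.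
apply: le_trans EBm; rewrite cardS.
have vinv : v^-1 = #|{: T}|%:R by rewrite /v invrK.
apply: lerD; first apply: lerD.
- rewrite vinv; apply: ler_wpM2r.
    rewrite mulr_ge0// exprn_ge0 ?invr_ge0 ?(ltW e0)// subr_ge0 mulr_ile1//.
    - by rewrite subr_ge0 (andP s01).2.
    - by rewrite gerBl ltW.
  by rewrite -natrM ler_nat mulnC; exact: card_box_sets.
- by rewrite vinv.
- by rewrite sum_cell_prob.
Qed.

End random_graph.

Theorem theorem1p3 (R : realType) (d : nat) (d_ge2 : (2 <= d)%N)
  (g : R -> R)
  (g01 : forall r : R, 0 <= r -> 0 <= g r <= 1)
  (g_ninc : forall r s : R, 0 <= r -> r <= s -> g s <= g r)
  (alpha_pos_fin : (0 < conn_integral d g < +oo)%E)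
  (disp : measure_display) (Omega : measurableType disp)
  (P : probability Omega R)
  (X : nat -> {RV P >-> d.-tuple R})
  (N : nat -> {RV P >-> nat})
  (U : nat -> nat -> {RV P >-> R})
  (X_unif : forall i (A : set (d.-tuple R)), measurable A ->
    distribution P (X i) A = lebesgueRd R d (A `&` torus_cube R d))
  (X_indep : mutually_independent P [set: nat] (fun i => events_of (X i)))
  (N_poisson : forall n k, (1 <= n)%N ->
    distribution P (N n) [set k] = (poisson_pmf (n%:R : R) k)%:E)
  (N_ndec : forall m n omega, (1 <= m <= n)%N -> (N m omega <= N n omega)%N)
  (U_unif : forall i j (A : set R), (i < j)%N -> measurable A ->
    distribution P (U i j) A = uniform_prob (@ltr01 R) A)
  (U_indep : mutually_independent P [set ij : nat * nat | (ij.1 < ij.2)%N]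
    (fun ij => events_of (U ij.1 ij.2)))
  (XNU_indep : mutually_independent P [set: 'I_3]
    (nth set0 [:: sigma_of [set: nat] X;
                  sigma_of [set n | (1 <= n)%N] N;
                  sigma_of [set ij : nat * nat | (ij.1 < ij.2)%N]
                    (fun ij => U ij.1 ij.2)]))
  (c : R) (c_gt_d : d%:R < c)
  (g_decay : g =o_ (pinfty_nbhs R) (fun r : R => r `^ (- c)))
  (gamma : R) (gamma_gt_beta : beta d g < gamma) :
  P [set omega | rcm_connected g (fun i => X i omega) (N n omega)
                   (fun i j => U i j omega) (rhat d g gamma n)]
    @[n --> \oo] --> 1%E.
Proof.
have gamma_gt1 : 1 < gamma.
  exact: le_lt_trans (beta_ge1 d_ge2 g01 g_ninc alpha_pos_fin) gamma_gt_beta.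
have [eps [tau [C [Lam [e0 t0 C0 H]]]]] := connectivity_rate d_ge2 g01 g_ninc X_unif
  X_indep N_poisson U_unif U_indep XNU_indep alpha_pos_fin gamma_gt1.
pose A n := conn_event g X N U (rhat d g gamma n) n.
have mA n : measurable (A n) by apply: measurable_conn_event => //; exact: powR_ge0.
have PA n : P (A n) \is a fin_num by exact: fin_num_measure.
apply/fine_cvgP; split; first by apply: nearW => n; exact: PA.
apply/cvgrPdist_le => eta eta0.
pose eta' := Num.min (eta / 2) 1.
have eta'0 : 0 < eta' by rewrite lt_min divr_gt0/=.
pose Lam' := Num.max Lam (C / (tau * eta')).
pose n0 := maxn (Num.truncn (expR Lam')).+1 (Num.truncn (4 / (eps ^+ 2 * eta))).+1.
exists n0 => // n /= n0n.
have n1 : (1 <= n)%N by apply: leq_trans n0n; rewrite leq_max.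
have n_gt0 : 0 < n%:R :> R by rewrite ltr0n.
have lam_ge : Lam' <= ln n%:R.
  rewrite -[Lam']expRK ler_ln ?posrE ?expR_gt0//.
  apply: le_trans (ltW (truncnS_gt _)) _; rewrite ler_nat.
  by apply: leq_trans n0n; rewrite leq_maxl.
have n_ge : 4 / (eps ^+ 2 * eta) <= n%:R.
  apply: le_trans (ltW (truncnS_gt _)) _; rewrite ler_nat.
  by apply: leq_trans n0n; rewrite leq_maxr.
have hC : C * expR (- (tau * ln n%:R)) <= eta'.
  by apply: expR_decay_le => //; apply: le_trans lam_ge; rewrite le_max lexx orbT.
have hC1 : C * expR (- (tau * ln n%:R)) <= 1 by apply: le_trans hC _; rewrite ge_min lexx orbT.
have hC2 : C * expR (- (tau * ln n%:R)) <= eta / 2 by apply: le_trans hC _; rewrite ge_min lexx.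
have Lam_le : Lam <= ln (n%:R : R) by apply: le_trans lam_ge; rewrite le_max lexx.
have := H n n1 Lam_le hC1; rewrite -[P _]fineK ?lee_fin; last exact: PA.
have h2 : 2 / (eps ^+ 2 * n%:R) <= eta / 2.
  rewrite ler_pdivrMr ?mulr_gt0 ?exprn_gt0//.
  move: n_ge; rewrite ler_pdivrMr ?mulr_gt0 ?exprn_gt0// => n_ge.
  have -> : eta / 2 * (eps ^+ 2 * n%:R) = (n%:R * (eps ^+ 2 * eta)) / 2 by field.
  by rewrite ler_pdivlMr//; lra.
have h2_0 : 0 <= 2 / (eps ^+ 2 * n%:R) by rewrite divr_ge0// mulr_ge0// ?sqr_ge0.
have hC0 : 0 <= C * expR (- (tau * ln n%:R)) by rewrite mulr_ge0// expR_ge0.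
have PA1 : fine (P (A n)) <= 1.
  by rewrite -lee_fin fineK//; exact: probability_le1.
move: hC0 hC1 hC2 h2 h2_0; set u := C * _; set v := 2 / _ => u0 u1 u2 v1 v0 lb.
rewrite ger0_norm ?subr_ge0//.
have uv : 0 <= u * v by rewrite mulr_ge0.
by rewrite /=; move: lb; rewrite -/(A n) mulrBl mul1r mulrBr mulr1; lra.
Qed.
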